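(* Let $A_{\mathbb R}$ be a quiver of continuous type $A$ and $k$ a field. Then the following hold. (1) For indecomposable representations $M_I$ and $M_J$ in $\mathrm{Rep}_k^{\mathrm{pwf}}(A_{\mathbb R})$, $\mathrm{Rep}_k^{\mathrm{b}}(A_{\mathbb R})$, or $\mathrm{rep}_k(A_{\mathbb R})$, either $\operatorname{Hom}(M_I,M_J)\cong k$ or $\operatorname{Hom}(M_I,M_J)=0$. (2) Every morphism $f:V\to W$ in $\mathrm{Rep}_k^{\mathrm{pwf}}(A_{\mathbb R})$, $\mathrm{Rep}_k^{\mathrm{b}}(A_{\mathbb R})$, or $\mathrm{rep}_k(A_{\mathbb R})$ has a kernel, a cokernel, and coinciding image and coimage in that category. (3) The category $\mathrm{rep}_k(A_{\mathbb R})$ is Krull–Schmidt, but it is not artinian. (4) The global dimension of $\mathrm{rep}_k(A_{\mathbb R})$ is $1$. (5) For two indecomposables $M_I$ and $M_J$ in $\mathrm{Rep}_k^{\mathrm{pwf}}(A_{\mathbb R})$, $\mathrm{Rep}_k^{\mathrm{b}}(A_{\mathbb R})$, or $\mathrm{rep}_k(A_{\mathbb R})$, the space $\operatorname{Ext}^1(M_I,M_J)$ is either isomorphic to $k$ or is $0$. (6) There exist Auslander–Reiten sequences in $\mathrm{rep}_k(A_{\mathbb R})$, but there are indecomposable objects $X$ of $\mathrm{rep}_k(A_{\mathbb R})$ for which there is neither an Auslander–Reiten sequence of the form $0\to X\to B\to C\to 0$ nor one of the form $0\to A\to B\to X\to 0$ in $\mathrm{rep}_k(A_{\mathbb R})$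.
   Context: A quiver of continuous type $A$, $A_{\mathbb R}=(\mathbb R,S,\preceq)$: $S\subset\mathbb R$ is a discrete, possibly empty, subset with no accumulation points; $\bar S=S\cup\{\pm\infty\}$ with $-\infty<s<+\infty$ for $s\in S$. Elements of $\bar S$ are indexed in an order-preserving way by a subset of $\mathbb Z\cup\{\pm\infty\}$ such that the index $0$ is used, and if $m\le p\le n$ in $\mathbb Z\cup\{\pm\infty\}$ and the indices $m,n$ are used then so is $p$ (so neighbours in $\bar S$ have consecutive integer indices; if $S$ is bounded above, $+\infty$ has an integer index, otherwise $+\infty=s_{+\infty}$; similarly for $-\infty$). The partial order $\preceq$ on $\mathbb R$: $x\preceq y$ iff $x=y$ or there are consecutive $s_n,s_{n+1}\in\bar S$ with $s_n\le x,y\le s_{n+1}$ and [$x\le y$ if $n$ is even; $y\le x$ if $n$ is odd]. So $s_n$ is a sink for $n$ even and a source for $n$ odd. A representation $V$ of $A_{\mathbb R}$ over $k$ assigns to each $x\in\mathbb R$ a $k$-vector space $V(x)$ and to each pair $y\preceq x$ a linear map $V(x,y):V(x)\to V(y)$ with $V(x,x)=\mathrm{id}$ and $V(y,z)\circ V(x,y)=V(x,z)$ for $z\preceq y\preceq x$. Morphisms are families of linear maps $f(x):V(x)\to W(x)$ commuting with the structure maps. For an interval (nonempty connected subset) $I\subseteq\mathbb R$, $M_I$ is given by $M_I(x)=k$ if $x\in I$ and $0$ otherwise; $M_I(x,y)=1_k$ if $y\preceq x$ and $x,y\in I$, and $0$ otherwise. $\mathrm{Rep}_k^{\mathrm{pwf}}(A_{\mathbb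 R})$: full subcategory of representations $V$ with $\dim V(x)<\infty$ for all $x$. $\mathrm{Rep}_k^{\mathrm{b}}(A_{\mathbb R})$: full subcategory of representations $V$ for which there is $n\in\mathbb N$ with $\dim V(x)<n$ for all $x$. $\mathrm{rep}_k(A_{\mathbb R})$ (finitely generated representations): full subcategory of those $V$ in $\mathrm{Rep}_k^{\mathrm{pwf}}(A_{\mathbb R})$ admitting an epimorphism from a finite direct sum of indecomposable projective objects of $\mathrm{Rep}_k^{\mathrm{pwf}}(A_{\mathbb R})$. Up to isomorphism these indecomposable projectives are the nonzero ones among the interval representations $M_I$ with $I=\{x\in\mathbb R: x\preceq a\}$ ($a\in\mathbb R$), $I=\{x\in\mathbb R: x\preceq a,\ x<a\}$, or $I=\{x\in\mathbb R: x\preceq a,\ x>a\}$ ($a\in\mathbb R\cup\{\pm\infty\}$), where $x\preceq+\infty$ means $+\infty=s_{n+1}$ with $n$ an even integer and $s_n\le x$, and $x\preceq-\infty$ means $-\infty=s_n$ with $n$ an odd integer and $x\le s_{n+1}$. An abelian category is artinian if every object satisfies the descending chain condition on subobjects. A short exact sequence $0\to U\xrightarrow{f}V\xrightarrow{g}W\to0$ in an abelian category is an Auslander–Reiten sequence if: $f$ is not a section and $g$ is not a retraction; $U$ and $W$ are indecomposable; every nonzero morphism $h:U\to X$ with $X$ indecomposable and $X\not\cong U$ factors through $f$; every nonzero morphism $h:X\to W$ with $X$ indecomposable and $X\not\cong W$ factors through $g$. *)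

(* Defs.v *)
From HB Require Import structures.
From mathcomp Require Import all_boot all_order all_algebra.
From mathcomp Require Import all_classical all_reals all_analysis.

Set Implicit Arguments.
Unset Strict Implicit.
Unset Printing Implicit Defensive.

Import Order.TTheory GRing.Theory Num.Theory.
Import numFieldNormedType.Exports.
Local Open Scope classical_set_scope.
Local Open Scope ring_scope.

(* [S] together with the indexing of its completion by -oo and +oo.
   [qidx] is the set of indices in use; [qpt] is only meaningful on [qidx].
   That +oo (resp. -oo) has an integer index exactly when [S] is bounded above
   (resp. below) follows from the fields below. *)
Record quiverA (R : realType) := QuiverA {
  qS : set R;
  qS_noacc : limit_point qS = set0;
  qidx : set (\bar int);
  qpt : \bar int -> \bar R;
  qidx0 : qidx 0%E;
  qidx_convex : forall m p n, qidx m -> qidx n ->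
    (m <= p)%E -> (p <= n)%E -> qidx p;
  qpt_mono : forall m n, qidx m -> qidx n -> (qpt m <= qpt n)%E = (m <= n)%E;
  qpt_img : qpt @` qidx = (EFin @` qS) `|` [set -oo%E; +oo%E]
}.

Section Quiver.
Variables (R : realType) (A : quiverA R).

Definition segment (n : int) (x : R) : Prop :=
  [/\ qidx A n%:E, qidx A (n + 1)%:E,
      (qpt A n%:E <= x%:E)%E & (x%:E <= qpt A (n + 1)%:E)%E].

Definition preceq (x y : R) : Prop :=
  x = y \/ exists n : int, [/\ segment n x, segment n y &
    if odd (absz n) then y <= x else x <= y].

Lemma segment_eq (m n : int) (y : R) : m < n -> segment m y -> segment n y ->
  n = m + 1 /\ qpt A n%:E = y%:E.
Proof.
move=> mn [m0 m1 my ym] [n0 n1 ny yn].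
have h : (qpt A n%:E <= qpt A (m + 1)%:E)%E by exact: le_trans ny ym.
have nm : n = m + 1.
  apply/eqP; rewrite eq_le lezD1 mn andbT.
  by move: h; rewrite (qpt_mono n0 m1) lee_fin.
by split=> //; apply/eqP; rewrite eq_le ny /= nm.
Qed.

Lemma preceq_between (x y z : R) : preceq z y -> preceq y x ->
  (z <= y <= x) \/ (x <= y <= z).
Proof.
case=> [->|[m [zm ym zy]]].
  case=> [->|[n [_ _]]]; first by left; rewrite lexx.
  by case: ifP => _ h; [right|left]; rewrite h lexx.
case=> [<-|[n [yn xn yx]]].
  by move: zy; case: ifP => _ h; [right|left]; rewrite h lexx.
have [mn|nm|E] := ltgtP m n.
- have [E e] := segment_eq mn ym yn.
  have [_ _ _ zle] := zm; have [_ _ xge _] := xn.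
  left; move: zle xge; rewrite -E e !lee_fin => -> ->.
  by [].
- have [E e] := segment_eq nm yn ym.
  have [_ _ zge _] := zm; have [_ _ _ xle] := xn.
  by right; move: zge xle; rewrite -E e !lee_fin => -> ->.
- move: zy yx; rewrite E; case: ifP => _ -> ->; [by right|by left].
Qed.

End Quiver.

Section Representations.
Variables (R : realType) (A : quiverA R) (k : fieldType).

Record qrep := QRep {
  robj :> R -> lmodType k;
  rmap : forall x y : R, preceq A y x -> {linear robj x -> robj y};
  rmap_id : forall x (h : preceq A x x) v, rmap h v = v;
  rmap_comp : forall x y z (hyx : preceq A y x) (hzy : preceq A z y)
    (hzx : preceq A z x) v, rmap hzy (rmap hyx v) = rmap hzx v
}.

Record rhom (V W : qrep) := Hom {
  hmap :> forall x, V x -> W x;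
  hmap_linear : forall x, linear (@hmap x);
  hmap_nat : forall x y (h : preceq A y x) v,
    hmap (rmap V h v) = rmap W h (hmap v)
}.

Lemma homP (V W : qrep) (f g : rhom V W) : (forall x v, f x v = g x v) -> f = g.
Proof.
case: f g => [f fl fn] [g gl gn] /= e.
have E : f = g by apply: functional_extensionality_dep => x; apply/funext => v.
by subst g; congr Hom; apply: Prop_irrelevance.
Qed.

HB.instance Definition _ (V W : qrep) := gen_eqMixin (rhom V W).
HB.instance Definition _ (V W : qrep) := gen_choiceMixin (rhom V W).

Section HomModule.
Variables V W : qrep.
Implicit Types (f g : rhom V W) (a : k).

Program Definition hom_zero : rhom V W := @Hom V W (fun x _ => 0) _ _.
Next Obligation. by move=> x a u v; rewrite scaler0 addr0. Qed.
Next Obligation. by move=> x y h v /=; rewrite linear0. Qed.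

Program Definition hom_opp f : rhom V W := @Hom V W (fun x v => - f x v) _ _.
Next Obligation.
by move=> f x a u v; rewrite hmap_linear opprD scalerN.
Qed.
Next Obligation. by move=> f x y h v /=; rewrite hmap_nat linearN. Qed.

Program Definition hom_add f g : rhom V W :=
  @Hom V W (fun x v => f x v + g x v) _ _.
Next Obligation.
by move=> f g x a u v; rewrite !hmap_linear scalerDr addrACA.
Qed.
Next Obligation. by move=> f g x y h v /=; rewrite !hmap_nat linearD. Qed.

Program Definition hom_scale a f : rhom V W :=
  @Hom V W (fun x v => a *: f x v) _ _.
Next Obligation.
by move=> a f x b u v; rewrite hmap_linear scalerDr !scalerA mulrC.
Qed.
Next Obligation. by move=> a f x y h v /=; rewrite hmap_nat linearZ. Qed.

Fact hom_addA : associative hom_add.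
Proof. by move=> f g h; apply: homP => x v /=; rewrite addrA. Qed.
Fact hom_addC : commutative hom_add.
Proof. by move=> f g; apply: homP => x v /=; rewrite addrC. Qed.
Fact hom_add0 : left_id hom_zero hom_add.
Proof. by move=> f; apply: homP => x v /=; rewrite add0r. Qed.
Fact hom_addN : left_inverse hom_zero hom_opp hom_add.
Proof. by move=> f; apply: homP => x v /=; rewrite addNr. Qed.

HB.instance Definition _ :=
  GRing.isZmodule.Build (rhom V W) hom_addA hom_addC hom_add0 hom_addN.

Fact hom_scaleA a b f : hom_scale a (hom_scale b f) = hom_scale (a * b) f.
Proof. by apply: homP => x v /=; rewrite scalerA. Qed.
Fact hom_scale1 : left_id 1 hom_scale.
Proof. by move=> f; apply: homP => x v /=; rewrite scale1r. Qed.
Fact hom_scaleDr : right_distributive hom_scale +%R.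
Proof. by move=> a f g; apply: homP => x v /=; rewrite scalerDr. Qed.
Fact hom_scaleDl f : {morph hom_scale^~ f : a b / a + b}.
Proof. by move=> a b; apply: homP => x v /=; rewrite scalerDl. Qed.

HB.instance Definition _ := GRing.Zmodule_isLmodule.Build k (rhom V W)
  hom_scaleA hom_scale1 hom_scaleDr hom_scaleDl.

End HomModule.

Program Definition idh (V : qrep) : rhom V V := @Hom V V (fun x v => v) _ _.
Next Obligation. by []. Qed.
Next Obligation. by []. Qed.

Program Definition comph (U V W : qrep) (g : rhom V W) (f : rhom U V) : rhom U W :=
  @Hom U W (fun x v => g x (f x v)) _ _.
Next Obligation. by move=> U V W g f x a u v; rewrite !hmap_linear. Qed.
Next Obligation. by move=> U V W g f x y h v /=; rewrite !hmap_nat. Qed.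

Program Definition rep0 : qrep :=
  @QRep (fun=> 'rV[k]_0 : lmodType k) (fun x y _ => idfun) _ _.
Next Obligation. by []. Qed.
Next Obligation. by []. Qed.

Section PairMap.
Variables (U V U' V' : lmodType k) (f : {linear U -> U'}) (g : {linear V -> V'}).
Definition pair_map (v : U * V) : U' * V' := (f v.1, g v.2).
Fact pair_map_linear : linear pair_map.
Proof. by move=> a [u1 u2] [v1 v2]; rewrite /pair_map /= !linearP. Qed.
HB.instance Definition _ :=
  GRing.isLinear.Build k (U * V)%type (U' * V')%type _ pair_map pair_map_linear.
End PairMap.

Program Definition dsum (V W : qrep) : qrep :=
  @QRep (fun x => (V x * W x)%type : lmodType k)
        (fun x y h => pair_map (rmap V h) (rmap W h)) _ _.
Next Obligation. by move=> V W x h [v w]; rewrite /= /pair_map /= !rmap_id. Qed.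
Next Obligation.
move=> V W x y z h1 h2 h3 [v w].
by rewrite /= /pair_map /= (rmap_comp h1 h2 h3) (rmap_comp h1 h2 h3).
Qed.

Definition dsums (n : nat) (V : 'I_n -> qrep) : qrep :=
  \big[dsum/rep0]_(i < n) V i.

Program Definition dsumh (V W V' W' : qrep) (f : rhom V V') (g : rhom W W') :
  rhom (dsum V W) (dsum V' W') :=
  @Hom (dsum V W) (dsum V' W') (fun x v => (f x v.1, g x v.2)) _ _.
Next Obligation.
by move=> V W V' W' f g x a [u1 u2] [v1 v2] /=; rewrite !hmap_linear.
Qed.
Next Obligation.
by move=> V W V' W' f g x y h [v w] /=; rewrite /pair_map /= !hmap_nat.
Qed.

Program Definition diagh (V : qrep) : rhom V (dsum V V) :=
  @Hom V (dsum V V) (fun x v => (v, v)) _ _.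
Next Obligation. by []. Qed.
Next Obligation. by []. Qed.

Program Definition codiagh (V : qrep) : rhom (dsum V V) V :=
  @Hom (dsum V V) V (fun x v => v.1 + v.2) _ _.
Next Obligation.
by move=> V x a [u1 u2] [v1 v2] /=; rewrite scalerDr addrACA.
Qed.
Next Obligation. by move=> V x y h [v w] /=; rewrite linearD. Qed.

Definition kif (b : bool) : lmodType k :=
  if b then (k^o : lmodType k) else ('rV[k]_0 : lmodType k).

Definition kif_map (b c : bool) : {linear kif b -> kif c} :=
  match b, c return {linear kif b -> kif c} with
  | true, true => idfun
  | _, _ => \0
  end.

Definition interval_set (I : set R) : Prop := I !=set0 /\ connected I.

Program Definition Mint (I : set R) (hI : interval_set I) : qrep :=
  @QRep (fun x => kif (x \in I)) (fun x y _ => kif_map (x \in I) (y \in I)) _ _.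
Next Obligation.
move=> I hI x h; rewrite /kif_map; case: (x \in I) => //= v.
by apply/rowP => -[].
Qed.
Next Obligation.
move=> I [I0 Ic] x y z hyx hzy hzx.
have : x \in I -> z \in I -> y \in I.
  rewrite !inE => Ix Iz.
  have /connected_intervalP Ii := Ic.
  by case: (preceq_between hzy hyx) => hb; [apply: Ii Iz Ix _ hb|apply: Ii Ix Iz _ hb].
case: (x \in I) (y \in I) (z \in I) => -[] [] // h v; do ?by rewrite /= ?linear0.
by have := h isT isT.
Qed.

Definition has_dim (U : lmodType k) (n : nat) : Prop :=
  exists f : {linear U -> 'rV[k]_n}, bijective f.

(* Full subcategories are predicates on representations. *)
Implicit Type C : qrep -> Prop.

Definition isoh (V W : qrep) (f : rhom V W) : Prop :=
  exists g : rhom W V, comph g f = idh V /\ comph f g = idh W.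

Definition isomorphic (V W : qrep) : Prop := exists f : rhom V W, isoh f.

Definition section (V W : qrep) (f : rhom V W) : Prop :=
  exists r : rhom W V, comph r f = idh V.

Definition retraction (V W : qrep) (f : rhom V W) : Prop :=
  exists s : rhom W V, comph f s = idh W.

Definition monoh C (V W : qrep) (f : rhom V W) : Prop :=
  forall X (g h : rhom X V), C X -> comph f g = comph f h -> g = h.

Definition epih C (V W : qrep) (f : rhom V W) : Prop :=
  forall X (g h : rhom W X), C X -> comph g f = comph h f -> g = h.

Definition is_kernel C (V W : qrep) (f : rhom V W) (K : qrep) (i : rhom K V) :=
  [/\ C K, comph f i = 0 &
      forall X (g : rhom X V), C X -> comph f g = 0 ->
        exists! h : rhom X K, comph i h = g].

Definition is_cokernel C (V W : qrep) (f : rhom V W) (Q : qrep) (q : rhom W Q) :=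
  [/\ C Q, comph q f = 0 &
      forall X (g : rhom W X), C X -> comph g f = 0 ->
        exists! h : rhom Q X, comph h q = g].

(* The image is a kernel [m] of the cokernel [q]; the coimage is a cokernel [c]
   of the kernel [i]; [u] is the comparison morphism. *)
Definition has_ker_coker_im C (V W : qrep) (f : rhom V W) : Prop :=
  exists (K Q Im Coim : qrep) (i : rhom K V) (q : rhom W Q)
         (m : rhom Im W) (c : rhom V Coim),
    [/\ is_kernel C f i, is_cokernel C f q, is_kernel C q m, is_cokernel C i c &
        exists u : rhom Coim Im, comph m (comph u c) = f /\ isoh u].

Definition is_zero (V : qrep) : Prop := forall x (v : V x), v = 0.

Definition indecomposable C (V : qrep) : Prop :=
  [/\ C V, ~ is_zero V &
      forall V1 V2, C V1 -> C V2 -> isomorphic V (dsum V1 V2) ->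
        is_zero V1 \/ is_zero V2].

Definition projective C (P : qrep) : Prop :=
  C P /\ forall V W (e : rhom V W) (f : rhom P W), C V -> C W -> epih C e ->
    exists g : rhom P V, comph e g = f.

Definition Rep_pwf (V : qrep) : Prop := forall x, exists n, has_dim (V x) n.

Definition Rep_b (V : qrep) : Prop :=
  exists n : nat, forall x, exists2 m : nat, (m < n)%N & has_dim (V x) m.

Definition rep_fg (V : qrep) : Prop :=
  Rep_pwf V /\ exists (n : nat) (P : 'I_n -> qrep),
    (forall i, projective Rep_pwf (P i) /\ indecomposable Rep_pwf (P i)) /\
    exists f : rhom (dsums P) V, epih Rep_pwf f.

Definition local_end (V : qrep) : Prop :=
  idh V <> 0 /\
  forall f g : rhom V V, ~ isoh f -> ~ isoh g -> ~ isoh (f + g).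

Definition krull_schmidt C : Prop :=
  (forall n (V : 'I_n -> qrep), (forall i, C (V i)) -> C (dsums V)) /\
  forall V, C V -> exists (n : nat) (X : 'I_n -> qrep),
    (forall i, C (X i) /\ local_end (X i)) /\ isomorphic V (dsums X).

Definition artinian_obj C (V : qrep) : Prop :=
  forall (U : nat -> qrep) (i : forall n, rhom (U n) V),
    (forall n, C (U n) /\ monoh C (i n)) ->
    (forall n, exists h : rhom (U n.+1) (U n), comph (i n) h = i n.+1) ->
    exists N, forall n, (N <= n)%N ->
      exists h : rhom (U N) (U n), comph (i n) h = i N.

Definition artinian C : Prop := forall V, C V -> artinian_obj C V.

Definition ses C (U V W : qrep) (f : rhom U V) (g : rhom V W) : Prop :=
  [/\ C U, C V, C W, is_kernel C g f & is_cokernel C f g].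

(* Existence of a projective resolution 0 -> P_n -> ... -> P_0 -> V -> 0 in [C],
   cut into short exact sequences. *)
Fixpoint pd_le C (n : nat) (V : qrep) : Prop :=
  match n with
  | 0%N => projective C V
  | n'.+1 => exists (K P : qrep) (i : rhom K P) (p : rhom P V),
      [/\ ses C i p, projective C P & pd_le C n' K]
  end.

Definition gldim_eq C (d : nat) : Prop :=
  (forall V, C V -> pd_le C d V) /\
  (forall n, (forall V, C V -> pd_le C n V) -> (d <= n)%N).

Record extension C (W U : qrep) := Extension {
  emid : qrep;
  einj : rhom U emid;
  eproj : rhom emid W;
  eses : ses C einj eproj
}.

Definition ext_equiv C (W U : qrep) (E E' : extension C W U) : Prop :=
  exists b : rhom (emid E) (emid E'),
    comph b (einj E) = einj E' /\ comph (eproj E') b = eproj E.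

(* [E'] is the pushout of [E] along multiplication by [a] on [U]. *)
Definition ext_scale C (W U : qrep) (a : k) (E E' : extension C W U) : Prop :=
  exists b : rhom (emid E) (emid E'),
    comph b (einj E) = comph (einj E') (a *: idh U) /\
    comph (eproj E') b = eproj E.

(* [E3] is the pushout along the codiagonal of [U] of an extension [D], itself
   the pullback along the diagonal of [W] of the direct sum of [E1] and [E2]. *)
Definition ext_baer C (W U : qrep) (E1 E2 E3 : extension C W U) : Prop :=
  exists (D : extension C W (dsum U U))
         (b : rhom (emid D) (dsum (emid E1) (emid E2)))
         (c : rhom (emid D) (emid E3)),
    [/\ comph b (einj D) = dsumh (einj E1) (einj E2),
        comph (dsumh (eproj E1) (eproj E2)) b = comph (diagh W) (eproj D),
        comph c (einj D) = comph (einj E3) (codiagh U) &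
        comph (eproj E3) c = eproj D].

(* Yoneda's Ext^1(W, U) in [C] is isomorphic to the vector space [E].  The
   extensions form a type too large to carry a quotient in [lmodType k], so the
   isomorphism is given on representatives. *)
Definition Ext1_iso C (W U : qrep) (E : lmodType k) : Prop :=
  exists phi : extension C W U -> E,
    [/\ forall e e', phi e = phi e' <-> ext_equiv e e',
        forall v, exists e, phi e = v,
        forall e1 e2 e3, phi e3 = phi e1 + phi e2 <-> ext_baer e1 e2 e3 &
        forall a e e', phi e' = a *: phi e <-> ext_scale a e e'].

Definition AR_sequence C (U V W : qrep) (f : rhom U V) (g : rhom V W) : Prop :=
  [/\ ses C f g, ~ section f /\ ~ retraction g,
      indecomposable C U /\ indecomposable C W,
      forall X (h : rhom U X), indecomposable C X -> ~ isomorphic X U ->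
        h <> 0 -> exists h' : rhom V X, comph h' f = h &
      forall X (h : rhom X W), indecomposable C X -> ~ isomorphic X W ->
        h <> 0 -> exists h' : rhom X V, comph g h' = h].

End Representations.

Definition lmod_iso (k : fieldType) (U V : lmodType k) : Prop :=
  exists f : {linear U -> V}, bijective f.

Arguments Rep_pwf {R A k} V.
Arguments Rep_b {R A k} V.
Arguments rep_fg {R A k} V.
Arguments Mint {R} A k {I} hI.

(* Main.v *)
(* No decomposition theorem is used.  In the category of pointwise
   finite-dimensional representations, M_I is projective when I is a principal
   downset or a downset inside one segment: an epimorphism V -> M_I splits
   because the images of V along a cofinal sequence in I stabilise.  A nonzero
   functional shows that there are no other indecomposable projectives, and a
   subrepresentation of a finite sum of these M_I is again such a sum.  Hence
   the finitely generated representations are closed under subobjects,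
   quotients and extensions, and have projective dimension at most 1; kernels
   and cokernels are then pointwise in all three categories.  The
   Krull-Schmidt property follows from Fitting's lemma, Hom(P, V) being
   finite-dimensional for P a finite sum of the M_I.  Extensions of M_I by M_J
   correspond to scalar cocycles; on the intersection K of I and J a cocycle has
   a potential, unique up to a constant, so that only the constants at the two
   ends of K remain and Ext^1 has dimension at most 1.  For b < a inside a
   segment, 0 -> M_[b,a) -> M_[b,a] + M_(b,a) -> M_(b,a] -> 0 is an
   Auslander-Reiten sequence, whereas none starts or ends at M_{b}, since maps
   into M_[b,a'] (from M_[b',b]) with a' (b') tending to b become stable. *)
Require Import Defs.
From HB Require Import structures.
From mathcomp Require Import all_boot all_order all_algebra.
From mathcomp Require Import all_classical all_reals all_analysis.
From mathcomp Require Import ring lra zify.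

Set Implicit Arguments.
Unset Strict Implicit.
Unset Printing Implicit Defensive.

Import Order.TTheory GRing.Theory Num.Theory.
Import numFieldNormedType.Exports.
Local Open Scope classical_set_scope.
Local Open Scope ring_scope.

(** * Finite-dimensional linear algebra *)

(** The representations have infinite total dimension, so finiteness is available only at one point
    or in one Hom space. Two devices exploit it: a chain of subspaces of a finite-dimensional space
    has an extreme member ([chain_min], [chain_max]), and Hom(P, V) serves as a substitute for the
    length of V. A lift over a support without largest element is built by recursion along a
    countable cofinal sequence, which the rationals supply. All order arguments rest on one fact: a
    chain z ⪯ y ⪯ x cannot cross a sink or a source, so it lies in a single segment. Hence the order
    is total above a point that is not a sink and below a point that is not a source. The three
    categories enter only through their closure under subobjects, quotients and extensions
    ([serre]), which makes exactness pointwise. For overlapping intervals, Ext^1 is at most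
    one-dimensional because the free constant of the potential absorbs one of the two end constants;
    for disjoint intervals a cocycle is itself a single constant. *)

Section LinearAlgebra.
Variable k : fieldType.
Implicit Types U V W : lmodType k.

Definition mklin U V (f : U -> V) (hf : linear f) : {linear U -> V} :=
  HB.pack f (GRing.isLinear.Build k U V *:%R f hf).

Lemma mklinE U V (f : U -> V) (hf : linear f) : mklin hf = f :> (U -> V).
Proof. by []. Qed.

Lemma lin0 U V (f : U -> V) : linear f -> f 0 = 0.
Proof. by move=> hf; rewrite -(mklinE hf) linear0. Qed.

Lemma linD U V (f : U -> V) : linear f -> {morph f : u v / u + v}.
Proof. by move=> hf u v; rewrite -(mklinE hf) linearD. Qed.

Lemma linB U V (f : U -> V) : linear f -> {morph f : u v / u - v}.
Proof. by move=> hf u v; rewrite -(mklinE hf) linearB. Qed.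

Lemma linZ U V (f : U -> V) : linear f -> forall a, {morph f : u / a *: u}.
Proof. by move=> hf a u; rewrite -(mklinE hf) linearZ. Qed.

Lemma lin_inj U V (f : U -> V) : linear f ->
  (forall u, f u = 0 -> u = 0) -> injective f.
Proof.
move=> hf h u v e; apply/eqP; rewrite -subr_eq0; apply/eqP/h.
by rewrite (linB hf) e subrr.
Qed.

Definition lin_subspace U (S : set U) :=
  S 0 /\ forall a u v, S u -> S v -> S (a *: u + v).

Lemma subspaceD U (S : set U) : lin_subspace S -> forall u v, S u -> S v -> S (u + v).
Proof. by move=> [_ h] u v Su Sv; have := h 1 u v Su Sv; rewrite scale1r. Qed.

Lemma subspaceZ U (S : set U) : lin_subspace S -> forall a u, S u -> S (a *: u).
Proof. by move=> [h0 h] a u Su; have := h a u 0 Su h0; rewrite addr0. Qed.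

Lemma subspace_sum U (S : set U) n (F : 'I_n -> U) :
  lin_subspace S -> (forall i, S (F i)) -> S (\sum_i F i).
Proof.
by move=> hS h; apply: big_ind => //; [case: hS|apply: subspaceD].
Qed.

Lemma subspace_ker U V (f : U -> V) : linear f -> lin_subspace [set u | f u = 0].
Proof.
move=> hf; split=> [|a u v /= hu hv]; first exact: (lin0 hf).
by rewrite hf hu hv scaler0 addr0.
Qed.

Lemma subspace_im U V (f : U -> V) : linear f -> lin_subspace (range f).
Proof.
move=> hf; split=> [|a _ _ [u _ <-] [v _ <-]]; first by exists 0; rewrite ?(lin0 hf).
by exists (a *: u + v); rewrite ?hf.
Qed.

(** Take a row-free matrix with rows in [S] and as many rows as possible: a vector of [S] outside
    its row space could be appended as a further row. *)
Lemma subspace_mx n (S : set 'rV[k]_n) : lin_subspace S ->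
  exists (r : nat) (A : 'M[k]_(r, n)), row_free A /\ forall v, S v <-> (v <= A)%MS.
Proof.
move=> hS.
pose P r := `[< exists A : 'M[k]_(r, n), row_free A /\ forall i, S (row i A) >].
have P0 : exists r, P r.
  exists 0%N; apply/asboolP; exists 0; split; last by case.
  by rewrite /row_free mxrank0.
have Pn r : P r -> (r <= n)%N.
  by move=> /asboolP[A [/eqP Ar _]]; rewrite -Ar rank_leq_col.
case: (ex_maxnP P0 Pn) => r /asboolP[A [Af AS]] rmax.
exists r, A; split=> // v; split=> [Sv|/submxP[u ->]]; last first.
  rewrite mulmx_sum_row; apply: subspace_sum => // i.
  exact: subspaceZ.
apply: contrapT => /negP nv.
suff /rmax : P r.+1 by rewrite ltnn.
apply/asboolP; rewrite -addn1; exists (col_mx A v); split.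
  rewrite /row_free -addsmxE.
  have v0 : v != 0 by apply: contraNneq nv => ->; rewrite sub0mx.
  have := mxrank_sum_cap A v.
  have -> : (\rank (A :&: v)%MS = 0)%N.
    apply/eqP; rewrite mxrank_eq0; apply: contraNT nv => hcap.
    have h1 : \rank (A :&: v)%MS = \rank v.
      apply/eqP; rewrite eqn_leq mxrankS ?capmxSr //= rank_rV v0.
      by rewrite lt0n mxrank_eq0.
    have : (v <= A :&: v)%MS by rewrite -(geq_leqif (mxrank_leqif_sup (capmxSr A v))) h1.
    by move=> /submx_trans; apply; apply: capmxSl.
  by rewrite addn0 rank_rV v0 (eqP Af) => ->.
move=> i; rewrite -(splitK i); case: (fintype.split i) => j /=.
  by rewrite rowKu.
by rewrite rowKd; have -> : row j v = v by apply/rowP => l; rewrite mxE ord1.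
Qed.

(** Only an upper bound on the dimension. In this form it passes to subspaces by mere composition,
    and no inverse map has to be carried along. *)
Definition findim U n := exists2 f : U -> 'rV[k]_n, linear f & injective f.

Lemma findim_inj U V (f : U -> V) n : linear f -> injective f ->
  findim V n -> findim U n.
Proof.
move=> hf fi [g hg gi]; exists (g \o f); last exact: inj_comp.
by move=> a u v /=; rewrite hf hg.
Qed.

Lemma has_dim_findim U n : has_dim U n -> findim U n.
Proof. by move=> [f /bij_inj fi]; exists f => //; apply: linearP. Qed.

Lemma findim_has_dim U n : findim U n -> exists2 m, (m <= n)%N & has_dim U m.
Proof.
move=> [f hf fi]; have [r [A [Af AS]]] := subspace_mx (subspace_im hf).
exists r; first by rewrite -(eqP Af) rank_leq_col.
have hl : linear (fun u => f u *m pinvmx A).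
  by move=> a u v; rewrite hf mulmxDl scalemxAl.
have fA u : (f u <= A)%MS by apply/AS; exists u.
exists (mklin hl).
have hg v : {u | f u = v *m A}.
  by apply: cid; have [|u _ <-] := (AS (v *m A)).2; [exact: submxMl|exists u].
exists (fun v => sval (hg v)) => [u|v] /=.
  by apply: fi; case: (hg _) => u' /= ->; rewrite mulmxKpV.
case: (hg v) => u' /= ->; rewrite -mulmxA.
by rewrite mulmxVp // mulmx1.
Qed.

Lemma findim_prod U V n m : findim U n -> findim V m ->
  findim (U * V)%type (n + m).
Proof.
move=> [f hf fi] [g hg gi]; exists (fun w => row_mx (f w.1) (g w.2)).
  move=> a [u1 v1] [u2 v2] /=; rewrite hf hg.
  by rewrite scale_row_mx add_row_mx.
by move=> [u1 v1] [u2 v2] /= /eq_row_mx[/fi -> /gi ->].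
Qed.

(** [p] is a projection with kernel [S]. Its image is a complement of [S] and later stands in for
    the quotient space. *)
Lemma findim_proj U n (S : set U) : findim U n -> lin_subspace S ->
  exists p : U -> U, [/\ linear p, forall u, S u -> p u = 0,
    forall u, S (u - p u) & forall u, p (p u) = p u].
Proof.
move=> /findim_has_dim[m _ [f [g fK gK]]] hS.
have hg : linear g.
  by move=> a u v; apply: (can_inj fK); rewrite gK linearP !gK.
have hS' : lin_subspace [set v | S (g v)].
  split=> [|a u v Su Sv] /=; first by rewrite (lin0 hg); case: hS.
  by rewrite hg; apply: hS.2.
have [r [A [Af AS]]] := subspace_mx hS'.
(* [B] kills exactly the row space of [A]; [Q] has the same left kernel as [B] and is in addition
   idempotent. *)
pose B := cokermx A; pose Q := B *m pinvmx B.
have QB : Q *m B = B by rewrite mulmxKpV.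
have QQ : Q *m Q = Q by rewrite {2}/Q mulmxA QB.
have kQ (v : 'rV[k]_m) : (v <= A)%MS -> v *m Q = 0.
  by move=> /submxP[u ->]; rewrite mulmxA -(mulmxA u) mulmx_coker mulmx0 mul0mx.
have mQ (v : 'rV[k]_m) : (v - v *m Q <= A)%MS.
  by rewrite submxE mulmxBl -mulmxA QB subrr.
exists (fun u => g (f u *m Q)); split.
- by move=> a u v; rewrite linearP mulmxDl -scalemxAl hg.
- move=> u Su; rewrite kQ ?(lin0 hg) //; apply/AS => /=.
  by rewrite fK.
- move=> u; have /AS /= := mQ (f u).
  by rewrite (linB hg) fK.
by move=> u; rewrite gK -mulmxA QQ.
Qed.

Lemma findim_functional U n (S : set U) u : findim U n -> lin_subspace S -> ~ S u ->
  exists phi : U -> k^o,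
    [/\ linear phi, forall v, S v -> phi v = 0 & phi u = 1].
Proof.
move=> Un hS Su; have [f hf fi] := Un.
have [p [hp p0 pS _]] := findim_proj Un hS.
have /rV0Pn[i fi0] : f (p u) != 0.
  apply: contra_notN Su => /eqP e; have {e} pu : p u = 0.
    by apply: fi; rewrite e (lin0 hf).
  by have := pS u; rewrite pu subr0.
exists (fun v => (f (p u) 0 i)^-1 * f (p v) 0 i); split.
- by move=> a v w /=; rewrite hp hf !mxE mulrDr mulrCA.
- by move=> v Sv /=; rewrite (p0 _ Sv) (lin0 hf) mxE mulr0.
- by rewrite mulVf.
Qed.

Lemma findim_factor U V W n (f : U -> V) (h : U -> W) : findim V n ->
  linear f -> linear h -> (forall u, f u = 0 -> h u = 0) ->
  exists2 g : V -> W, linear g & forall u, g (f u) = h u.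
Proof.
move=> Vn hf hh k0.
have [p [hp p0 pS _]] := findim_proj Vn (subspace_im hf).
pose q v := sval (cid2 (pS v)).
have qE v : f (q v) = v - p v by rewrite /q; case: cid2.
have kE u u' : f u = f u' -> h u = h u'.
  by move=> e; apply/eqP; rewrite -subr_eq0 -(linB hh) k0 // (linB hf) e subrr.
exists (fun v => h (q v)).
  move=> a u v; rewrite -hh; apply: kE; rewrite hf !qE hp scalerBr.
  by rewrite opprD addrACA.
by move=> u; apply: kE; rewrite qE p0 ?subr0 //; exists u.
Qed.

Lemma findim_section U V n (f : U -> V) : findim V n -> linear f ->
  (forall v, exists u, f u = v) ->
  exists2 g : V -> U, linear g & forall v, f (g v) = v.
Proof.
move=> /findim_has_dim[m _ [h [h' hK h'K]]] hf fs.
pose l i := sval (cid (fs (h' (delta_mx 0 i)))).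
have lE i : f (l i) = h' (delta_mx 0 i) by rewrite /l; case: cid.
exists (fun v => \sum_i h v 0 i *: l i).
  move=> a u v; rewrite scaler_sumr -big_split; apply: eq_bigr => i _ /=.
  by rewrite linearP !mxE scalerDl scalerA.
move=> v; apply: (can_inj hK); rewrite -(mklinE hf) !linear_sum /=.
rewrite [RHS]row_sum_delta; apply: eq_bigr => i _.
by rewrite (linZ hf) lE linearZ /= h'K.
Qed.

Lemma findim_surj U V n (f : U -> V) : findim U n -> linear f ->
  (forall v, exists u, f u = v) -> findim V n.
Proof.
move=> Un hf fs.
have [p [hp p0 pS _]] := findim_proj Un (subspace_ker hf).
pose l v := sval (cid (fs v)).
have lE v : f (l v) = v by rewrite /l; case: cid.
have fp u : f (p u) = f u.
  by apply/eqP; rewrite eq_sym -subr_eq0 -(linB hf); apply/eqP/pS.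
have pE u u' : f u = f u' -> p u = p u'.
  move=> e; apply/eqP; rewrite -subr_eq0 -(linB hp) p0 //=.
  by rewrite (linB hf) e subrr.
apply: (@findim_inj _ _ (fun v => p (l v))) Un.
  by move=> a u v; rewrite -hp; apply: pE; rewrite hf !lE.
by apply: (can_inj (g := f)) => v; rewrite fp lE.
Qed.

Lemma findim_ext U V W n m (f : U -> V) (g : V -> W) : findim U n -> findim W m ->
  linear f -> linear g -> injective f -> (forall w, exists v, g v = w) ->
  (forall v, g v = 0 -> exists u, f u = v) -> findim V (n + m).
Proof.
move=> Un Wm hf hg fi gs ex.
have [s hs sK] := findim_section Wm hg gs.
have r v : {u | f u = v - s (g v)}.
  by apply: cid; apply: ex; rewrite (linB hg) sK subrr.
apply: (@findim_inj _ _ (fun v => (sval (r v), g v))) (findim_prod Un Wm).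
  move=> a u v /=; rewrite pair_equal_spec; split; last exact: hg.
  apply: fi; rewrite hf; case: (r _) (r u) (r v) => x /= -> [y /= ->] [z /= ->].
  by rewrite hg hs scalerBr opprD addrACA.
move=> u v; case: (r u) => x /= xE; case: (r v) => y /= yE [e1 e2].
by move: xE; rewrite e1 e2 yE => /addIr.
Qed.

(** A bounded rank function that strictly increases along strict inclusions of subspaces is all that
    the arguments on chains require. *)
Lemma findim_dim U n : findim U n -> exists d : set U -> nat,
  (forall S, lin_subspace S -> (d S <= n)%N) /\
  forall S T, lin_subspace S -> lin_subspace T -> S `<=` T ->
    (d S <= d T)%N /\ ((d T <= d S)%N -> T `<=` S).
Proof.
move=> [f hf fi].
have im S : {A : 'M[k]_n | lin_subspace S -> forall v, (exists2 u, S u & f u = v) <-> (v <= A)%MS}.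
  apply: cid; have [hS|] := pselect (lin_subspace S); last by exists 0.
  have hS' : lin_subspace (f @` S).
    split=> [|a _ _ [u Su <-] [v Sv <-]].
      by exists 0; rewrite ?(lin0 hf) //; case: hS.
    by exists (a *: u + v); rewrite ?hf //; apply: hS.2.
  have [r [A [_ AS]]] := subspace_mx hS'; exists <<A>>%MS => _ v.
  by rewrite genmxE; apply: AS.
pose d S := \rank (sval (im S)).
exists d; split=> [S _|S T hS hT ST]; first exact: rank_leq_row.
have := svalP (im T) hT; have := svalP (im S) hS.
rewrite /d; move: (sval (im S)) (sval (im T)) => A B AS BT.
have AB : (A <= B)%MS.
  apply/rV_subP => v /AS[u Su <-]; apply/BT; exists u => //; exact: ST.
split; first exact: mxrankS.
rewrite (geq_leqif (mxrank_leqif_sup AB)) => BA u Tu.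
have /AS[u' Su' /fi <- //] : (f u <= A)%MS.
by apply: submx_trans BA; apply/BT; exists u.
Qed.

(** A member of least rank works: a member contained in it has no smaller rank, hence is equal to
    it. *)
Lemma chain_min U n (T : Type) (D : set T) (L : T -> set U) : findim U n ->
  D !=set0 -> (forall i, D i -> lin_subspace (L i)) ->
  (forall i j, D i -> D j -> L i `<=` L j \/ L j `<=` L i) ->
  exists2 i, D i & forall j, D j -> L i `<=` L j.
Proof.
move=> /findim_dim[d [dn dS]] [i0 Di0] hL tot.
have P : exists m, `[< exists2 i, D i & d (L i) = m >].
  by exists (d (L i0)); apply/asboolP; exists i0.
case: (ex_minnP P) => m /asboolP[i Di <-] mmin; exists i => // j Dj.
have [//|LL] := tot i j Di Dj.
have [_] := dS _ _ (hL j Dj) (hL i Di) LL; apply.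
by apply: mmin; apply/asboolP; exists j.
Qed.

Lemma chain_max U n (T : Type) (D : set T) (L : T -> set U) : findim U n ->
  D !=set0 -> (forall i, D i -> lin_subspace (L i)) ->
  (forall i j, D i -> D j -> L i `<=` L j \/ L j `<=` L i) ->
  exists2 i, D i & forall j, D j -> L j `<=` L i.
Proof.
move=> /findim_dim[d [dn dS]] [i0 Di0] hL tot.
have P : exists m, `[< exists2 i, D i & d (L i) = m >].
  by exists (d (L i0)); apply/asboolP; exists i0.
have Pn m : `[< exists2 i, D i & d (L i) = m >] -> (m <= n)%N.
  by move=> /asboolP[i Di <-]; apply: dn; apply: hL.
case: (ex_maxnP P Pn) => m /asboolP[i Di <-] mmax; exists i => // j Dj.
have [LL|//] := tot i j Di Dj.
have [_] := dS _ _ (hL i Di) (hL j Dj) LL; apply.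
by apply: mmax; apply/asboolP; exists j.
Qed.

(** By hypothesis [f] and its square have the same image, hence the same rank, and so by
    rank-nullity the same kernel. *)
Lemma findim_endo_ker U n (f : U -> U) : findim U n -> linear f ->
  (forall u, exists v, f u = f (f v)) -> forall u, f (f u) = 0 -> f u = 0.
Proof.
move=> Un hf im u fu0.
have [m _ [h [h' hK h'K]]] := findim_has_dim Un.
have hh' : linear h'.
  by move=> a v w; apply: (can_inj hK); rewrite h'K linearP !h'K.
have hF : linear (fun v => h (f (h' v))) by move=> a v w; rewrite hh' hf linearP.
pose A := lin1_mx (mklin hF).
have AE v : v *m A = h (f (h' v)) by rewrite mul_rV_lin1.
have AA : (A <= A *m A)%MS.
  apply/rV_subP => _ /submxP[w ->]; rewrite AE; have [v ->] := im (h' w).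
  by apply/submxP; exists (h v); rewrite mulmxA !AE !hK.
have KK : (kermx (A *m A) <= kermx A)%MS.
  rewrite -(geq_leqif (mxrank_leqif_sup _)); last first.
    by apply/sub_kermxP; rewrite mulmxA mulmx_ker mul0mx.
  by rewrite !mxrank_ker leq_sub2l // mxrankS.
have : (h u <= kermx A)%MS.
  apply: submx_trans KK; apply/sub_kermxP.
  by rewrite mulmxA !AE !hK fu0 linear0.
by move/sub_kermxP; rewrite AE hK => e; rewrite -[LHS]hK e (lin0 hh').
Qed.
End LinearAlgebra.

(** * The order of a continuous quiver of type A *)

Section Order.
Variables (R : realType) (A : quiverA R).
Local Notation "x ⪯ y" := (preceq A x y) (at level 70).
Implicit Types (x y z : R) (n m : int).

Lemma odd_absz_succ n : odd (absz (n + 1)) = ~~ odd (absz n).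
Proof.
case: n => [n|[|n]].
- by rewrite -[1]/(Posz 1) -PoszD absz_nat addn1.
- by [].
- have -> : Negz n.+1 + 1 = Negz n by lia.
  by rewrite /= negbK.
Qed.

Lemma preceq_refl x : x ⪯ x. Proof. by left. Qed.
Hint Resolve preceq_refl : core.

Lemma seg_total n x y : segment A n x -> segment A n y -> x ⪯ y \/ y ⪯ x.
Proof.
move=> nx ny; have [xy|yx] := leP x y; case: (boolP (odd (absz n))) => o.
- by right; right; exists n; rewrite o.
- by left; right; exists n; rewrite (negbTE o).
- by left; right; exists n; rewrite o ltW.
- by right; right; exists n; rewrite (negbTE o) ltW.
Qed.

Lemma seg_uniq n m x y : x <> y -> segment A n x -> segment A n y ->
  segment A m x -> segment A m y -> n = m.
Proof.
move=> xy nx ny mx my; apply: contrapT => nm.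
have [{}nm|{}nm|//] := ltgtP n m; apply: xy.
  by have [_ ex] := segment_eq nm nx mx; have [_] := segment_eq nm ny my; rewrite ex => -[].
by have [_ ex] := segment_eq nm mx nx; have [_] := segment_eq nm my ny; rewrite ex => -[].
Qed.

Lemma seg_convex n x y z : segment A n x -> segment A n y -> x <= z <= y ->
  segment A n z.
Proof.
move=> [n0 n1 nx _] [_ _ _ yn] /andP[xz zy]; split=> //.
  by apply: le_trans nx _; rewrite lee_fin.
by apply: le_trans yn; rewrite lee_fin.
Qed.

Lemma preceq_seg x y : x ⪯ y -> x <> y -> exists n,
  [/\ segment A n x, segment A n y & if odd (absz n) then y <= x else x <= y].
Proof. by case. Qed.

Lemma preceq_betw x y z : y ⪯ x -> y <= z <= x \/ x <= z <= y ->
  y ⪯ z /\ z ⪯ x.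
Proof.
case=> [->|[n [ny nx o]]].
  by case=> /le_anti ->.
move=> h; have nz : segment A n z.
  by case: h => h; [apply: seg_convex h|apply: (seg_convex nx ny)].
by split; right; exists n; split=> //; move: o; case: ifP => _ o;
  case: h => /andP[h1 h2]; lra.
Qed.

Lemma preceq_anti x y : x ⪯ y -> y ⪯ x -> x = y.
Proof.
case=> // -[n [nx ny o]] [//|[m [my mx o']]]; apply: contrapT => xy.
have nm := seg_uniq xy nx ny mx my; rewrite -nm in o'.
by apply: xy; apply: le_anti; move: o o'; case: ifP => _ -> ->.
Qed.

(** Adjacent segments have opposite parity, so they meet in a sink, with nothing strictly below it,
    or in a source, with nothing strictly above it. A chain therefore cannot pass from one segment
    to the next. *)
Lemma preceq_common z y x : z ⪯ y -> y ⪯ x -> z <> x ->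
  exists n, [/\ segment A n z, segment A n y, segment A n x &
    if odd (absz n) then x <= y <= z else z <= y <= x].
Proof.
case=> [->|[n [nz ny o]]].
  case=> [->//|[m [my mx o]] _]; exists m; split=> //.
  by move: o; case: ifP; rewrite lexx ?andbT.
case=> [<-|[m [my mx o']]] zx.
  by exists n; split=> //; move: o; case: ifP; rewrite lexx ?andbT.
have [zy|zy] := pselect (z = y).
  by subst z; exists m; split=> //; move: o'; case: ifP; rewrite lexx ?andbT.
have [yx|yx] := pselect (y = x).
  by subst x; exists n; split=> //; move: o; case: ifP; rewrite lexx ?andbT.
have [nm|nm|E] := ltgtP n m.
- have [E ey] := segment_eq nm ny my.
  have [_ _ _ zle] := nz; have [_ _ xge _] := mx.
  move: zle xge o o'; rewrite -E ey !lee_fin E odd_absz_succ => h1 h2.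
  case: (odd _) => /= h3 h4; exfalso; [apply: yx|apply: zy]; lra.
- have [E ey] := segment_eq nm my ny.
  have [_ _ zge _] := nz; have [_ _ _ xle] := mx.
  move: zge xle o o'; rewrite -E ey !lee_fin E odd_absz_succ => h1 h2.
  case: (odd _) => /= h3 h4; exfalso; [apply: zy|apply: yx]; lra.
exists n; split=> //; first by rewrite E.
by move: o o'; rewrite -E; case: ifP => _ -> ->.
Qed.

Lemma preceq_trans y z x : z ⪯ y -> y ⪯ x -> z ⪯ x.
Proof.
move=> zy yx; have [->//|zx] := pselect (z = x).
have [n [nz ny nx o]] := preceq_common zy yx zx.
by right; exists n; split=> //; move: o; case: ifP => _ /andP[]; apply: le_trans.
Qed.

(** Two incomparable branches start only above a sink; the point [x0] strictly below [x] rules this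
    out. *)
Lemma up_chain x0 x y z : x0 ⪯ x -> x0 <> x -> x ⪯ y -> x ⪯ z -> y ⪯ z \/ z ⪯ y.
Proof.
move=> x0x nx xy xz.
have x0y : x0 <> y by move=> e; apply: nx; apply: preceq_anti => //; rewrite e.
have x0z : x0 <> z by move=> e; apply: nx; apply: preceq_anti => //; rewrite e.
have [n [n1 n2 n3 _]] := preceq_common x0x xy x0y.
have [m [m1 m2 m3 _]] := preceq_common x0x xz x0z.
have nm := seg_uniq nx n1 n2 m1 m2; subst m.
exact: seg_total n3 m3.
Qed.

Lemma down_chain x1 x y z : x ⪯ x1 -> x <> x1 -> y ⪯ x -> z ⪯ x -> y ⪯ z \/ z ⪯ y.
Proof.
move=> xx1 nx yx zx.
have yx1 : y <> x1 by move=> e; apply: nx; apply: preceq_anti => //; rewrite -e.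
have zx1 : z <> x1 by move=> e; apply: nx; apply: preceq_anti => //; rewrite -e.
have [n [n1 n2 n3 _]] := preceq_common yx xx1 yx1.
have [m [m1 m2 m3 _]] := preceq_common zx xx1 zx1.
have nm := seg_uniq nx n2 n3 m2 m3; subst m.
exact: seg_total n1 m1.
Qed.

Lemma preceq_dense x y : x ⪯ y -> x <> y ->
  exists z, [/\ x ⪯ z, z ⪯ y, x <> z & z <> y].
Proof.
move=> xy nxy; pose z := (x + y) / 2.
have [xz zy] : x ⪯ z /\ z ⪯ y.
  by apply: preceq_betw => //; have [h|h] := leP x y; [left|right]; rewrite /z; lra.
by exists z; split=> //; rewrite /z => e; apply: nxy; lra.
Qed.

Lemma qidx_lt_int (i j : \bar int) m : qidx A i -> qidx A j ->
  (i <= m%:E)%E -> (m%:E < j)%E -> qidx A (m + 1)%:E.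
Proof.
move=> Ai Aj im mj; apply: (qidx_convex Ai Aj).
  by apply: le_trans im _; rewrite lee_fin; lia.
by case: j mj {Aj} => //= [j|]; rewrite ?leey // lte_fin lee_fin; lia.
Qed.

Lemma qpt_lt i j : qidx A i -> qidx A j -> (qpt A i < qpt A j)%E = (i < j)%E.
Proof. by move=> Ai Aj; rewrite !ltNge (qpt_mono Aj Ai). Qed.

Lemma qpt_cases i : qidx A i ->
  (qpt A i = -oo \/ qpt A i = +oo \/ exists2 s, qS A s & qpt A i = s%:E)%E.
Proof.
move=> Ai; have : (qpt A @` qidx A) (qpt A i) by exists i.
by rewrite qpt_img => -[[s Ss <-]|[->|->]]; [right; right; exists s|left|right; left].
Qed.

(** Unless an integer index has value -oo, every negative integer is an index. If all these points
    stayed to the right of [x], they would decrease to an infimum, an accumulation point of [S]. *)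
Lemma qidx_below x : exists2 m, qidx A m%:E & (qpt A m%:E <= x%:E)%E.
Proof.
have [i Ai iE] : exists2 i, qidx A i & qpt A i = -oo%E.
  have : (qpt A @` qidx A) -oo%E by rewrite qpt_img; right; left.
  by case=> i; exists i.
have A0 := qidx0 A.
have i0 : (i <= 0)%E by rewrite -(qpt_mono Ai A0) iE leNye.
case: i Ai iE i0 => [m|//|] Ai iE _; first by exists m => //; rewrite iE leNye.
apply: contrapT => nex.
have Am (j : nat) : qidx A (- j%:Z)%:E.
  by apply: (qidx_convex Ai A0); rewrite ?leNye // lee_fin; lia.
have gt_x (j : nat) : (x%:E < qpt A (- j%:Z)%:E)%E.
  by rewrite ltNge; apply/negP => h; apply: nex; exists (- j%:Z).
have sp (j : nat) : exists2 s, qS A s & qpt A (- j.+1%:Z)%:E = s%:E.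
  have := gt_x j.+1; have : (qpt A (- j.+1%:Z)%:E < qpt A (- 0%:Z)%:E)%E.
    by rewrite qpt_lt // lte_fin; lia.
  case: (qpt_cases (Am j.+1)) => [->|[->|//]]; last by rewrite ltNge leey.
  by move=> _; rewrite ltNge leNye.
pose p j := s2val (cid2 (sp j)).
have pS j : qS A (p j) by rewrite /p; case: cid2.
have pE j : qpt A (- j.+1%:Z)%:E = (p j)%:E by rewrite /p; case: cid2.
have px j : x < p j by rewrite -lte_fin -pE.
have pdec j : p j.+1 < p j by rewrite -lte_fin -!pE qpt_lt // lte_fin; lia.
have hinf : has_inf (range p).
  split; first by exists (p 0%N); exists 0%N.
  by exists x => _ [j _ <-]; apply: ltW.
pose l := inf (range p).
have lp j : l < p j.
  apply: le_lt_trans (pdec j); apply: ge_inf; first by case: hinf.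
  by exists j.+1.
have : limit_point (qS A) l; last by rewrite qS_noacc.
move=> U /nbhs_ballP[e /= e0 eU].
have [_ [j _ <-] hj] := inf_adherent e0 hinf.
exists (p j); split; [by rewrite gt_eqF|exact: pS|apply: eU].
by rewrite /ball /= distrC ger0_norm ?subr_ge0 ?(ltW (lp j)) // ltrBlDl.
Qed.

Lemma qidx_above x : exists2 m, qidx A m%:E & (x%:E <= qpt A m%:E)%E.
Proof.
have [i Ai iE] : exists2 i, qidx A i & qpt A i = +oo%E.
  have : (qpt A @` qidx A) +oo%E by rewrite qpt_img; right; right.
  by case=> i; exists i.
have A0 := qidx0 A.
have i0 : (0 <= i)%E by rewrite -(qpt_mono A0 Ai) iE leey.
case: i Ai iE i0 => [m||//] Ai iE _; first by exists m => //; rewrite iE leey.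
apply: contrapT => nex.
have Am (j : nat) : qidx A (j%:Z)%:E.
  by apply: (qidx_convex A0 Ai); rewrite ?leey // lee_fin; lia.
have lt_x (j : nat) : (qpt A (j%:Z)%:E < x%:E)%E.
  by rewrite ltNge; apply/negP => h; apply: nex; exists j%:Z.
have sp (j : nat) : exists2 s, qS A s & qpt A (j.+1%:Z)%:E = s%:E.
  have := lt_x j.+1; have : (qpt A (0%:Z)%:E < qpt A (j.+1%:Z)%:E)%E.
    by rewrite qpt_lt // lte_fin; lia.
  case: (qpt_cases (Am j.+1)) => [->|[->|//]]; first by rewrite ltNge leNye.
  by move=> _; rewrite ltNge leey.
pose p j := s2val (cid2 (sp j)).
have pS j : qS A (p j) by rewrite /p; case: cid2.
have pE j : qpt A (j.+1%:Z)%:E = (p j)%:E by rewrite /p; case: cid2.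
have px j : p j < x by rewrite -lte_fin -pE.
have pinc j : p j < p j.+1 by rewrite -lte_fin -!pE qpt_lt // lte_fin; lia.
have hsup : has_sup (range p).
  split; first by exists (p 0%N); exists 0%N.
  by exists x => _ [j _ <-]; apply: ltW.
pose l := sup (range p).
have lp j : p j < l.
  apply: lt_le_trans (pinc j) _; apply: ub_le_sup; first by case: hsup.
  by exists j.+1.
have : limit_point (qS A) l; last by rewrite qS_noacc.
move=> U /nbhs_ballP[e /= e0 eU].
have [_ [j _ <-] hj] := sup_adherent e0 hsup.
exists (p j); split; [by rewrite lt_eqF|exact: pS|apply: eU].
rewrite /ball /= ger0_norm ?subr_ge0 ?(ltW (lp j)) //.
by move: hj; rewrite -/l; lra.
Qed.

Lemma segment_ex x : exists n, segment A n x.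
Proof.
have [a Aa ax] := qidx_below x; have [b Ab xb] := qidx_above x.
have [j Aj jE] : exists2 j, qidx A j & qpt A j = +oo%E.
  have : (qpt A @` qidx A) +oo%E by rewrite qpt_img; right; right.
  by case=> j; exists j.
have aj : (a%:E < j)%E.
  by rewrite -(qpt_lt Aa Aj) jE; apply: le_lt_trans ax (ltry x).
have [d bd] : exists d : nat, b <= a + 1 + d%:Z by exists `|b - a|%N; lia.
elim: d a Aa ax aj bd => [|d IH] a Aa ax aj bd; have Aa1 := qidx_lt_int Aa Aj (lexx _) aj.
  exists a; split=> //; apply: le_trans xb _.
  by rewrite (qpt_mono Ab Aa1) lee_fin; lia.
have [xa|ax'] := leP x%:E (qpt A (a + 1)%:E); first by exists a.
apply: (IH (a + 1)) => //; first exact: ltW.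
  by rewrite -(qpt_lt Aa1 Aj) jE; apply: lt_trans ax' (ltry x).
by rewrite -addn1 PoszD in bd; lia.
Qed.

(** The induction is on the difference of the segment indices of the two ends, which are integers
    because [S] has no accumulation point; the cut is made at the right end of the first segment. *)
Lemma interval_ind (Q : R -> R -> Prop) :
  (forall n (l r : R), l <= r -> segment A n l -> segment A n r -> Q l r) ->
  (forall l p r : R, l <= p -> p <= r -> Q l p -> Q p r -> Q l r) ->
  forall l r, l <= r -> Q l r.
Proof.
move=> base step l r lr.
have [n nl] := segment_ex l; have [m mr] := segment_ex r.
(* Segments share their end points, so the segment found for [r] may precede the one found for [l].
   This happens only if [l] and [r] coincide. *)
have [mn|nm] := ltP m n.
  have [Am0 Am1 _ rm] := mr; have [An0 An1 ln _] := nl.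
  suff e : r = l by subst r; exact: (base n).
  apply/eqP; rewrite eq_le lr andbT -lee_fin; apply: le_trans rm _; apply: le_trans ln.
  by rewrite (qpt_mono Am1 An0) lee_fin; lia.
have [d mE] : exists d : nat, m = n + d%:Z by exists `|m - n|%N; lia.
move: {nm} mE; elim: d n l lr nl => [|d IH] n l lr nl mE.
  by apply: (base n) => //; rewrite mE addr0 in mr.
have [An0 An1 nl1 ln] := nl; have [Am0 Am1 rm1 rm] := mr.
have pm : (qpt A (n + 1)%:E <= qpt A m%:E)%E.
  by rewrite (qpt_mono An1 Am0) lee_fin; lia.
have [p pE] : exists p, qpt A (n + 1)%:E = p%:E.
  move: ln (le_trans pm rm1); case: (qpt A (n + 1)%:E) => [p|//|//].
  by exists p.
have lp : l <= p by rewrite -lee_fin -pE.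
have pr : p <= r by rewrite -lee_fin -pE; apply: le_trans pm rm1.
have An2 : qidx A (n + 1 + 1)%:E.
  by apply: (qidx_convex An1 Am1); rewrite lee_fin; lia.
have np : segment A (n + 1) p.
  by split=> //; rewrite -pE // (qpt_mono An1 An2) lee_fin; lia.
apply: (step l p) => //; first apply: (base n) => //.
  by split=> //; rewrite -?pE //; apply: le_trans nl1 _; rewrite pE lee_fin.
by apply: (IH (n + 1)) => //; lia.
Qed.

Lemma segment_nontrivial : exists n x y, [/\ segment A n x, segment A n y & x <> y].
Proof.
have [n [A0 A1 h0 h1]] := segment_ex 0.
have lt01 : (qpt A n%:E < qpt A (n + 1)%:E)%E by rewrite qpt_lt // lte_fin; lia.
exists n; move: h0 h1 lt01.
case E0: (qpt A n%:E) => [a| |] //; case E1: (qpt A (n + 1)%:E) => [b| |] //;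
  rewrite ?lee_fin ?lte_fin => h0 h1 h.
- exists a, b; split; [split|split|] => //; rewrite ?E0 ?E1 ?lee_fin; lra.
- by exists a, (a + 1); split; [split|split|] => //; rewrite ?E0 ?E1 ?lee_fin ?leey //; lra.
- by exists b, (b - 1); split; [split|split|] => //; rewrite ?E0 ?E1 ?lee_fin ?leNye //; lra.
- by exists 0, 1; split; [split|split|] => //; rewrite ?E0 ?E1 ?lee_fin ?leNye ?leey //; lra.
Qed.

(** The outer points [c] and [d] witness that [b] is not a sink and [a] not a source, so that the
    order is total above [b] and below [a]. *)
Lemma preceq_four : exists c b a d, [/\ c ⪯ b, b ⪯ a, a ⪯ d & [/\ c <> b, b <> a & a <> d]].
Proof.
have [n [x [y [nx ny xy]]]] := segment_nontrivial.
wlog xLy : x y nx ny xy / x ⪯ y.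
  by move=> h; case: (seg_total nx ny) => [|l]; [apply: (h x y)|apply: (h y x) => // e; apply: xy].
have [b [xb by' nxb nby]] := preceq_dense xLy xy.
have [a [ba ay nba nay]] := preceq_dense by' nby.
by exists x, b, a, y.
Qed.

Lemma interval_setP (I : set R) : interval_set I <-> I !=set0 /\
  forall x y z, I x -> I y -> x <= z <= y -> I z.
Proof.
split=> -[I0 h]; split=> //; last first.
  by apply/connected_intervalP => x y Ix Iy z; apply: h.
by move=> x y z Ix Iy; move/connected_intervalP: h; apply.
Qed.

Lemma chain_interval (J : set R) : J !=set0 ->
  (forall x y, J x -> J y -> x ⪯ y \/ y ⪯ x) ->
  (forall x y z, J x -> J y -> x ⪯ z -> z ⪯ y -> J z) -> interval_set J.
Proof.
move=> J0 tot conv; apply/interval_setP; split=> // x y z Jx Jy xzy.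
case: (tot x y Jx Jy) => h.
  by have [] := @preceq_betw _ _ z h (or_introl xzy); apply: conv.
by have [] := @preceq_betw _ _ z h (or_intror xzy); apply: conv.
Qed.

Definition downset (I : set R) := forall x y, I x -> y ⪯ x -> I y.

(** This form covers the half-open supports on one side of a point as well as those that run off to
    infinity, without naming a bounding point. *)
Definition leg (I : set R) :=
  exists n, [/\ I !=set0, I `<=` segment A n & downset I].

(* The supports of the indecomposable projectives. *)
Definition pint (I : set R) := (exists a, I = [set x | x ⪯ a]) \/ leg I.

Lemma pint_downset I : pint I -> downset I.
Proof.
case=> [[a ->]|[n [_ _ //]]] x y /= xa yx; exact: preceq_trans yx xa.
Qed.

Lemma pint_interval I : pint I -> interval_set I.
Proof.
case=> [[a ->]|[n [I0 In Id]]]; last first.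
  apply: chain_interval => // [x y /In nx /In ny|x y z _ Iy _]; last exact: Id.
  exact: seg_total nx ny.
apply/interval_setP; split=> [|x y z /= xa ya /andP[xz zy]]; first by exists a; apply: preceq_refl.
have [za|az] := leP z a.
  have h : x <= z <= a \/ a <= z <= x by left; rewrite xz za.
  by have [] := preceq_betw xa h.
have h : y <= z <= a \/ a <= z <= y by right; rewrite zy ltW.
by have [] := preceq_betw ya h.
Qed.

(** If [I] has no largest element, a rational lies between any [x] in [I] and some larger element of
    [I]. It is thus enough to exceed every rational that can be exceeded within [I]. *)
Lemma pint_cofinal I : pint I -> exists u : nat -> R,
  [/\ forall j, I (u j), forall j, u j ⪯ u j.+1 &
      forall x, I x -> exists j, x ⪯ u j].
Proof.
case=> [[a ->]|[n [[x0 Ix0] In Id]]].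
  by exists (fun=> a); split=> [j|j|x]; [exact: preceq_refl|exact: preceq_refl|exists 0%N].
have tot x y : I x -> I y -> x ⪯ y \/ y ⪯ x by move=> /In nx /In; apply: seg_total.
have [[m Im mmax]|nmax] := pselect (exists2 m, I m & forall x, I x -> x ⪯ m).
  by exists (fun=> m); split=> // x /mmax; exists 0%N.
(* [l j] is an element of [I] above the rational with code [j] if there is one, and [x0] otherwise;
   [u] will be the running maximum of [l]. *)
pose l (j : nat) := xget x0 [set y | I y /\ exists2 q : rat, unpickle j = Some q & ratr q ⪯ y].
have Il j : I (l j) by rewrite /l; case: xgetP => [y -> []|].
pose mx x y := if `[< x ⪯ y >] then y else x.
have mxP x y : I x -> I y -> [/\ I (mx x y), x ⪯ mx x y & y ⪯ mx x y].
  move=> Ix Iy; rewrite /mx; case: asboolP => // nxy; split=> //.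
  by case: (tot _ _ Ix Iy).
pose u := fix u j := if j is j'.+1 then mx (u j') (l j) else l 0%N.
have Iu j : I (u j) by elim: j => [|j IH] /=; [exact: Il|have [] := mxP _ _ IH (Il j.+1)].
have lu j : l j ⪯ u j by case: j => //= j; have [] := mxP _ _ (Iu j) (Il j.+1).
exists u; split=> // [j|x Ix]; first by have [] := mxP _ _ (Iu j) (Il j.+1).
have [y Iy nyx] : exists2 y, I y & ~ y ⪯ x.
  apply: contrapT => h; apply: nmax; exists x => // y Iy.
  by apply: contrapT => nyx; apply: h; exists y.
have xy : x ⪯ y by case: (tot _ _ Ix Iy).
have nxy : x <> y by move=> e; apply: nyx; rewrite e.
have [q [xq qy]] : exists q : rat, x ⪯ ratr q /\ ratr q ⪯ y.
  have [h|h] := ltP x y.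
    have [q] := rat_in_itvoo h; rewrite in_itv /= => /andP[h1 h2].
    by exists q; apply: preceq_betw => //; left; rewrite !ltW.
  have {}h : y < x by rewrite lt_neqAle h andbT; apply/eqP => e; apply: nxy.
  have [q] := rat_in_itvoo h; rewrite in_itv /= => /andP[h1 h2].
  by exists q; apply: preceq_betw => //; right; rewrite !ltW.
exists (pickle q); apply: preceq_trans (lu _); apply: preceq_trans xq _.
rewrite /l; case: xgetP => [z -> [_ [q']]|/(_ y)[]].
  by rewrite pickleK => -[<-].
by split=> //; exists q; rewrite ?pickleK.
Qed.

(** Two pieces arise only below a source [a] that [K] omits: without [a] the downset falls apart
    into its two sides, each inside one segment. *)
Lemma pint_sub (I K : set R) : pint I -> downset K -> K `<=` I -> K = set0 \/ pint K \/
  exists K1 K2, [/\ leg K1, leg K2, K = K1 `|` K2 & K1 `&` K2 = set0].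
Proof.
move=> pI Kd KI; have [->|/set0P K0] := eqVneq K set0; [by left|right].
case: pI => [[a Ia]|[n [_ In _]]]; last by left; right; exists n; split=> // x /KI /In.
subst I.
have [Ka|nKa] := pselect (K a).
  by left; left; exists a; apply/seteqP; split=> // x /= xa; apply: Kd xa.
pose K1 := K `&` [set x | x < a]; pose K2 := K `&` [set x | a < x].
have K12 : K = K1 `|` K2.
  apply/seteqP; split=> [x Kx|x [[]|[]] //].
  have [h|h|h] := ltgtP x a; [by left|by right|by move: nKa; rewrite -h].
have side K' : K' = K1 \/ K' = K2 -> K' !=set0 -> leg K'.
  move=> hK' [x0 K'x0].
  have xa x : K' x -> x ⪯ a by case: hK' => -> [/KI].
  have nxa x : K' x -> x <> a by case: hK' => -> [_ /= h] e; rewrite e ltxx in h.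
  have same x y : K' x -> K' y -> (x < a) = (y < a).
    by case: hK' => -> [_ /= hx] [_ /= hy]; rewrite ?hx ?hy // !ltNge !ltW.
  have [n [nx0 na _]] := preceq_seg (xa _ K'x0) (nxa _ K'x0).
  exists n; split; first by exists x0.
    move=> x K'x; have [m [mx ma o]] := preceq_seg (xa _ K'x) (nxa _ K'x).
    have s := same _ _ K'x K'x0; have nx := nxa _ K'x; have nx0' := nxa _ K'x0.
    have [e|e] := leP x x0.
      have [xa'|ax'] := ltP x a.
        have h : x0 <= a by move: xa'; rewrite s; apply: ltW.
        have mx0 : segment A m x0 by apply: (seg_convex mx ma); rewrite e h.
        by rewrite (seg_uniq nx0' nx0 na mx0 ma).
      have nxx : segment A n x by apply: (seg_convex na nx0); rewrite ax' e.
      by [].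
    have [xa'|ax'] := ltP x a.
      by apply: (seg_convex nx0 na); rewrite !ltW.
    have h : a <= x0 by rewrite leNgt -s -leNgt.
    have mx0 : segment A m x0 by apply: (seg_convex ma mx); rewrite h ltW.
    by rewrite (seg_uniq nx0' nx0 na mx0 ma).
  move=> x y K'x yx.
  have Ky : K y by apply: Kd yx; case: hK' K'x => -> [].
  have ny : y <> a by move=> e; apply: nKa; rewrite -e.
  have h := preceq_between yx (xa _ K'x).
  case: hK' K'x => -> [_ /= hx]; split=> //=; case: h => /andP[h1 h2]; lra.
have [K10|/set0P K10] := eqVneq K1 set0.
  by left; rewrite K12 K10 set0U in K0 *; right; apply: side => //; right.
have [K20|/set0P K20] := eqVneq K2 set0.
  by left; rewrite K12 K20 setU0 in K0 *; right; apply: side => //; left.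
right; exists K1, K2; split=> //; [by apply: side => //; left|by apply: side => //; right|].
by apply/seteqP; split=> // x [[_ /= h] [_ /= h']]; have := lt_trans h h'; rewrite ltxx.
Qed.

(** If [J] has no largest element, any two of its elements lie below a strict pair of [J]. Chains
    ending in that pair stay in its segment, so the whole generated downset lies in one segment. *)
Lemma chain_pint (J : set R) : J !=set0 ->
  (forall x y, J x -> J y -> x ⪯ y \/ y ⪯ x) ->
  pint [set x | exists2 y, J y & x ⪯ y].
Proof.
move=> [x1 Jx1] tot.
have [[m Jm mmax]|nmax] := pselect (exists2 m, J m & forall x, J x -> x ⪯ m).
  left; exists m; apply/seteqP; split=> [x /= [y /mmax ym xy]|x /= xm]; last by exists m.
  exact: preceq_trans xy ym.
have succ x : J x -> exists y, [/\ J y, x ⪯ y & x <> y].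
  move=> Jx; apply: contrapT => h; apply: nmax; exists x => // y Jy.
  have [->//|nxy] := pselect (x = y).
  by case: (tot _ _ Jx Jy) => // xy; exfalso; apply: h; exists y.
have [x2 [Jx2 x12 n12]] := succ _ Jx1.
have [n [n1 n2 _]] := preceq_seg x12 n12.
right; exists n; split.
- by exists x1, x1.
- move=> y [x Jx yx].
  have [x3 [Jx3 xx3 x23]] : exists x3, [/\ J x3, x ⪯ x3 & x2 ⪯ x3].
    by case: (tot _ _ Jx Jx2) => h; [exists x2|exists x].
  have [x4 [Jx4 x34 n34]] := succ _ Jx3.
  have lt34 z : z ⪯ x3 -> z <> x4.
    by move=> z3 e; apply: n34; apply: preceq_anti => //; rewrite -e.
  have x13 := preceq_trans x12 x23; have y3 := preceq_trans yx xx3.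
  have [m [m2 m3 m4 _]] := preceq_common x23 x34 (lt34 _ x23).
  have [m' [m1 m3' m4' _]] := preceq_common x13 x34 (lt34 _ x13).
  have [m'' [my m3'' m4'' _]] := preceq_common y3 x34 (lt34 _ y3).
  have e1 := seg_uniq n34 m3' m4' m3 m4; have e2 := seg_uniq n34 m3'' m4'' m3 m4.
  by subst m' m''; rewrite (seg_uniq n12 n1 n2 m1 m2).
- by move=> x y [z Jz xz] yx; exists z => //; apply: preceq_trans yx xz.
Qed.
End Order.

(** * Subrepresentations, quotients and direct sums *)

Section Submodule.
Variables (k : fieldType) (U : lmodType k) (S : set U) (hS : lin_subspace S).

(** The proof that [S] is a subspace is a dummy argument, from which the closure instance can be
    inferred. *)
Definition submod_pred of lin_subspace S : {pred U} := fun u => `[< S u >].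

Fact submod_pred_closed : submod_closed (submod_pred hS).
Proof.
split=> [|a u v]; rewrite !unfold_in; first by apply/asboolP; exact: hS.1.
by move=> /asboolP Su /asboolP Sv; apply/asboolP; apply: hS.2.
Qed.
HB.instance Definition _ :=
  GRing.isSubmodClosed.Build k U (submod_pred hS) submod_pred_closed.

Definition submod := {u | u \in submod_pred hS}.
HB.instance Definition _ := SubChoice.on submod.
HB.instance Definition _ := [SubChoice_isSubLmodule of submod by <:].

Definition in_submod u (Su : S u) : submod := exist _ u (asboolT Su).

Lemma submodP (u : submod) : S (val u).
Proof. by case: u => u h; apply/asboolP. Qed.
End Submodule.

Section Rep.
Variables (R : realType) (A : quiverA R) (k : fieldType).
Local Notation "x ⪯ y" := (preceq A x y) (at level 70).
Local Notation rep := (qrep A k).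
Implicit Types (U V W X : rep).

HB.instance Definition _ V W (f : rhom V W) x :=
  GRing.isLinear.Build k (V x) (W x) _ (hmap f (x := x)) (@hmap_linear _ _ _ _ _ f x).

Lemma hmap0 V W (f : rhom V W) x : f x 0 = 0.
Proof. exact: linear0. Qed.
Lemma hmapD V W (f : rhom V W) x u v : f x (u + v) = f x u + f x v.
Proof. exact: linearD. Qed.
Lemma hmapB V W (f : rhom V W) x u v : f x (u - v) = f x u - f x v.
Proof. exact: linearB. Qed.
Lemma hmapN V W (f : rhom V W) x u : f x (- u) = - f x u.
Proof. exact: linearN. Qed.
Lemma hmapZ V W (f : rhom V W) x a u : f x (a *: u) = a *: f x u.
Proof. exact: linearZ. Qed.

Lemma hom_ev V W (f g : rhom V W) : f = g -> forall x v, f x v = g x v.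
Proof. by move=> ->. Qed.
Arguments hom_ev {V W f g} _ x v.

Lemma hom0E V W x v : (0 : rhom V W) x v = 0. Proof. by []. Qed.
Lemma homDE V W (f g : rhom V W) x v : (f + g) x v = f x v + g x v. Proof. by []. Qed.
Lemma homNE V W (f : rhom V W) x v : (- f) x v = - f x v. Proof. by []. Qed.
Lemma homZE V W a (f : rhom V W) x v : (a *: f) x v = a *: f x v. Proof. by []. Qed.

Lemma comphA U V W X (f : rhom U V) (g : rhom V W) (h : rhom W X) :
  comph h (comph g f) = comph (comph h g) f.
Proof. exact: homP. Qed.

Lemma compidh U V (f : rhom U V) : comph (idh V) f = f.
Proof. exact: homP. Qed.

Lemma comphid U V (f : rhom U V) : comph f (idh U) = f.
Proof. exact: homP. Qed.

Lemma rmap0 V x y (h : y ⪯ x) : rmap V h 0 = 0.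
Proof. exact: linear0. Qed.
Lemma rmapD V x y (h : y ⪯ x) u v : rmap V h (u + v) = rmap V h u + rmap V h v.
Proof. exact: linearD. Qed.
Lemma rmapZ V x y (h : y ⪯ x) a u : rmap V h (a *: u) = a *: rmap V h u.
Proof. exact: linearZ. Qed.

Lemma rmap_irr V x y (h h' : y ⪯ x) v : rmap V h v = rmap V h' v.
Proof. by rewrite (Prop_irrelevance h h'). Qed.

Definition hinj V W (f : rhom V W) := forall x, injective (hmap f (x := x)).
Definition hsurj V W (f : rhom V W) := forall x w, exists v, f x v = w.
Definition hexact U V W (f : rhom U V) (g : rhom V W) :=
  forall x v, g x v = 0 <-> exists u, f x u = v.

Lemma hinjP V W (f : rhom V W) : (forall x v, f x v = 0 -> v = 0) -> hinj f.
Proof. by move=> h x; apply: lin_inj (h x); apply: hmap_linear. Qed.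

Lemma hinj0 V W (f : rhom V W) x v : hinj f -> f x v = 0 -> v = 0.
Proof. by move=> fi e; apply: (fi x); rewrite e linear0. Qed.

Lemma sub_ex V (S : forall x, set (V x)) : (forall x, lin_subspace (S x)) ->
  (forall x y (h : y ⪯ x) v, S x v -> S y (rmap V h v)) ->
  exists (K : rep) (i : rhom K V), hinj i /\ forall x v, S x v <-> exists u, i x u = v.
Proof.
move=> hS hm.
pose m x y (h : y ⪯ x) (v : submod (hS x)) : submod (hS y) :=
  in_submod (hS y) (hm x y h _ (submodP v)).
have ml x y h : linear (@m x y h).
  by move=> a u v; apply: val_inj; rewrite /= !linearP.
have mid x (h : x ⪯ x) v : mklin (ml x x h) v = v.
  by apply: val_inj; rewrite /= rmap_id.
have mc x y z (hyx : y ⪯ x) (hzy : z ⪯ y) (hzx : z ⪯ x) v :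
    mklin (ml y z hzy) (mklin (ml x y hyx) v) = mklin (ml x z hzx) v.
  by apply: val_inj; rewrite /= rmap_comp.
pose K : rep := @QRep R A k (fun x => submod (hS x)) (fun x y h => mklin (ml x y h)) mid mc.
have il x : linear (fun v : K x => val v : V x) by move=> a u v; rewrite linearP.
have inat x y (h : y ⪯ x) (v : K x) : val (rmap K h v) = rmap V h (val v) by [].
exists K, (@Defs.Hom _ _ _ K V (fun x v => val v) il inat); split=> [x|x v] /=.
  exact: val_inj.
by split=> [Sv|[u <-]]; [exists (in_submod (hS x) Sv)|apply: submodP].
Qed.

(** The quotient at [x] is realised on the fixed points of a projection with kernel [S x]. Its
    structure maps are those of [V] followed by the projection; they compose correctly because [S]
    is stable. *)
Lemma quot_ex V (S : forall x, set (V x)) : Rep_pwf V -> (forall x, lin_subspace (S x)) ->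
  (forall x y (h : y ⪯ x) v, S x v -> S y (rmap V h v)) ->
  exists (Q : rep) (q : rhom V Q), hsurj q /\ forall x v, q x v = 0 <-> S x v.
Proof.
move=> Vf hS hm.
have P x : {p : V x -> V x | [/\ linear p, forall u, S x u -> p u = 0,
    forall u, S x (u - p u) & forall u, p (p u) = p u]}.
  apply: cid; have [n /has_dim_findim Vn] := Vf x.
  exact: findim_proj Vn (hS x).
pose p x := sval (P x).
have pl x : linear (p x) by rewrite /p; case: (P x) => ? [].
have p0 x u : S x u -> p x u = 0 by case: (svalP (P x)) => _ h _ _; apply: h.
have pS x u : S x (u - p x u) by case: (svalP (P x)) => _ _ h _; apply: h.
have pp x u : p x (p x u) = p x u by case: (svalP (P x)) => _ _ _ h; apply: h.
have pE x u v : S x (u - v) -> p x u = p x v.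
  by move=> h; apply/eqP; rewrite -subr_eq0 -(linB (pl x)) p0.
have hT x : lin_subspace [set u | p x u = u].
  by split=> [|a u v /= pu pv]; rewrite /= ?(lin0 (pl x)) // pl pu pv.
pose m x y (h : y ⪯ x) (v : submod (hT x)) : submod (hT y) :=
  in_submod (hT y) (pp y (rmap V h (val v))).
have ml x y h : linear (@m x y h).
  by move=> a u v; apply: val_inj; rewrite /= !linearP pl.
have mid x (h : x ⪯ x) v : mklin (ml x x h) v = v.
  by have e : p x (val v) = val v := submodP v; apply: val_inj; rewrite /= rmap_id.
have mc x y z (hyx : y ⪯ x) (hzy : z ⪯ y) (hzx : z ⪯ x) v :
    mklin (ml y z hzy) (mklin (ml x y hyx) v) = mklin (ml x z hzx) v.
  apply: val_inj; rewrite /= -(rmap_comp hyx hzy hzx); apply: pE.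
  by rewrite -linearB; apply: hm; rewrite -opprB -scaleN1r; apply: subspaceZ.
pose Q : rep := @QRep R A k (fun x => submod (hT x)) (fun x y h => mklin (ml x y h)) mid mc.
pose q x (v : V x) : Q x := in_submod (hT x) (pp x v).
have ql x : linear (@q x) by move=> a u v; apply: val_inj; rewrite /= pl.
have qn x y (h : y ⪯ x) v : q y (rmap V h v) = rmap Q h (q x v).
  by apply: val_inj => /=; apply: pE; rewrite -linearB; apply: hm.
exists Q, (@Defs.Hom _ _ _ V Q q ql qn); split=> [x w|x v] /=.
  by have e : p x (val w) = val w := submodP w; exists (val w); apply: val_inj.
split=> [/(congr1 val) /= e|/p0 e]; last by apply: val_inj.
by have := pS x v; rewrite e subr0.
Qed.

Lemma hom_lift X V W (i : rhom V W) (f : rhom X W) : hinj i ->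
  (forall x v, exists u, i x u = f x v) -> exists h, comph i h = f.
Proof.
move=> ii ex; pose g x v := sval (cid (ex x v)).
have gE x v : i x (g x v) = f x v by rewrite /g; case: cid.
have gl x : linear (g x) by move=> a u v; apply: ii; rewrite gE !hmap_linear !gE.
have gn x y (h : y ⪯ x) v : g y (rmap X h v) = rmap V h (g x v).
  by apply: ii; rewrite gE !hmap_nat gE.
by exists (@Defs.Hom _ _ _ X V g gl gn); apply: homP => x v /=.
Qed.

Lemma hom_desc V W X (p : rhom V W) (f : rhom V X) : hsurj p ->
  (forall x v, p x v = 0 -> f x v = 0) -> exists h, comph h p = f.
Proof.
move=> ps k0; pose g x w := f x (sval (cid (ps x w))).
have gE x v : g x (p x v) = f x v.
  rewrite /g; case: cid => u /= e; apply/eqP; rewrite -subr_eq0 -hmapB k0 //.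
  by rewrite hmapB e subrr.
have gl x : linear (g x).
  move=> a w w'; have [v <-] := ps x w; have [v' <-] := ps x w'.
  by rewrite -hmap_linear !gE hmap_linear.
have gn x y (h : y ⪯ x) w : g y (rmap W h w) = rmap X h (g x w).
  by have [v <-] := ps x w; rewrite -hmap_nat !gE hmap_nat.
by exists (@Defs.Hom _ _ _ W X g gl gn); apply: homP => x v /=.
Qed.

Lemma subspace_hker V W (f : rhom V W) x : lin_subspace [set v | f x v = 0].
Proof. exact/subspace_ker/hmap_linear. Qed.

Lemma subspace_him V W (f : rhom V W) x : lin_subspace [set w | exists v, f x v = w].
Proof.
have -> : [set w | exists v, f x v = w] = range (hmap f (x := x)).
  by apply/seteqP; split=> w [v]; [move=> <-; exists v|move=> _ <-; exists v].
exact/subspace_im/hmap_linear.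
Qed.

Lemma ker_ex V W (f : rhom V W) :
  exists (K : rep) (i : rhom K V), hinj i /\ hexact i f.
Proof.
have [|x y h v /= e|K [i [ii iE]]] := @sub_ex V (fun x => [set v | f x v = 0]).
- by move=> x; apply: subspace_hker.
- by rewrite hmap_nat e linear0.
- by exists K, i; split=> // x v; apply: iE.
Qed.

Lemma coker_ex V W (f : rhom V W) : Rep_pwf W ->
  exists (Q : rep) (q : rhom W Q), hsurj q /\ hexact f q.
Proof.
move=> Wf; apply: quot_ex => // [x|x y h _ [v <-]]; first exact: subspace_him.
by exists (rmap V h v); rewrite hmap_nat.
Qed.

Lemma im_ex V W (f : rhom V W) : exists (I : rep) (c : rhom V I) (m : rhom I W),
  [/\ hsurj c, hinj m & comph m c = f].
Proof.
have [|x y h w /= [v <-]|I [m [mi mE]]] := @sub_ex W (fun x => [set w | exists v, f x v = w]).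
- by move=> x; apply: subspace_him.
- by exists (rmap V h v); rewrite hmap_nat.
have [|c cE] := @hom_lift V I W m f mi; first by move=> x v; apply/mE; exists v.
exists I, c, m; split=> // x w.
have [v e] : exists v, f x v = m x w by apply/mE; exists w.
by exists v; apply: mi; rewrite -e -cE.
Qed.

Lemma iso_bij V W (f : rhom V W) : isoh f -> hinj f /\ hsurj f.
Proof.
move=> [g [gf fg]]; split=> [x|x w].
  by apply: (can_inj (g := g x)) => v; have := hom_ev gf x v.
by exists (g x w); apply: (hom_ev fg).
Qed.

Lemma bij_iso V W (f : rhom V W) : hinj f -> hsurj f -> isoh f.
Proof.
move=> fi fs; have [|g fg] := @hom_lift W V W f (idh W) fi.
  by move=> x w; have [v] := fs x w; exists v.
by exists g; split=> //; apply: homP => x v; apply: fi; apply: (hom_ev fg).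
Qed.

Lemma isomorphic_refl V : isomorphic V V.
Proof. by exists (idh V); apply: bij_iso => [x u v|x w] //; exists w. Qed.

Lemma isomorphic_sym V W : isomorphic V W -> isomorphic W V.
Proof. by move=> [f [g [gf fg]]]; exists g; exists f. Qed.

Lemma isomorphic_trans U V W : isomorphic U V -> isomorphic V W -> isomorphic U W.
Proof.
move=> [f /iso_bij[fi fs]] [g /iso_bij[gi gs]]; exists (comph g f).
apply: bij_iso => [x u v /gi /fi //|x w].
by have [v <-] := gs x w; have [u <-] := fs x v; exists u.
Qed.

Lemma isomorphic_bij V W : isomorphic V W -> exists2 f : rhom V W, hinj f & hsurj f.
Proof. by move=> [f /iso_bij[]]; exists f. Qed.

Lemma isomorphic_zero V W : isomorphic V W -> is_zero V -> is_zero W.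
Proof.
move=> [f /iso_bij[_ fs]] V0 x w.
by have [v <-] := fs x w; rewrite (V0 x v) hmap0.
Qed.

Program Definition dinl V W : rhom V (dsum V W) :=
  @Defs.Hom _ _ _ V (dsum V W) (fun x v => (v, 0)) _ _.
Next Obligation.
by move=> V W x a u v; rewrite [LHS](_ : _ = (a *: u + v, a *: (0 : W x) + 0)) // scaler0 addr0.
Qed.
Next Obligation. by move=> V W x y h v; rewrite /= /pair_map /= linear0. Qed.

Program Definition dinr V W : rhom W (dsum V W) :=
  @Defs.Hom _ _ _ W (dsum V W) (fun x v => (0, v)) _ _.
Next Obligation.
by move=> V W x a u v; rewrite [LHS](_ : _ = (a *: (0 : V x) + 0, a *: u + v)) // scaler0 addr0.
Qed.
Next Obligation. by move=> V W x y h v; rewrite /= /pair_map /= linear0. Qed.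

Program Definition dfst V W : rhom (dsum V W) V :=
  @Defs.Hom _ _ _ (dsum V W) V (fun x v => v.1) _ _.
Next Obligation. by []. Qed.
Next Obligation. by []. Qed.

Program Definition dsnd V W : rhom (dsum V W) W :=
  @Defs.Hom _ _ _ (dsum V W) W (fun x v => v.2) _ _.
Next Obligation. by []. Qed.
Next Obligation. by []. Qed.

Definition hpair X V W (f : rhom X V) (g : rhom X W) : rhom X (dsum V W) :=
  comph (dsumh f g) (diagh X).

Definition hcopair V W X (f : rhom V X) (g : rhom W X) : rhom (dsum V W) X :=
  comph (codiagh X) (dsumh f g).

Lemma dsum_iso V W V' W' : isomorphic V V' -> isomorphic W W' ->
  isomorphic (dsum V W) (dsum V' W').
Proof.
move=> [f /iso_bij[fi fs]] [g /iso_bij[gi gs]]; exists (dsumh f g).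
apply: bij_iso => [x [u1 u2] [v1 v2] /= [/fi -> /gi ->] //|x [v w]].
by have [v' <-] := fs x v; have [w' <-] := gs x w; exists (v', w').
Qed.

Lemma dsum_assoc U V W : isomorphic (dsum (dsum U V) W) (dsum U (dsum V W)).
Proof.
exists (hpair (comph (dfst U V) (dfst _ W)) (hpair (comph (dsnd U V) (dfst _ W)) (dsnd _ W))).
apply: bij_iso => [x [[u1 u2] u3] [[v1 v2] v3] /= [-> -> ->] //|x [u [v w]]].
by exists ((u, v), w).
Qed.

Lemma dsum0l V : isomorphic (dsum (rep0 A k) V) V.
Proof.
exists (dsnd _ _); apply: bij_iso => [x [u1 u2] [v1 v2] /= ->|x v].
  by congr pair; apply/rowP => -[].
by exists (0, v).
Qed.

Lemma split_iso V W (p : rhom V W) (s : rhom W V) : comph p s = idh W ->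
  exists (K : rep) (i : rhom K V), [/\ hinj i, hexact i p & isomorphic V (dsum W K)].
Proof.
move=> ps; have [K [i [ii ie]]] := ker_ex p.
exists K, i; split=> //; apply: isomorphic_sym; exists (hcopair s i); apply: bij_iso.
  apply: hinjP => x [w u] /= e.
  have w0 : w = 0.
    have /= := congr1 (p x) e; rewrite hmapD hmap0.
    have -> : p x (i x u) = 0 by apply/ie; exists u.
    by rewrite addr0 => <-; rewrite -[LHS](hom_ev ps).
  move: e; rewrite w0 hmap0 add0r => /(hinj0 ii) ->.
  by [].
move=> x v; have [|u uE] := (ie x (v - s x (p x v))).1.
  by have /= e := hom_ev ps x (p x v); rewrite hmapB e subrr.
by exists (p x v, u); rewrite /= uE addrC subrK.
Qed.
End Rep.
Arguments hom_ev {R A k V W f g} _ x v.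

(** * Serre subcategories and interval representations *)

Section Serre.
Variables (R : realType) (A : quiverA R) (k : fieldType).
Local Notation "x ⪯ y" := (preceq A x y) (at level 70).
Local Notation rep := (qrep A k).
Implicit Types (U V W X : rep) (C : rep -> Prop).

(** The closure properties common to the three categories, relative to pointwise injections,
    surjections and exactness among all representations. *)
Record serre C := Serre {
  serre_pwf : forall V, C V -> Rep_pwf V;
  serre_sub : forall V W (f : rhom V W), hinj f -> C W -> C V;
  serre_quot : forall V W (f : rhom V W), hsurj f -> C V -> C W;
  serre_ext : forall U V W (f : rhom U V) (g : rhom V W), hinj f -> hsurj g ->
    hexact f g -> C U -> C W -> C V
}.

Lemma serre_iso C V W : serre C -> isomorphic V W -> C V -> C W.
Proof. by move=> sC [f /iso_bij[fi fs]]; apply: (serre_quot sC fs). Qed.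

Lemma dsum_exact V W : [/\ hinj (dinl V W), hsurj (dsnd V W) & hexact (dinl V W) (dsnd V W)].
Proof.
split=> [x u v []//|x w|x [v w]]; first by exists (0, w).
by split=> /= [->|[u [_ ->]]] //; exists v.
Qed.

Lemma serre_dsum C V W : serre C -> C V -> C W -> C (dsum V W).
Proof. by move=> sC; have [h1 h2 h3] := dsum_exact V W; apply: serre_ext h1 h2 h3. Qed.

Lemma serre_summand C V W : serre C -> C (dsum V W) -> C V /\ C W.
Proof.
move=> sC CVW; split.
  by apply: (serre_quot sC (f := dfst V W)) CVW => x v; exists (v, 0).
by apply: (serre_quot sC (f := dsnd V W)) CVW => x v; exists (0, v).
Qed.

Lemma kernel_exact C U V W (f : rhom U V) (g : rhom V W) :
  hinj f -> hexact f g -> C U -> is_kernel C g f.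
Proof.
move=> fi ex CU; split=> // [|X h CX gh].
  by apply: homP => x u /=; apply/ex; exists u.
have [|l lE] := @hom_lift _ _ _ X U V f h fi.
  by move=> x v; apply/ex; exact: (hom_ev gh x v).
exists l; split=> // l' l'E; apply: homP => x v; apply: fi.
by have := hom_ev lE x v; have := hom_ev l'E x v => /= -> ->.
Qed.

Lemma cokernel_exact C U V W (f : rhom U V) (g : rhom V W) :
  hsurj g -> hexact f g -> C W -> is_cokernel C f g.
Proof.
move=> gs ex CW; split=> // [|X h CX hf].
  by apply: homP => x u /=; apply/ex; exists u.
have [|l lE] := @hom_desc _ _ _ V W X g h gs.
  by move=> x v /ex[u <-]; exact: (hom_ev hf x u).
exists l; split=> // l' l'E; apply: homP => x w; have [v <-] := gs x w.
by have := hom_ev lE x v; have := hom_ev l'E x v => /= -> ->.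
Qed.

Lemma ses_exact C U V W (f : rhom U V) (g : rhom V W) : C U -> C V -> C W ->
  hinj f -> hsurj g -> hexact f g -> ses C f g.
Proof.
by move=> CU CV CW fi gs ex; split=> //; [apply: kernel_exact|apply: cokernel_exact].
Qed.

(** The pointwise kernel and cokernel lie in [C], so they can be tested against the universal
    properties. The comparison maps this produces show that the categorical kernel and cokernel are
    the pointwise ones. *)
Lemma exact_ses C U V W (f : rhom U V) (g : rhom V W) : serre C -> ses C f g ->
  [/\ hinj f, hsurj g & hexact f g].
Proof.
move=> sC [CU CV CW [_ gf0 kerU] [_ _ cokU]].
have [K [i [ii ie]]] := ker_ex g.
have CK := serre_sub sC ii CV.
have gi : comph g i = 0 by apply: homP => x u; apply/ie; exists u.
have [h' [h'E _]] := kerU K i CK gi.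
have [|h hE] := @hom_lift _ _ _ U K V i f ii.
  by move=> x v; apply/ie; exact: (hom_ev gf0 x v).
have [l [_ lu]] := kerU U f CU gf0.
have h'h : comph h' h = idh U.
  have e : comph f (comph h' h) = f by rewrite comphA h'E hE.
  by rewrite -(lu _ e) (lu (idh U)) // comphid.
have ex : hexact f g.
  move=> x v; split=> [/ie[u <-]|[u <-]]; last exact: (hom_ev gf0 x u).
  by exists (h' x u); exact: (hom_ev h'E x u).
have fi : hinj f.
  apply: hinjP => x u fu; have := hom_ev h'h x u => /= <-.
  have /= := hom_ev hE x u; rewrite fu => /(hinj0 ii) ->.
  exact: hmap0.
split=> // x w.
have [Q [q [qs qe]]] := coker_ex f (serre_pwf sC CV).
have CQ := serre_quot sC qs CV.
have qf : comph q f = 0 by apply: homP => y u; apply/qe; exists u.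
have [h2 [h2E _]] := cokU Q q CQ qf.
have [|t tE] := @hom_desc _ _ _ V Q W q g qs.
  by move=> y v /qe[u <-]; exact: (hom_ev gf0 y u).
have [l2 [_ l2u]] := cokU W g CW gf0.
have th : comph t h2 = idh W.
  have e : comph (comph t h2) g = g by rewrite -comphA h2E tE.
  by rewrite -(l2u _ e) (l2u (idh W)) // compidh.
have [v qv] := qs x (h2 x w); exists v.
have := hom_ev tE x v => /= <-; rewrite qv.
exact: (hom_ev th x w).
Qed.

Lemma epih_surj C V W (f : rhom V W) : serre C -> C W -> epih C f -> hsurj f.
Proof.
move=> sC CW ef; have [Q [q [qs qe]]] := coker_ex f (serre_pwf sC CW).
have q0 : q = 0.
  apply: (ef _ q 0); first exact: serre_quot qs CW.
  by apply: homP => x v /=; apply/qe; exists v.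
by move=> x w; apply/qe; rewrite q0.
Qed.

Lemma surj_epih C V W (f : rhom V W) : hsurj f -> epih C f.
Proof.
move=> fs X g h _ e; apply: homP => x w; have [v <-] := fs x w.
exact: (hom_ev e x v).
Qed.

Lemma inj_monoh C V W (f : rhom V W) : hinj f -> monoh C f.
Proof.
by move=> fi X g h _ e; apply: homP => x v; apply: fi; exact: (hom_ev e x v).
Qed.

(** The pointwise image serves both as image and as coimage, so the comparison morphism is the
    identity. *)
Lemma serre_ker_coker C V W (f : rhom V W) : serre C -> C V -> C W ->
  has_ker_coker_im C f.
Proof.
move=> sC CV CW; have [K [i [ii ie]]] := ker_ex f.
have [Q [q [qs qe]]] := coker_ex f (serre_pwf sC CW).
have [I [c [m [cs mi mc]]]] := im_ex f.
have CI := serre_sub sC mi CW.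
have fE x v : f x v = m x (c x v) by rewrite -mc.
have kE x v : f x v = 0 <-> c x v = 0.
  by rewrite fE; split=> [/(hinj0 mi)//|->]; exact: hmap0.
have iE x w : (exists v, f x v = w) <-> exists u, m x u = w.
  split=> -[v <-]; first by exists (c x v).
  by have [v' <-] := cs x v; exists v'.
have ie' : hexact i c by move=> x v; rewrite -kE.
have qm : hexact m q by move=> x w; rewrite -iE.
exists K, Q, I, I, i, q, m, c; split.
- by apply: kernel_exact => //; apply: serre_sub ii CV.
- by apply: cokernel_exact => //; apply: serre_quot qs CW.
- exact: kernel_exact.
- exact: cokernel_exact.
exists (idh I); rewrite compidh; split=> //.
by exists (idh I); rewrite compidh.
Qed.

Lemma retract_indecomposable C V W (p : rhom V W) (s : rhom W V) : serre C ->
  indecomposable C V -> comph p s = idh W -> ~ is_zero W -> isomorphic V W.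
Proof.
move=> sC [CV _ ind] ps W0; have [K [i [ii ie VWK]]] := split_iso ps.
have CK := serre_sub sC ii CV.
have CW : C W by have [] := serre_summand sC (serre_iso sC VWK CV).
have [//|K0] := ind _ _ CW CK VWK.
exists p; apply: bij_iso => [|x w]; last by exists (s x w); exact: (hom_ev ps x w).
by apply: hinjP => x v /ie[u <-]; rewrite (K0 x u) hmap0.
Qed.

Lemma pwfP V : Rep_pwf V <-> forall x, exists n, findim (V x) n.
Proof.
split=> h x; have [n hn] := h x; first by exists n; apply: has_dim_findim.
by have [m _ hm] := findim_has_dim hn; exists m.
Qed.

Lemma RepbP V : Rep_b V <-> exists n, forall x, findim (V x) n.
Proof.
split=> -[n h].
  exists n => x; have [m mn /has_dim_findim[f fl fi]] := h x.
  have [d nE] : exists d, n = (m + d)%N by exists (n - m)%N; rewrite subnKC // ltnW.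
  rewrite nE; exists (fun v => row_mx (f v) 0).
    by move=> a u v; rewrite fl scale_row_mx add_row_mx scaler0 addr0.
  by move=> u v /eq_row_mx[/fi].
exists n.+1 => x; have [m mn hm] := findim_has_dim (h x).
by exists m.
Qed.

Lemma serre_pwfT : serre (@Rep_pwf R A k).
Proof.
split=> // [V W f fi /pwfP Wf|V W f fs /pwfP Vf|U V W f g fi gs ex /pwfP Uf /pwfP Wf];
  apply/pwfP => x.
- have [n hn] := Wf x; exists n; apply: findim_inj (fi x) hn; exact: hmap_linear.
- have [n hn] := Vf x; exists n; apply: findim_surj hn _ (fs x); exact: hmap_linear.
- have [n hn] := Uf x; have [m hm] := Wf x; exists (n + m)%N.
  apply: (findim_ext hn hm (f := hmap f (x := x)) (g := hmap g (x := x))) => //;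
    try exact: hmap_linear.
  by move=> v; rewrite ex.
Qed.

Lemma serre_b : serre (@Rep_b R A k).
Proof.
split=> [V [n h] x|V W f fi /RepbP[n Wf]|V W f fs /RepbP[n Vf]
  |U V W f g fi gs ex /RepbP[n Uf] /RepbP[m Wf]].
- by have [d _ hd] := h x; exists d.
- apply/RepbP; exists n => x; apply: findim_inj (fi x) (Wf x); exact: hmap_linear.
- apply/RepbP; exists n => x; apply: findim_surj (Vf x) _ (fs x); exact: hmap_linear.
- apply/RepbP; exists (n + m)%N => x.
  apply: (findim_ext (Uf x) (Wf x) (f := hmap f (x := x)) (g := hmap g (x := x))) => //;
    try exact: hmap_linear.
  by move=> v; rewrite ex.
Qed.
End Serre.

Section Interval.
Variable k : fieldType.

(** Scalar coordinates for the dependent fibre [kif k b]. Later computations take place in [k] and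
    need no case analysis on the boolean in the type. *)
Definition kif_val b : kif k b -> k :=
  match b with true => fun v => v | false => fun=> 0 end.
Definition kif_of b (a : k) : kif k b :=
  match b with true => a | false => 0 end.

Lemma kif_valK b : cancel (@kif_val b) (@kif_of b).
Proof. by case: b => // v; apply/rowP => -[]. Qed.

Lemma kif_val_out b (v : kif k b) : b = false -> kif_val v = 0.
Proof. by case: b v. Qed.

Lemma kif_ofK b a : kif_val (kif_of b a) = if b then a else 0.
Proof. by case: b. Qed.

Lemma kif_val_linear b : linear (@kif_val b : kif k b -> k^o).
Proof. by case: b => // a u v; rewrite /= scaler0 addr0. Qed.

Lemma kif_val_map b c (v : kif k b) : kif_val (kif_map k b c v) = if c then kif_val v else 0.
Proof. by case: b c v => -[]. Qed.
End Interval.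

Section Mint.
Variables (R : realType) (A : quiverA R) (k : fieldType).
Local Notation "x ⪯ y" := (preceq A x y) (at level 70).
Local Notation rep := (qrep A k).
Implicit Types (I J K : set R) (x y z : R).

(** Points of one segment are comparable, and [interval_ind] links the segments. *)
Lemma const_on_interval (T : Type) K (g : R -> T) :
  (forall x y z, K x -> K y -> x <= z <= y -> K z) ->
  (forall x y, K x -> K y -> y ⪯ x -> g x = g y) ->
  forall x y, K x -> K y -> g x = g y.
Proof.
move=> Kc gc x y; wlog xy : x y / x <= y.
  by move=> h Kx Ky; have [l|l] := leP x y; [|symmetry]; apply: h => //; apply: ltW.
move: x y xy; apply: (@interval_ind _ A) => [n x y _ nx ny Kx Ky|x z y xz zy h1 h2 Kx Ky].
  by case: (seg_total nx ny) => h; [symmetry|]; apply: gc.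
have Kz : K z by apply: Kc Kx Ky _; rewrite xz.
by rewrite h1 // h2.
Qed.

Variables (I : set R) (hI : interval_set I).
Local Notation M := (Mint A k hI).

Definition mcoef x (v : M x) : k := kif_val v.
Definition unit_at x : M x := @kif_of k (x \in I) 1.
Arguments mcoef {x} v.

Lemma mcoef_linear x : linear (@mcoef x : M x -> k^o).
Proof. exact: kif_val_linear. Qed.

Lemma mcoef0 x : mcoef (0 : M x) = 0.
Proof. exact: (lin0 (@mcoef_linear x)). Qed.
Lemma mcoefD x (u v : M x) : mcoef (u + v) = mcoef u + mcoef v.
Proof. exact: (linD (@mcoef_linear x)). Qed.
Lemma mcoefN x (u : M x) : mcoef (- u) = - mcoef u.
Proof. by have := linZ (@mcoef_linear x) (-1) u; rewrite !scaleN1r. Qed.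
Lemma mcoefZ x a (u : M x) : mcoef (a *: u) = a * mcoef u.
Proof. exact: (linZ (@mcoef_linear x)). Qed.

Lemma mcoef_inj x : injective (@mcoef x).
Proof. exact: can_inj (@kif_valK k (x \in I)). Qed.

Lemma mcoef_unit x : I x -> mcoef (unit_at x) = 1.
Proof. by move=> Ix; rewrite /mcoef kif_ofK mem_set. Qed.

Lemma mcoef_out x (v : M x) : ~ I x -> mcoef v = 0.
Proof.
by move=> Ix; apply: kif_val_out; rewrite memNset.
Qed.

Lemma unit_out x : ~ I x -> unit_at x = 0.
Proof. by move=> Ix; apply: mcoef_inj; rewrite mcoef0 mcoef_out. Qed.

Lemma mcoef_map x y (h : y ⪯ x) (v : M x) : I y -> mcoef (rmap M h v) = mcoef v.
Proof. by move=> Iy; rewrite /mcoef /= kif_val_map mem_set. Qed.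

Lemma mcoefE x (v : M x) : v = mcoef v *: unit_at x.
Proof.
apply: mcoef_inj; rewrite mcoefZ; have [Ix|Ix] := pselect (I x).
  by rewrite mcoef_unit // mulr1.
by rewrite !mcoef_out // mul0r.
Qed.

Lemma unit_map x y (h : y ⪯ x) : I x -> rmap M h (unit_at x) = unit_at y.
Proof.
move=> Ix; apply: mcoef_inj; have [Iy|Iy] := pselect (I y).
  by rewrite mcoef_map // !mcoef_unit.
by rewrite !mcoef_out.
Qed.

(** [u x] is the image of the generator at [x]. For [y] outside [I] the second condition says that
    [u x] restricts to 0, as it must. *)
Lemma from_Mint (X : rep) (u : forall x, X x) : (forall x, ~ I x -> u x = 0) ->
  (forall x y (h : y ⪯ x), I x -> rmap X h (u x) = u y) ->
  exists f : rhom M X, forall x v, f x v = mcoef v *: u x.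
Proof.
move=> u0 un.
have fl x : linear (fun v : M x => mcoef v *: u x).
  by move=> a v w; rewrite mcoefD mcoefZ scalerDl scalerA.
have fn x y (h : y ⪯ x) (v : M x) :
    mcoef (rmap M h v) *: u y = rmap X h (mcoef v *: u x).
  rewrite linearZ /=; have [Ix|Ix] := pselect (I x); last first.
    by rewrite [v]mcoefE (unit_out Ix) scaler0 linear0 !mcoef0 !scale0r.
  have [Iy|Iy] := pselect (I y); first by rewrite un // mcoef_map.
  by rewrite (un _ _ h Ix) (u0 _ Iy) !scaler0.
by exists (@Defs.Hom _ _ _ M X _ fl fn).
Qed.

(** Dual to maps out of an interval representation: for [x] outside [I] the naturality condition
    says that [phi y] vanishes on everything restricted from [x]. *)
Lemma to_Mint (X : rep) (phi : forall x, X x -> k^o) : (forall x, linear (phi x)) ->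
  (forall x v, ~ I x -> phi x v = 0) ->
  (forall x y (h : y ⪯ x) v, I y -> phi y (rmap X h v) = phi x v) ->
  exists f : rhom X M, forall x v, mcoef (f x v) = phi x v.
Proof.
move=> pl p0 pn; pose f x v : M x := phi x v *: unit_at x.
have fE x v : mcoef (f x v) = phi x v.
  rewrite mcoefZ; have [Ix|Ix] := pselect (I x); first by rewrite mcoef_unit // mulr1.
  by rewrite mcoef_out // mulr0 p0.
have fl x : linear (f x) by move=> a u v; rewrite /f pl scalerDl scalerA.
have fn x y (h : y ⪯ x) v : f y (rmap X h v) = rmap M h (f x v).
  apply: mcoef_inj; rewrite fE; have [Iy|Iy] := pselect (I y).
    by rewrite pn // mcoef_map.
  by rewrite p0 // mcoef_out.
by exists (@Defs.Hom _ _ _ X M f fl fn).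
Qed.

Lemma hom_unit (X : rep) (f : rhom M X) x v : f x v = mcoef v *: f x (unit_at x).
Proof. by rewrite -hmapZ -mcoefE. Qed.

Lemma hom_unit_map (X : rep) (f : rhom M X) x y (h : y ⪯ x) : I x ->
  rmap X h (f x (unit_at x)) = f y (unit_at y).
Proof. by move=> Ix; rewrite -hmap_nat unit_map. Qed.

Lemma hom_Mint_eq (X : rep) (f g : rhom M X) :
  (forall x, I x -> f x (unit_at x) = g x (unit_at x)) -> f = g.
Proof.
move=> h; apply: homP => x v; rewrite [v]mcoefE !hmapZ.
have [Ix|Ix] := pselect (I x); first by rewrite h.
by rewrite unit_out // !hmap0.
Qed.

Lemma findim_Mint x : findim (M x) 1.
Proof.
exists (fun v => (mcoef v)%:M).
  by move=> a u v; rewrite mcoefD mcoefZ raddfD /= scale_scalar_mx.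
by move=> u v /matrixP/(_ 0 0); rewrite !mxE eqxx !mulr1n => /mcoef_inj.
Qed.

Lemma Mint_nonzero : ~ is_zero M.
Proof.
have [[x Ix] _] := hI => /(_ x (unit_at x)) /(congr1 mcoef).
by rewrite mcoef_unit // mcoef0 => /eqP; rewrite oner_eq0.
Qed.
End Mint.
Arguments mcoef {R A k I hI x} v.

Section MintHom.
Variables (R : realType) (A : quiverA R) (k : fieldType).
Local Notation "x ⪯ y" := (preceq A x y) (at level 70).
Local Notation rep := (qrep A k).
Variables (I J : set R) (hI : interval_set I) (hJ : interval_set J).
Local Notation MI := (Mint A k hI).
Local Notation MJ := (Mint A k hJ).
Local Notation e := (@unit_at R A k I hI).
Local Notation sc f x := (mcoef (hmap f (e x))).

Lemma hom_scalar_const (f : rhom MI MJ) x y : (I `&` J) x -> (I `&` J) y ->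
  sc f x = sc f y.
Proof.
move: x y; apply: (@const_on_interval _ A) => [x y z [Ix Jx] [Iy Jy] h|x y [Ix Jx] [Iy Jy] h].
  by split; [apply: ((interval_setP I).1 hI).2 Ix Iy h|apply: ((interval_setP J).1 hJ).2 Jx Jy h].
by rewrite -(hom_unit_map f h Ix) mcoef_map.
Qed.

Lemma hom_scalar_eq (f g : rhom MI MJ) x : (I `&` J) x -> sc f x = sc g x -> f = g.
Proof.
move=> IJx fg; apply: hom_Mint_eq => y Iy; apply: mcoef_inj.
have [Jy|Jy] := pselect (J y); last by rewrite !mcoef_out.
by rewrite !(@hom_scalar_const _ y x).
Qed.

(** The scalar of a morphism is constant on the interval [I] ∩ [J]. Evaluation at one point where
    some [f0] is nonzero is then injective, and it is onto by the multiples of [f0]. *)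
Lemma hom_Mint_dichotomy :
  lmod_iso (rhom MI MJ) k^o \/ forall f : rhom MI MJ, f = 0.
Proof.
have [h|/existsNP[f0 f0n]] := pselect (forall f : rhom MI MJ, f = 0); [by right|left].
have [x [IJx fx]] : exists x, (I `&` J) x /\ sc f0 x != 0.
  apply: contrapT => h; apply: f0n; apply: hom_Mint_eq => y Iy; apply: mcoef_inj.
  rewrite hom0E mcoef0; have [Jy|Jy] := pselect (J y); last by rewrite mcoef_out.
  by apply: contrapT => /eqP ny; apply: h; exists y.
have Fl : linear (fun f : rhom MI MJ => sc f x : k^o).
  by move=> a f g; rewrite homDE homZE mcoefD mcoefZ.
exists (mklin Fl); exists (fun a => (a / sc f0 x) *: f0) => [f|a]; rewrite mklinE.
  by apply: (hom_scalar_eq IJx); rewrite homZE mcoefZ mulfVK.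
by rewrite homZE mcoefZ mulfVK.
Qed.
End MintHom.

Section MintEnd.
Variables (R : realType) (A : quiverA R) (k : fieldType).
Variables (I : set R) (hI : interval_set I).
Local Notation M := (Mint A k hI).

Lemma end_scalar (f : rhom M M) : exists a, f = a *: idh M.
Proof.
have [[x Ix] _] := hI; exists (mcoef (f x (unit_at A k hI x))).
by apply: (@hom_scalar_eq _ _ _ _ _ _ _ _ _ x) => //; rewrite homZE mcoefZ /= mcoef_unit ?mulr1.
Qed.

(** The idempotent belonging to [V1] is a scalar [a]. It fixes [V1] and kills [V2], so one of the
    two vanishes according to whether [a] is 0. *)
Lemma Mint_indecomposable C : C M -> indecomposable C M.
Proof.
move=> CM; split=> //; first exact: Mint_nonzero.
move=> V1 V2 _ _ [F [G [GF FG]]].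
have [a aE] := end_scalar (comph G (comph (dinl V1 V2) (comph (dfst V1 V2) F))).
have GE x w : G x ((F x (G x w)).1, 0) = a *: G x w by exact: (hom_ev aE x (G x w)).
have FGE x w : F x (G x w) = w by exact: (hom_ev FG x w).
have [a0|a0] := eqVneq a 0.
  left=> x v; have := GE x (v, 0); rewrite FGE a0 scale0r /= => h.
  by have := FGE x (v, 0); rewrite h hmap0 => -[].
right=> x v; have := GE x (0, v); rewrite FGE /= => h.
have := congr1 (F x) h; rewrite FGE hmapZ FGE => /(congr1 snd) /= /esym/eqP.
by rewrite scaler_eq0 (negbTE a0) => /eqP.
Qed.
End MintEnd.

(** * Interval projectives and finitely generated representations *)

Section Projective.
Variables (R : realType) (A : quiverA R) (k : fieldType).
Local Notation "x ⪯ y" := (preceq A x y) (at level 70).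
Local Notation rep := (qrep A k).
Implicit Types (U V W X P Q : rep) (I J : set R).

Lemma Mint_pwf I (hI : interval_set I) : Rep_pwf (Mint A k hI).
Proof. by apply/pwfP => x; exists 1%N; apply: findim_Mint. Qed.

(* The stable images [S j] of [V] along a cofinal sequence in [I] form an
   inverse system of surjections, through which an element can be lifted. *)
Lemma pint_split I (hI : interval_set I) V (p : rhom V (Mint A k hI)) :
  pint A I -> Rep_pwf V -> hsurj p -> exists s, comph p s = idh (Mint A k hI).
Proof.
move=> pI Vf ps; have [u [uI uS uc]] := pint_cofinal pI.
have uL i j : (i <= j)%N -> u i ⪯ u j.
  move=> /subnKC <-; elim: (j - i)%N => [|d IH]; first by rewrite addn0; apply: preceq_refl.
  by rewrite addnS; apply: preceq_trans IH (uS _).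
pose T j i := [set v | exists (h : u j ⪯ u i) w, rmap V h w = v].
have TA j i i' : (j <= i)%N -> (i <= i')%N -> T j i' `<=` T j i.
  move=> ji ii v [h [w <-]]; exists (uL _ _ ji), (rmap V (uL _ _ ii) w).
  exact: rmap_comp.
have Tmin j : exists2 m, (j <= m)%N & forall i, (j <= i)%N -> T j m `<=` T j i.
  have [n /has_dim_findim Vn] := Vf (u j).
  apply: (@chain_min _ _ _ _ [set i | (j <= i)%N] (T j) Vn); first by exists j => /=.
    move=> i /= ji; split=> [|a _ _ [h [w <-]] [h' [w' <-]]].
      by exists (uL _ _ ji), 0; rewrite linear0.
    by exists h, (a *: w + w'); rewrite linearP !(rmap_irr h h').
  move=> i i' /= ji ji'; have [l|/ltnW l] := leqP i i'.
    by right; apply: TA.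
  by left; apply: TA.
pose m j := s2val (cid2 (Tmin j)).
have mj j : (j <= m j)%N by rewrite /m; case: cid2.
have mT j i : (j <= i)%N -> T j (m j) `<=` T j i by rewrite /m; case: cid2 => ? /= _; apply.
pose S j := T j (m j).
(* Stability at [j] lets an element of [S j] be lifted to level [m j.+1]; restricted to level
   [j.+1], the lift belongs to [S j.+1]. *)
have next j (t : {v | S j v}) : {t' : {v | S j.+1 v} | rmap V (uS j) (sval t') = sval t}.
  apply: cid; case: t => v Sv /=.
  have [h [w hw]] := mT j (m j.+1) (ltnW (mj j.+1)) v Sv.
  have St : S j.+1 (rmap V (uL _ _ (mj j.+1)) w) by exists (uL _ _ (mj j.+1)), w.
  by exists (exist _ _ St) => /=; rewrite -hw; apply: rmap_comp.
have [t0 pt0] : exists t0 : {v | S 0%N v}, mcoef (p (u 0%N) (sval t0)) = 1.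
  have [w pw] := ps _ (unit_at A k hI (u (m 0%N))).
  have St : S 0%N (rmap V (uL _ _ (mj 0%N)) w) by exists (uL _ _ (mj 0%N)), w.
  exists (exist _ _ St) => /=.
  by rewrite hmap_nat mcoef_map // pw mcoef_unit.
pose t := fix t j : {v | S j v} := if j is j'.+1 then sval (next j' (t j')) else t0.
have tS j : rmap V (uS j) (sval (t j.+1)) = sval (t j) by rewrite /=; case: (next _ _).
have tL i j (h : u i ⪯ u j) : (i <= j)%N -> rmap V h (sval (t j)) = sval (t i).
  move=> l; move: h; rewrite -(subnKC l); elim: (j - i)%N => [|d IH].
    by rewrite addn0 => h; apply: rmap_id.
  rewrite addnS => h; rewrite -(IH (uL _ _ (leq_addr _ _))) -[in RHS]tS.
  by symmetry; apply: rmap_comp.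
have pt j : mcoef (p (u j) (sval (t j))) = 1.
  by elim: j => [//|j IH]; rewrite -IH -[in RHS]tS hmap_nat mcoef_map.
have sE x : {v | (I x -> forall j (h : x ⪯ u j), rmap V h (sval (t j)) = v) /\ (~ I x -> v = 0)}.
  apply: cid; have [Ix|Ix] := pselect (I x); last by exists 0.
  have [j xj] := uc _ Ix; exists (rmap V xj (sval (t j))); split=> // _ i h.
  have [l|/ltnW l] := leqP i j.
    by rewrite -(tL _ _ (uL _ _ l) l); apply: rmap_comp.
  by rewrite -(tL _ _ (uL _ _ l) l); symmetry; apply: rmap_comp.
have [|x y h Ix|s sP] := @from_Mint _ _ _ _ hI V (fun x => sval (sE x)).
- by move=> x Ix; case: (svalP (sE x)) => _; apply.
- have Iy := pint_downset pI Ix h; have [j xj] := uc _ Ix.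
  rewrite -((svalP (sE x)).1 Ix j xj) -((svalP (sE y)).1 Iy j (preceq_trans h xj)).
  exact: rmap_comp.
exists s; apply: hom_Mint_eq => x Ix; apply: mcoef_inj; rewrite /= sP hmapZ mcoefZ mcoef_unit //.
have [j xj] := uc _ Ix; rewrite -((svalP (sE x)).1 Ix j xj).
by rewrite hmap_nat mcoef_map // pt mulr1.
Qed.

(** The pullback of [e] along [f], realised as a kernel, surjects onto [P]. A section of this
    surjection followed by the projection to [V] is the required lift. *)
Lemma split_projective P : Rep_pwf P ->
  (forall V (p : rhom V P), Rep_pwf V -> hsurj p -> exists s, comph p s = idh P) ->
  projective Rep_pwf P.
Proof.
move=> Pf split; split=> // V W e f Vf Wf /(epih_surj (serre_pwfT A k) Wf) es.
have [K [i [ii ie]]] := ker_ex (hcopair e (- f)).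
have [||s sE] := split K (comph (dsnd V P) i).
- exact: (serre_sub (serre_pwfT A k) ii (serre_dsum (serre_pwfT A k) Vf Pf)).
- move=> x v; have [w wE] := es x (f x v).
  have [|c cE] := (ie x (w, v)).1; first by rewrite /= wE subrr.
  by exists c; rewrite /= cE.
exists (comph (dfst V P) (comph i s)); apply: homP => x v /=.
have /= := hom_ev sE x v; set z := i x (s x v) => zv.
have : (hcopair e (- f)) x z = 0 by apply/ie; exists (s x v).
by rewrite /= zv => /subr0_eq.
Qed.

Lemma pint_projective I (hI : interval_set I) : pint A I ->
  projective Rep_pwf (Mint A k hI).
Proof.
move=> pI; apply: split_projective; first exact: Mint_pwf.
by move=> V p Vf ps; apply: pint_split.
Qed.

Definition pproj X := exists I (hI : interval_set I), pint A I /\ X = Mint A k hI.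

(* A nonzero functional on [P x1] induces a surjection of [P] onto [M_J] for a
   chain [J]; it lifts to the projective cover of [M_J]. *)
Lemma projective_pproj P : projective Rep_pwf P -> indecomposable Rep_pwf P ->
  exists2 X, pproj X & isomorphic P X.
Proof.
move=> [Pf Pproj] Pind; have [_ P0 _] := Pind.
pose supp x := exists v : P x, v <> 0.
(* The support above a sink [x0] may have two branches. A point of support strictly above [x0] is no
   sink and serves as [x1]; if there is none, [x0] itself is the only point of support above
   [x0]. *)
have [x1 [[v1 v10] x1c]] : exists x1, supp x1 /\ forall y z, x1 ⪯ y -> x1 ⪯ z ->
    supp y -> supp z -> y ⪯ z \/ z ⪯ y.
  have [x0 [v0 v00]] : exists x, supp x.
    apply: contrapT => h; apply: P0 => x v; apply: contrapT => v0.
    by apply: h; exists x, v.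
  have [[x [x0x nx0 sx]]|h] := pselect (exists x, [/\ x0 ⪯ x, x0 <> x & supp x]).
    by exists x; split=> // y z xy xz _ _; apply: up_chain x0x nx0 xy xz.
  exists x0; split; first by exists v0.
  have {}h y : x0 ⪯ y -> supp y -> y = x0.
    by move=> xy sy; apply: contrapT => ny; apply: h; exists y; split=> // e; apply: ny.
  by move=> y z hy hz sy sz; left; rewrite (h _ hy sy) (h _ hz sz); apply: preceq_refl.
have [n /has_dim_findim Pn] := Pf x1.
have [|phi [phil _ phi1]] := @findim_functional _ _ _ [set 0] v1 Pn _ v10.
  by split=> // a u v /= -> ->; rewrite scaler0 addr0.
pose J := [set x | exists (h : x1 ⪯ x) v, phi (rmap P h v) <> 0].
have Jx1 : J x1.
  by exists (preceq_refl A x1), v1; rewrite rmap_id phi1; apply/eqP/oner_neq0.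
have Jle x : J x -> x1 ⪯ x by case.
have Js x : J x -> supp x.
  by move=> [h [v nv]]; exists v => v0; apply: nv; rewrite v0 linear0 (lin0 phil).
have Jtot x y : J x -> J y -> x ⪯ y \/ y ⪯ x.
  by move=> Jx Jy; apply: x1c; [apply: Jle|apply: Jle|apply: Js|apply: Js].
have Jconv x y z : J x -> J y -> x ⪯ z -> z ⪯ y -> J z.
  move=> Jx [h [v nv]] xz zy; have x1z := preceq_trans (Jle _ Jx) xz.
  by exists x1z, (rmap P zy v); rewrite (rmap_comp _ _ h).
have J0 : J !=set0 by exists x1.
have hJ := chain_interval J0 Jtot Jconv.
pose I := [set x | exists2 y, J y & x ⪯ y].
have pI : pint A I by apply: chain_pint.
have hI := pint_interval pI.
have JI x : J x -> I x by move=> Jx; exists x => //; apply: preceq_refl.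
pose psi x (v : P x) : k^o := if pselect (x1 ⪯ x) is left h then phi (rmap P h v) else 0.
have psiE x (h : x1 ⪯ x) v : psi x v = phi (rmap P h v).
  by rewrite /psi; case: pselect => // h'; rewrite (rmap_irr h h').
have psi0 x v : ~ J x -> psi x v = 0.
  move=> nJ; rewrite /psi; case: pselect => // h; apply: contrapT => nv.
  by apply: nJ; exists h, v.
have psil x : linear (psi x).
  move=> a u v; rewrite /psi; case: pselect => h; first by rewrite linearP phil.
  by rewrite scaler0 addr0.
have [|q qE] := @to_Mint _ _ _ _ hJ P psi psil psi0.
  move=> x y h v Jy; have x1y := Jle _ Jy.
  by rewrite (psiE _ (preceq_trans x1y h)) (psiE _ x1y); congr phi; apply: rmap_comp.
have qs x : J x -> exists v, mcoef (q x v) = 1.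
  move=> [h [v /eqP nv]]; exists ((phi (rmap P h v))^-1 *: v).
  by rewrite qE (psiE _ h) linearZ /= (linZ phil); exact: mulVf.
have qs' : hsurj q.
  move=> x w; have [Jx|Jx] := pselect (J x).
    have [v qv] := qs _ Jx; exists (mcoef w *: v); apply: mcoef_inj.
    by rewrite hmapZ mcoefZ qv mulr1.
  by exists 0; apply: mcoef_inj; rewrite !mcoef_out.
have [|x y h Ix|r rE] := @from_Mint _ _ _ _ hI (Mint A k hJ) (unit_at A k hJ).
- by move=> x Ix; apply: unit_out => /JI.
- have [Jx|Jx] := pselect (J x); first exact: unit_map.
  rewrite (unit_out A k hJ Jx) linear0 unit_out // => Jy; apply: Jx.
  by have [z Jz xz] := Ix; apply: Jconv Jy Jz h xz.
have rc x v : J x -> mcoef (r x v) = mcoef v by move=> Jx; rewrite rE mcoefZ mcoef_unit ?mulr1.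
have rs : hsurj r.
  move=> x w; have [Jx|Jx] := pselect (J x).
    exists (mcoef w *: unit_at A k hI x); apply: mcoef_inj.
    by rewrite rc // mcoefZ mcoef_unit ?mulr1 //; apply: JI.
  by exists 0; apply: mcoef_inj; rewrite !mcoef_out.
have [g gE] := Pproj _ _ r q (Mint_pwf hI) (Mint_pwf hJ) (surj_epih rs).
(* Every point of [I] lies below a point of [J], where the lift [g] is onto because [q] is;
   restriction in M_I carries the generator down. *)
have gs : hsurj g.
  move=> x w; have [[y Jy xy]|Ix] := pselect (I x); last first.
    by exists 0; apply: mcoef_inj; rewrite !mcoef_out.
  have [v qv] := qs _ Jy; exists (mcoef w *: rmap P xy v); apply: mcoef_inj.
  rewrite hmapZ mcoefZ hmap_nat mcoef_map; last by exists y.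
  by have /= e := hom_ev gE y v; rewrite -(rc _ _ Jy) e qv mulr1.
have [s gs1] := pint_split pI Pf gs.
exists (Mint A k hI); first by exists I, hI.
exact: retract_indecomposable (serre_pwfT A k) Pind gs1 (@Mint_nonzero _ _ _ _ _).
Qed.

(** A list-like form of [dsums], suited to induction on the summands. *)
Inductive sums (G : rep -> Prop) : rep -> Prop :=
| sums0 : sums G (rep0 A k)
| sumsS X P : G X -> sums G P -> sums G (dsum X P).

Lemma sums_dsums G P : sums G P ->
  exists n (Q : 'I_n -> rep), (forall i, G (Q i)) /\ P = dsums Q.
Proof.
elim=> [|X {}P GX _ [n [Q [GQ ->]]]].
  by exists 0%N, (fun=> rep0 A k); split; [case|rewrite /dsums big_ord0].
exists n.+1, (fun i => if unlift ord0 i is Some j then Q j else X); split.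
  by move=> i; case: unliftP => [j _|_].
rewrite /dsums big_ord_recl unlift_none; congr dsum.
by apply: eq_bigr => i _; rewrite liftK.
Qed.

Lemma dsums_sums G n (Q : 'I_n -> rep) : (forall i, G (Q i)) -> sums G (dsums Q).
Proof.
elim: n Q => [|n IH] Q GQ; first by rewrite /dsums big_ord0; apply: sums0.
by rewrite /dsums big_ord_recl; apply: sumsS => //; apply: IH.
Qed.

Lemma sums_dsum G P Q : sums G P -> sums G Q ->
  exists2 T, sums G T & isomorphic (dsum P Q) T.
Proof.
move=> + sQ; elim=> [|X {}P GX _ [T sT iT]].
  by exists Q => //; apply: dsum0l.
exists (dsum X T); first exact: sumsS.
by apply: isomorphic_trans (dsum_assoc _ _ _) _; apply: dsum_iso iT; apply: isomorphic_refl.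
Qed.

Lemma sums_iso (G H : rep -> Prop) P : (forall X, G X -> exists2 Y, H Y & isomorphic X Y) ->
  sums G P -> exists2 Q, sums H Q & isomorphic P Q.
Proof.
move=> GH; elim=> [|X {}P GX _ [Q sQ iQ]].
  by exists (rep0 A k); [apply: sums0|apply: isomorphic_refl].
by have [Y HY iY] := GH _ GX; exists (dsum Y Q); [apply: sumsS|apply: dsum_iso].
Qed.

Lemma rep0_zero : is_zero (rep0 A k).
Proof. by move=> x v; apply/rowP => -[]. Qed.

Lemma rep0_pwf : Rep_pwf (rep0 A k).
Proof.
apply/pwfP => x; exists 0%N; exists id => //.
Qed.

Lemma serre_rep0 C V : serre C -> C V -> C (rep0 A k).
Proof.
move=> sC; apply: (serre_sub sC (f := (0 : rhom (rep0 A k) V))).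
by move=> x u v _; rewrite (rep0_zero u) (rep0_zero v).
Qed.

Lemma sums_serre C G P : serre C -> C (rep0 A k) -> (forall X, G X -> C X) ->
  sums G P -> C P.
Proof. by move=> sC C0 GC; elim=> // X Q /GC CX _ CQ; apply: serre_dsum. Qed.

Definition fgproj := sums pproj.

Lemma fgproj_pwf P : fgproj P -> Rep_pwf P.
Proof.
apply: sums_serre; [exact: serre_pwfT|exact: rep0_pwf|].
by move=> X [I [hI [_ ->]]]; apply: Mint_pwf.
Qed.

Lemma fgproj_projective P : fgproj P -> projective Rep_pwf P.
Proof.
move=> fP; split; first exact: fgproj_pwf.
move=> V W e f Vf Wf ee; elim: fP f => [|X {}P [I [hI [pI ->]]] _ IH] f.
  by exists 0; apply: homP => x v; rewrite (rep0_zero v) !hmap0.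
have [_ /(_ _ _ e (comph f (dinl _ _)) Vf Wf ee)[g1 g1E]] := pint_projective hI pI.
have [g2 g2E] := IH (comph f (dinr _ _)).
exists (hcopair g1 g2); apply: homP => x [u v] /=.
have /= := hom_ev g1E x u; have /= := hom_ev g2E x v.
rewrite hmapD => -> ->; rewrite -hmapD.
by congr (f x _); congr pair; rewrite ?addr0 ?add0r.
Qed.

(** Abstract indecomposable projectives are traded for interval ones, so that later arguments only
    meet sums of [pproj]. *)
Lemma rep_fgP V : rep_fg V <->
  Rep_pwf V /\ exists P (f : rhom P V), fgproj P /\ hsurj f.
Proof.
split=> -[Vf].
  move=> [n [Q [Qp [f /(epih_surj (serre_pwfT A k) Vf) fs]]]]; split=> //.
  have sQ : sums (fun X => projective Rep_pwf X /\ indecomposable Rep_pwf X) (dsums Q).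
    exact: dsums_sums.
  have [|P sP /isomorphic_sym/isomorphic_bij[g _ gs]] := @sums_iso _ pproj _ _ sQ.
    by move=> X [pX iX]; apply: projective_pproj.
  exists P, (comph f g); split=> // x v.
  by have [w <-] := fs x v; have [w' <-] := gs x w; exists w'.
move=> [P [f [/sums_dsums[n [Q [Qp PQ]]] fs]]]; split=> //; exists n, Q; subst P; split.
  move=> i; have [I [hI [pI ->]]] := Qp i.
  by split; [apply: pint_projective|apply: Mint_indecomposable; apply: Mint_pwf].
by exists f; apply: surj_epih.
Qed.

Definition fst_supp I (hI : interval_set I) P K (i : rhom K (dsum (Mint A k hI) P)) :=
  [set x | exists v, mcoef (i x v).1 <> 0].

(** [D] is also closed upwards within the support of the first coordinate. The first coordinate cut
    off outside [D] is therefore still a morphism, onto M_D; it splits, and the kernel [K'] has no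
    first coordinate left on [D]. *)
Lemma peel I (hI : interval_set I) P K (i : rhom K (dsum (Mint A k hI) P)) D :
  Rep_pwf K -> pint A I -> pint A D -> D `<=` fst_supp i ->
  (forall x y, D y -> y ⪯ x -> fst_supp i x -> D x) ->
  exists X K' (i' : rhom K' K), [/\ pproj X, hinj i', isomorphic K (dsum X K') &
    forall x u, D x -> mcoef (i x (i' x u)).1 = 0].
Proof.
move=> Kf pI pD DS Dup; have hD := pint_interval pD.
have SI x : fst_supp i x -> I x.
  by move=> [v nv]; apply: contrapT => nI; apply: nv; rewrite mcoef_out.
pose phi x (v : K x) : k^o := if `[< D x >] then mcoef (i x v).1 else 0.
have [|x v|x y h v|p pE] := @to_Mint _ _ _ _ hD K phi.
- move=> x a u v; rewrite /phi; case: asboolP => _; last by rewrite scaler0 addr0.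
  by rewrite hmap_linear /= mcoefD mcoefZ.
- by rewrite /phi; case: asboolP.
- rewrite /phi => Dy; rewrite (asboolT Dy) hmap_nat /= mcoef_map //; last exact/SI/DS.
  case: asboolP => // nD; apply: contrapT => nv; apply: nD.
  by apply: (Dup _ _ Dy h); exists v.
have ps : hsurj p.
  move=> x w; have [Dx|Dx] := pselect (D x); last first.
    by exists 0; apply: mcoef_inj; rewrite !mcoef_out.
  have [v /eqP nv] := DS _ Dx; exists (mcoef w *: ((mcoef (i x v).1)^-1 *: v)).
  apply: mcoef_inj; rewrite pE /phi asboolT // !hmapZ /= !mcoefZ mulVf ?mulr1 //.
have [s sE] := pint_split pD Kf ps.
have [K' [i' [ii ie iso]]] := split_iso sE.
exists (Mint A k hD), K', i'; split=> //; first by exists D, hD.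
move=> x u Dx; have : p x (i' x u) = 0 by apply/ie; exists u.
by move=> /(congr1 mcoef); rewrite pE mcoef0 /phi asboolT.
Qed.

(* A subrepresentation of [M_I + P] splits off its image in [M_I], which is
   again a sum of at most two projective intervals. *)
Lemma sub_fgproj P K (i : rhom K P) : fgproj P -> hinj i ->
  exists2 Q, fgproj Q & isomorphic K Q.
Proof.
move=> fP; elim: fP K i => [|X {}P [I [hI [pI ->]]] fP IH] K i ii.
  exists (rep0 A k); first exact: sums0.
  exists i; apply: bij_iso => // x w; exists 0.
  by rewrite hmap0 (rep0_zero w).
have fIP : fgproj (dsum (Mint A k hI) P) by apply: sumsS => //; exists I, hI.
have pwf_inj K1 (j : rhom K1 (dsum (Mint A k hI) P)) : hinj j -> Rep_pwf K1.
  by move=> ji; apply: (serre_sub (serre_pwfT A k) ji); apply: fgproj_pwf.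
have case0 K1 (j : rhom K1 (dsum (Mint A k hI) P)) : hinj j ->
    (forall x v, mcoef (j x v).1 = 0) -> exists2 Q, fgproj Q & isomorphic K1 Q.
  move=> ji j0; apply: (IH K1 (comph (dsnd _ _) j)); apply: hinjP => x v /= e.
  apply: (hinj0 ji); rewrite [LHS]surjective_pairing e.
  by congr pair; apply: mcoef_inj; rewrite j0 mcoef0.
have supp_down K1 (j : rhom K1 (dsum (Mint A k hI) P)) : downset A (fst_supp j).
  move=> x y [v nv] yx; exists (rmap K1 yx v); rewrite hmap_nat /= mcoef_map //.
  apply: (pint_downset pI) yx; apply: contrapT => nI; apply: nv.
  by rewrite mcoef_out.
have suppI K1 (j : rhom K1 (dsum (Mint A k hI) P)) : fst_supp j `<=` I.
  by move=> x [v nv]; apply: contrapT => nI; apply: nv; rewrite mcoef_out.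
have case1 K1 (j : rhom K1 (dsum (Mint A k hI) P)) : hinj j ->
    fst_supp j = set0 \/ pint A (fst_supp j) -> exists2 Q, fgproj Q & isomorphic K1 Q.
  move=> ji [S0|pS].
    apply: (case0 _ j) => // x v; apply: contrapT => nv.
    by have : fst_supp j x; [exists v|rewrite S0].
  have [//|//|X0 [K' [i' [pX i'i iso j0]]]] := @peel _ _ _ _ j _ (pwf_inj _ _ ji) pI pS.
  have [|x v|Q fQ iQ] := case0 K' (comph j i').
  - by move=> x u v /ji /i'i.
  - have [Sx|nS] := pselect (fst_supp j x); first exact: j0.
    by apply: contrapT => nv; apply: nS; exists (i' x v).
  exists (dsum X0 Q); first exact: sumsS.
  by apply: isomorphic_trans iso _; apply: dsum_iso => //; apply: isomorphic_refl.
have [S0|[pS|[D1 [D2 [l1 l2 S12 D12]]]]] := pint_sub pI (supp_down _ i) (@suppI _ i).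
- by apply: case1 ii _; left.
- by apply: case1 ii _; right.
have D1S : D1 `<=` fst_supp i by rewrite S12 => x; left.
(* When there are two legs, [D1] is removed first. The remaining support is a downset inside [D2],
   hence empty or again a leg, and [case1] applies. *)
have [x y D1y yx|X0 [K' [i' [pX i'i iso j0]]]] :=
  @peel _ _ _ _ i _ (pwf_inj _ _ ii) pI (or_intror l1) D1S.
  rewrite {1}S12 => -[//|D2x]; exfalso.
  have [n [_ _ D2d]] := l2.
  by have : (D1 `&` D2) y; [split=> //; apply: D2d yx|rewrite D12].
have ji : hinj (comph i i') by move=> x u v /ii /i'i.
have S2 : fst_supp (comph i i') `<=` D2.
  move=> x [v nv]; have : fst_supp i x by exists (i' x v).
  by rewrite S12 => -[D1x|//]; exfalso; apply: nv; apply: j0.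
have [|Q fQ iQ] := case1 _ _ ji.
  have [->|/set0P S0] := eqVneq (fst_supp (comph i i')) set0; [by left|right; right].
  have [n [_ D2n _]] := l2; exists n; split=> // x /S2 /D2n //.
exists (dsum X0 Q); first exact: sumsS.
by apply: isomorphic_trans iso _; apply: dsum_iso => //; apply: isomorphic_refl.
Qed.

Lemma serre_fg : serre (@rep_fg R A k).
Proof.
have sP := serre_pwfT A k.
split=> [V []//|V W f fi /rep_fgP[Wf [P [p [fP ps]]]]|V W f fs /rep_fgP[Vf [P [p [fP ps]]]]
  |U V W f g fi gs ex /rep_fgP[Uf [P [p [fP ps]]]] /rep_fgP[Wf [Q [q [fQ qs]]]]];
  apply/rep_fgP.
- split; first exact: serre_sub sP _ _ _ fi Wf.
  (* The preimage in [P] of the subobject is a subrepresentation of [P], hence again a sum of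
     projective intervals, and it maps onto [V]. *)
  have [||K [j [ji jE]]] := @sub_ex _ _ _ P (fun x => [set v | exists u, f x u = p x v]).
  + move=> x; split=> [|a u v [u' eu] [v' ev]]; first by exists 0; rewrite !hmap0.
    by exists (a *: u' + v'); rewrite !hmap_linear eu ev.
  + by move=> x y h v [u eu]; exists (rmap V h u); rewrite !hmap_nat eu.
  have [Q fQ /isomorphic_sym/isomorphic_bij[t _ ts]] := sub_fgproj fP ji.
  have [|l lE] := @hom_lift _ _ _ K V W f (comph p j) fi.
    by move=> x v; apply/jE; exists v.
  exists Q, (comph l t); split=> // x v.
  have [w pw] := ps x (f x v).
  have [u uw] : exists u, j x u = w by apply/jE; exists v; rewrite pw.
  have [u' uu] := ts x u; exists u'; apply: fi; rewrite /= uu.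
  by have /= -> := hom_ev lE x u; rewrite uw.
- split; first exact: serre_quot sP _ _ _ fs Vf.
  exists P, (comph f p); split=> // x w.
  by have [v <-] := fs x w; have [u <-] := ps x v; exists u.
- have Vf := serre_ext sP fi gs ex Uf Wf; split=> //.
  (* As in the horseshoe lemma, the cover of [W] is lifted to [V] and combined with the cover of
     [U]. *)
  have [_ /(_ _ _ g q Vf Wf (surj_epih gs))[l lE]] := fgproj_projective fQ.
  have [T fT /isomorphic_sym/isomorphic_bij[t _ ts]] := sums_dsum fP fQ.
  exists T, (comph (hcopair (comph f p) l) t); split=> // x v.
  have [b qb] := qs x (g x v).
  have [|u fu] := (ex x (v - l x b)).1.
    by rewrite hmapB; have /= -> := hom_ev lE x b; rewrite qb subrr.
  have [a pa] := ps x u; have [c tc] := ts x (a, b); exists c.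
  by rewrite /= tc /= pa fu subrK.
Qed.
End Projective.

(** * Decompositions, chains and global dimension *)

Section KrullSchmidt.
Variables (R : realType) (A : quiverA R) (k : fieldType).
Local Notation "x ⪯ y" := (preceq A x y) (at level 70).
Local Notation rep := (qrep A k).
Implicit Types (U V W X P Q : rep) (I J : set R).

Lemma findim_proper (U W : lmodType k) n (f : U -> W) (S : set W) w :
  findim W n -> linear f -> injective f -> lin_subspace S ->
  (forall u, S (f u)) -> ~ S w -> exists2 m, (m < n)%N & findim U m.
Proof.
move=> [g gl gi] fl fi hS fS nSw.
have hT : lin_subspace (g @` S).
  split=> [|a _ _ [u Su <-] [v Sv <-]]; first by exists 0; rewrite ?(lin0 gl) //; case: hS.
  by exists (a *: u + v); rewrite ?gl //; apply: hS.2.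
have [r [B [Bf BS]]] := subspace_mx hT; exists r.
  rewrite ltn_neqAle -{2}(eqP Bf) rank_leq_col andbT; apply/eqP => rn; apply: nSw.
  have : (g w <= B)%MS by rewrite submx_full // /row_full (eqP Bf) rn.
  by move=> /BS[w' Sw' /gi <-].
have gB u : (g (f u) <= B)%MS by apply/BS; exists (f u).
exists (fun u => g (f u) *m pinvmx B).
  by move=> a u v; rewrite fl gl mulmxDl -scalemxAl.
by move=> u v /(congr1 (mulmx^~ B)); rewrite !mulmxKpV // => /gi /fi.
Qed.

Lemma findim_zero (U : lmodType k) : (forall u : U, u = 0) -> findim U 0.
Proof.
move=> U0; exists (fun=> 0); first by move=> a u v; rewrite scaler0 addr0.
by move=> u v _; rewrite (U0 u) (U0 v).
Qed.

Lemma comph_linearr U V W (g : rhom V W) : linear (fun f : rhom U V => comph g f).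
Proof. by move=> a f f'; apply: homP => x v; exact: hmap_linear. Qed.

Lemma comph_linearl U V W (f : rhom U V) : linear (fun g : rhom V W => comph g f).
Proof. by move=> a g g'; apply: homP. Qed.

Lemma findim_hom_Mint I J (hI : interval_set I) (hJ : interval_set J) :
  exists n, findim (rhom (Mint A k hI) (Mint A k hJ)) n.
Proof.
have [[f fb]|h] := hom_Mint_dichotomy A k hI hJ; last by exists 0%N; apply: findim_zero.
exists 1%N; apply: (findim_inj (linearP f) (bij_inj fb)).
exists (fun a : k^o => a%:M); first by move=> a u v; rewrite raddfD /= scale_scalar_mx.
by move=> u v /matrixP/(_ 0 0); rewrite !mxE eqxx !mulr1n.
Qed.

Lemma findim_hom_fgproj P Q : fgproj P -> fgproj Q -> exists n, findim (rhom P Q) n.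
Proof.
elim=> [|X {}P [I [hI [_ ->]]] _ IHP] fQ.
  by exists 0%N; apply: findim_zero => f; apply: homP => x v; rewrite (rep0_zero v) !hmap0.
have [n hn] : exists n, findim (rhom (Mint A k hI) Q) n.
  elim: fQ {IHP} => [|Y {}Q [J [hJ [_ ->]]] _ [m hm]].
    by exists 0%N; apply: findim_zero => f; apply: homP => x v; apply: rep0_zero.
  have [n hn] := findim_hom_Mint hI hJ; exists (n + m)%N.
  apply: (findim_inj _ _ (findim_prod hn hm)
    (f := fun f => (comph (dfst _ _) f, comph (dsnd _ _) f))).
    by move=> a f g; congr pair; apply: comph_linearr.
  move=> f g e; apply: homP => x v; rewrite [LHS]surjective_pairing [RHS]surjective_pairing.
  have e1 : comph (dfst _ _) f = comph (dfst _ _) g := congr1 fst e.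
  have e2 : comph (dsnd _ _) f = comph (dsnd _ _) g := congr1 snd e.
  by have /= -> := hom_ev e1 x v; have /= -> := hom_ev e2 x v.
have [m hm] := IHP fQ; exists (n + m)%N.
apply: (findim_inj _ _ (findim_prod hn hm)
  (f := fun f => (comph f (dinl _ _), comph f (dinr _ _)))).
  by move=> a f g; congr pair; apply: comph_linearl.
move=> f g e; apply: homP => x [u v].
have e1 : comph f (dinl _ _) = comph g (dinl _ _) := congr1 fst e.
have e2 : comph f (dinr _ _) = comph g (dinr _ _) := congr1 snd e.
have -> : (u, v) = (u, 0) + (0, v) :> dsum (Mint A k hI) P x.
  by congr pair; rewrite ?addr0 ?add0r.
rewrite !hmapD; congr (_ + _); first exact: (hom_ev e1 x u).
exact: (hom_ev e2 x v).
Qed.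

(** Since [P] is projective, composition with [p] maps Hom(P, P) onto Hom(P, V). *)
Lemma findim_hom_fg P V (p : rhom P V) : fgproj P -> hsurj p -> Rep_pwf V ->
  exists n, findim (rhom P V) n.
Proof.
move=> fP ps Vf; have [n hn] := findim_hom_fgproj fP fP; exists n.
apply: (findim_surj hn (comph_linearr p)) => f.
have [_ h] := fgproj_projective fP.
by have [g] := h _ _ p f (fgproj_pwf fP) Vf (surj_epih ps); exists g.
Qed.

Definition hpow V (f : rhom V V) n : rhom V V := iter n (comph f) (idh V).

Lemma hpowE V (f : rhom V V) n x v : hpow f n x v = iter n (f x) v.
Proof. by elim: n => //= n ->. Qed.

(* Fitting's lemma, with the stabilisation of the images of the powers of [f]
   obtained from their action on the finite-dimensional space [Hom(P, V)]. *)
Lemma fitting V (f : rhom V V) : indecomposable rep_fg V ->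
  isoh f \/ exists n, hpow f n = 0.
Proof.
move=> [Vfg _ ind]; have [Vf [P [p [fP ps]]]] := (rep_fgP V).1 Vfg.
have [d hd] := findim_hom_fg fP ps Vf.
pose L n := range (fun g : rhom P V => comph (hpow f n) g).
have LA i j : (i <= j)%N -> L j `<=` L i.
  move=> /subnKC <- _ [g _ <-]; exists (comph (hpow f (j - i)) g) => //.
  by apply: homP => x v /=; rewrite !hpowE iterD.
have [n _ nmin] : exists2 n, setT n & forall j, setT j -> L n `<=` L j.
  apply: (@chain_min _ _ _ _ setT L hd); first by exists 0%N.
    by move=> i _; apply: subspace_im; apply: comph_linearr.
  by move=> i j _ _; have [/LA|/ltnW/LA] := leqP i j; [right|left].
pose g := hpow f n.+1.
(* [comph g p] lies in [L n.+1], hence in [L (n.+1 + n.+1)]; as [p] is onto, this equality of images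
   in Hom(P, V) descends to the points of [V]. *)
have gg x v : exists w, g x v = g x (g x w).
  have [v' <-] := ps x v.
  have : L n.+1 (comph g p) by exists p.
  move=> /(LA _ _ (leqnSn n)) /(nmin (n.+1 + n.+1)%N I)[w _ wE].
  by exists (w x v'); have /= <- := hom_ev wE x v'; rewrite !hpowE iterD.
have gk x v : g x (g x v) = 0 -> g x v = 0.
  have [e /has_dim_findim he] := Vf x.
  exact: (findim_endo_ker he (hmap_linear g (x := x)) (gg x)).
have [T [c [m [cs mi mc]]]] := im_ex g.
have gE x v : g x v = m x (c x v) by rewrite -mc.
(* [comph c m] is [g] acting on its own image [T]. Being invertible, it makes [T] a direct summand
   of [V] whose complement is the kernel of [g]. *)
have [t [tE1 tE2]] : isoh (comph c m).
  apply: bij_iso.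
    apply: hinjP => x y /=; have [v <-] := cs x y => cmc.
    apply: (hinj0 mi); rewrite -gE; apply: gk.
    by rewrite gE gE cmc hmap0.
  move=> x y; have [v <-] := cs x y; have [w gw] := gg x v.
  by exists (c x w); apply: mi; rewrite /= -!gE -gw.
have [K [i [ii ie iso]]] := @split_iso _ _ _ _ _ c (comph m t) (etrans (comphA _ _ _) tE2).
have Kfg := serre_sub (serre_fg A k) ii Vfg.
have Tfg := serre_quot (serre_fg A k) cs Vfg.
have [T0|K0] := ind _ _ Tfg Kfg iso.
  by right; exists n.+1; apply: homP => x v; rewrite -/g gE (T0 _ (c x v)) hmap0.
left; have ci : hinj c.
  by apply: hinjP => x v /ie[u <-]; rewrite (K0 _ u) hmap0.
apply: bij_iso.
  apply: hinjP => x v fv; apply: (hinj0 ci); apply: (hinj0 mi); rewrite -gE.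
  by rewrite hpowE iterSr fv -hpowE hmap0.
move=> x v; have [u cu] := cs x (t x (c x v)).
exists (hpow f n x u); apply: ci; rewrite -[LHS]/(c x (g x u)) gE cu.
exact: (hom_ev tE2 x (c x v)).
Qed.

Lemma isoh_comp U V W (f : rhom U V) (g : rhom V W) : isoh f -> isoh g -> isoh (comph g f).
Proof.
move=> /iso_bij[fi fs] /iso_bij[gi gs]; apply: bij_iso => [x u v /gi/fi //|x w].
by have [v <-] := gs x w; have [u <-] := fs x v; exists u.
Qed.

(** After composition with the inverse of [f + g] the two maps add up to the identity. If the first
    is nilpotent, the second is injective, since its kernel is fixed by the first; an injective
    nilpotent map forces [V] to vanish. *)
Lemma indecomposable_local V : indecomposable rep_fg V -> local_end V.
Proof.
move=> indV; have [_ V0 _] := indV; split.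
  by move=> e; apply: V0 => x v; exact: (hom_ev e x v).
move=> f g nf ng fg; have [u [ufg fgu]] := fg.
have sum x v : u x (f x v) + u x (g x v) = v by rewrite -hmapD; exact: (hom_ev ufg x v).
have [uf|[n fn]] := fitting (comph u f) indV.
  apply: nf; have -> : f = comph (f + g) (comph u f).
    by rewrite comphA fgu compidh.
  exact: isoh_comp.
have ugi : hinj (comph u g).
  apply: hinjP => x v /= ug0; have ufv : u x (f x v) = v by rewrite -[RHS]sum ug0 addr0.
  have : hpow (comph u f) n x v = 0 by rewrite fn.
  have it m : iter m (comph u f x) v = v by elim: m => //= m ->.
  by rewrite hpowE it.
have [ug|[n' gn]] := fitting (comph u g) indV.
  apply: ng; have -> : g = comph (f + g) (comph u g).
    by rewrite comphA fgu compidh.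
  exact: isoh_comp.
apply: V0 => x v; have : hpow (comph u g) n' x v = 0 by rewrite gn.
by rewrite hpowE; elim: n' {gn} => //= n' IH /(hinj0 ugi).
Qed.

(** Induction on a bound for dim Hom(P, V) with [P] fixed. A decomposition into nonzero [V1] and
    [V2] embeds each Hom(P, Vi) properly, because the component of [p] in the other summand lies
    outside. *)
Lemma decomposition V : rep_fg V ->
  exists2 S, sums (fun X => rep_fg X /\ local_end X) S & isomorphic V S.
Proof.
move=> Vfg; have [Vf [P [p [fP ps]]]] := (rep_fgP V).1 Vfg.
have [n hn] := findim_hom_fg fP ps Vf.
elim/ltn_ind: n V Vfg Vf p ps hn => n IH V Vfg Vf p ps hn.
have [V0|V0] := pselect (is_zero V).
  exists (rep0 A k); first exact: sums0.
  exists 0; apply: bij_iso => [x u v _|x w]; first by rewrite (V0 x u) (V0 x v).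
  by exists 0; rewrite (rep0_zero w).
have [indV|nind] := pselect (indecomposable rep_fg V).
  exists (dsum V (rep0 A k)); first apply: sumsS.
  - by split=> //; apply: indecomposable_local.
  - exact: sums0.
  exists (dinl _ _); apply: bij_iso => [x u v [] //|x [u w]]; exists u.
  by rewrite /= (rep0_zero w).
have [V1 [V2 [C1 C2 iso nz1 nz2]]] : exists V1 V2, [/\ rep_fg V1, rep_fg V2,
    isomorphic V (dsum V1 V2), ~ is_zero V1 & ~ is_zero V2].
  apply: contrapT => h; apply: nind; split=> // V1 V2 C1 C2 iso.
  apply: contrapT => /not_orP[n1 n2]; apply: h.
  by exists V1, V2.
have [F [G [GF FG]]] := iso.
have GFE x v : G x (F x v) = v by exact: (hom_ev GF x v).
have FGE x v : F x (G x v) = v by exact: (hom_ev FG x v).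
pose p1 := comph (dfst _ _) (comph F p); pose p2 := comph (dsnd _ _) (comph F p).
have p1s : hsurj p1.
  by move=> x v; have [w pw] := ps x (G x (v, 0)); exists w; rewrite /= pw FGE.
have p2s : hsurj p2.
  by move=> x v; have [w pw] := ps x (G x (0, v)); exists w; rewrite /= pw FGE.
have nz (W : rep) (q : rhom P W) : hsurj q -> ~ is_zero W -> q <> 0.
  by move=> qs nW q0; apply: nW => x w; have [v <-] := qs x w; rewrite q0.
pose in1 (q : rhom P V1) := comph G (comph (dinl V1 V2) q).
pose in2 (q : rhom P V2) := comph G (comph (dinr V1 V2) q).
have in1l : linear in1 by move=> a q q'; rewrite /in1 !comph_linearr.
have in2l : linear in2 by move=> a q q'; rewrite /in2 !comph_linearr.
have in12 q q' x v : F x ((in1 q + in2 q') x v) = (q x v, q' x v).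
  rewrite homDE hmapD /= !FGE.
  by congr pair; rewrite ?addr0 ?add0r.
have in1E q x v : F x (in1 q x v) = (q x v, 0) by rewrite /= FGE.
have in2E q x v : F x (in2 q x v) = (0, q x v) by rewrite /= FGE.
have in1i : injective in1.
  by move=> q q' e; apply: homP => x v; have := in1E q x v; rewrite e in1E => -[].
have in2i : injective in2.
  by move=> q q' e; apply: homP => x v; have := in2E q x v; rewrite e in2E => -[].
have [m1 m1n h1] : exists2 m, (m < n)%N & findim (rhom P V1) m.
  apply: (findim_proper (S := range in1) (w := in2 p2) hn in1l in1i).
  - exact: subspace_im.
  - by move=> q; exists q.
  - move=> [q _ e]; apply: (nz _ p2 p2s nz2); apply: homP => x v.
    by have := in1E q x v; rewrite e in2E => -[].
have [m2 m2n h2] : exists2 m, (m < n)%N & findim (rhom P V2) m.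
  apply: (findim_proper (S := range in2) (w := in1 p1) hn in2l in2i).
  - exact: subspace_im.
  - by move=> q; exists q.
  - move=> [q _ e]; apply: (nz _ p1 p1s nz1); apply: homP => x v.
    by have := in2E q x v; rewrite e in1E => -[].
have [S1 s1 i1] := IH _ m1n V1 C1 (serre_pwf (serre_fg A k) C1) p1 p1s h1.
have [S2 s2 i2] := IH _ m2n V2 C2 (serre_pwf (serre_fg A k) C2) p2 p2s h2.
have [S sS iS] := sums_dsum s1 s2; exists S => //.
by apply: isomorphic_trans iso (isomorphic_trans _ iS); apply: dsum_iso.
Qed.

Lemma pint_fg I (hI : interval_set I) : pint A I -> rep_fg (Mint A k hI).
Proof.
move=> pI; apply/rep_fgP; split; first exact: Mint_pwf.
exists (dsum (Mint A k hI) (rep0 A k)), (dfst _ _); split.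
  by apply: sumsS; [exists I, hI|apply: sums0].
by move=> x v; exists (v, 0).
Qed.

Lemma krull_schmidt_fg : krull_schmidt (@rep_fg R A k).
Proof.
have fg0 : rep_fg (rep0 A k).
  have pI : pint A [set y | y ⪯ 0] by left; exists 0.
  exact: serre_rep0 (serre_fg A k) (pint_fg (pint_interval pI) pI).
split=> [n V CV|V /decomposition[S /sums_dsums[n [X [GX ->]]] iso]]; last by exists n, X.
apply: (sums_serre (G := rep_fg) (serre_fg A k) fg0) => //.
exact: dsums_sums.
Qed.

(** The conditions say that [I] ∩ [J] is closed downwards in [J] and upwards in [I], that is, it
    supports a subobject of M_J and a quotient of M_I. *)
Lemma Mint_map I J (hI : interval_set I) (hJ : interval_set J) :
  (forall x y, y ⪯ x -> I x -> J x -> J y -> I y) ->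
  (forall x y, y ⪯ x -> I x -> I y -> J y -> J x) ->
  exists f : rhom (Mint A k hI) (Mint A k hJ),
    forall x, I x -> f x (unit_at A k hI x) = unit_at A k hJ x.
Proof.
move=> c1 c2.
have [x Ix|x y h Ix|f fE] := @from_Mint _ _ _ _ hI (Mint A k hJ)
  (fun x => if `[< I x >] then unit_at A k hJ x else 0).
- by rewrite asboolF.
- rewrite asboolT //; have [Jx|Jx] := pselect (J x).
    rewrite unit_map //; case: asboolP => // Iy; apply: unit_out => Jy.
    by apply: Iy; apply: c1 h Ix Jx Jy.
  rewrite (unit_out A k hJ Jx) linear0; case: asboolP => // Iy.
  by rewrite unit_out // => Jy; apply: Jx; apply: c2 h Ix Iy Jy.
by exists f => x Ix; rewrite fE asboolT // mcoef_unit // scale1r.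
Qed.

Lemma Mint_map_inj I J (hI : interval_set I) (hJ : interval_set J)
    (f : rhom (Mint A k hI) (Mint A k hJ)) : I `<=` J ->
  (forall x, I x -> f x (unit_at A k hI x) = unit_at A k hJ x) -> hinj f.
Proof.
move=> IJ fE; apply: hinjP => x v; have [Ix|Ix] := pselect (I x); last first.
  by move=> _; apply: mcoef_inj; rewrite !mcoef_out.
rewrite hom_unit fE // => /(congr1 mcoef); rewrite mcoefZ mcoef_unit; last exact: IJ.
by rewrite mulr1 mcoef0 => e; apply: mcoef_inj; rewrite e mcoef0.
Qed.

Lemma Mint_map_surj I J (hI : interval_set I) (hJ : interval_set J)
    (f : rhom (Mint A k hI) (Mint A k hJ)) : J `<=` I ->
  (forall x, I x -> f x (unit_at A k hI x) = unit_at A k hJ x) -> hsurj f.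
Proof.
move=> JI fE x w; have [Jx|Jx] := pselect (J x); last first.
  by exists 0; apply: mcoef_inj; rewrite !mcoef_out.
exists (mcoef w *: unit_at A k hI x); rewrite hmapZ fE; last exact: JI.
by rewrite -mcoefE.
Qed.

(** Density gives strictly descending points [x j] above [c], whose principal downsets carry nested
    projectives. Stage [N] does not factor through stage [N.+1], which vanishes at [x N]. *)
Lemma not_artinian_fg : ~ artinian (@rep_fg R A k).
Proof.
have [c [b [_ [_ [cb _ _ [ncb _ _]]]]]] := preceq_four A.
have nxt (y : {y | c ⪯ y /\ c <> y}) :
    {z : {y | c ⪯ y /\ c <> y} | sval z ⪯ sval y /\ sval z <> sval y}.
  case: y => y [cy ncy] /=; apply: cid.
  have [z [cz zy ncz nzy]] := preceq_dense cy ncy.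
  by exists (exist _ z (conj cz ncz)).
pose xs j := iter j (fun y => sval (nxt y)) (exist _ b (conj cb ncb)).
pose x j := sval (xs j).
have xS j : x j.+1 ⪯ x j /\ x j.+1 <> x j := svalP (nxt (xs j)).
have pU j : pint A [set y | y ⪯ x j] by left; exists (x j).
pose U j := Mint A k (pint_interval (pU j)).
have xL i j : (i <= j)%N -> x j ⪯ x i.
  move=> /subnKC <-; elim: (j - i)%N => [|d IH]; first by rewrite addn0; apply: preceq_refl.
  by rewrite addnS; apply: preceq_trans IH; case: (xS (i + d)%N).
have inc i j : (i <= j)%N -> {f : rhom (U j) (U i) | forall y, y ⪯ x j ->
    f y (unit_at A k (pint_interval (pU j)) y) = unit_at A k (pint_interval (pU i)) y}.
  move=> ij; apply: cid; apply: Mint_map => y z /= zy yj.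
    by move=> _ _; apply: preceq_trans zy yj.
  by move=> _ _; apply: preceq_trans yj (xL _ _ ij).
have Ufg j : rep_fg (U j) by apply: pint_fg.
move=> /(_ _ (Ufg 0%N) U (fun j => sval (inc _ _ (leq0n j)))) [j|j|N Nmin].
- split=> //; apply: inj_monoh; apply: (Mint_map_inj _ (svalP (inc _ _ (leq0n j)))).
  by move=> y /= yj; apply: preceq_trans yj (xL _ _ (leq0n j)).
- exists (sval (inc _ _ (leqnSn j))); apply: hom_Mint_eq => y /= yj.
  rewrite (svalP (inc _ _ (leqnSn j))) // !(svalP (inc _ _ (leq0n _))) //.
  by apply: preceq_trans yj _; case: (xS j).
have [h hE] := Nmin N.+1 (leqnSn N).
have /= := hom_ev hE (x N) (unit_at A k (pint_interval (pU N)) (x N)).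
rewrite (svalP (inc _ _ (leq0n N))); last exact: preceq_refl.
have -> : h (x N) (unit_at A k (pint_interval (pU N)) (x N)) = 0.
  apply: mcoef_inj; rewrite mcoef_out ?mcoef0 //= => e.
  by have [l n] := xS N; apply: n; exact: (preceq_anti l e).
rewrite hmap0 => /(congr1 mcoef); rewrite mcoef0 mcoef_unit; last exact: xL.
by move=> /esym/eqP; rewrite oner_eq0.
Qed.

Lemma projective_iso C P Q : C P -> projective C Q -> isomorphic P Q -> projective C P.
Proof.
move=> CP [_ Qp] [F [G [GF FG]]]; split=> // V W e f CV CW ee.
have [g gE] := Qp _ _ e (comph f G) CV CW ee; exists (comph g F).
by rewrite comphA gE -comphA GF comphid.
Qed.

Lemma fgproj_fg P : fgproj P -> rep_fg P /\ projective rep_fg P.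
Proof.
move=> fP; have Pfg : rep_fg P.
  by apply/rep_fgP; split; [exact: fgproj_pwf|exists P, (idh P); split=> // x v; exists v].
split=> //; split=> // V W e f CV CW /(epih_surj (serre_fg A k) CW) es.
have [_ h] := fgproj_projective fP.
have pwf := serre_pwf (serre_fg A k).
exact: h _ _ e f (pwf _ CV) (pwf _ CW) (surj_epih es).
Qed.

Lemma gldim_fg : gldim_eq (@rep_fg R A k) 1.
Proof.
split=> [V Vfg|[|//] all0].
  have [Vf [P [p [fP ps]]]] := (rep_fgP V).1 Vfg.
  have [K [i [ii ie]]] := ker_ex p; have [Q fQ iQ] := sub_fgproj fP ii.
  have [Pfg Pp] := fgproj_fg fP; have Kfg := serre_sub (serre_fg A k) ii Pfg.
  exists K, P, i, p; split=> //; first exact: ses_exact.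
  by apply: projective_iso iQ => //; have [] := fgproj_fg fQ.
(* Dimension 0 would make the simple representation at [b] projective although [b] is not a sink. A
   section of its cover would give an element that restriction to [c] kills, while that restriction
   is injective on the cover. *)
exfalso; have [c [b [_ [_ [cb _ _ [ncb _ _]]]]]] := preceq_four A.
have pI : pint A [set y | y ⪯ b] by left; exists b.
have hI := pint_interval pI.
have hJ : interval_set [set b].
  by apply/interval_setP; split=> [|x y z -> -> /le_anti ->]; first exists b.
have [x y yx /= xb xb' yb|x y /= yx xb yb yb'|f fE] := @Mint_map _ _ hI hJ.
- by rewrite yb; apply: preceq_refl.
- by apply: (preceq_anti xb); rewrite -yb'.
have fs : hsurj f.
  by apply: Mint_map_surj fE => x /= ->; apply: preceq_refl.
have Ifg := pint_fg hI pI; have Jfg := serre_quot (serre_fg A k) fs Ifg.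
have [_ /(_ _ _ f (idh _) Ifg Jfg (surj_epih fs))[s sE]] := all0 _ Jfg.
have /= := hom_ev sE b (unit_at A k hJ b).
have -> : s b (unit_at A k hJ b) = 0.
  have : rmap (Mint A k hI) cb (s b (unit_at A k hJ b)) = 0.
    by rewrite (hom_unit_map s cb) // unit_out ?hmap0 //= => /esym.
  move=> /(congr1 mcoef); rewrite mcoef_map // mcoef0 => e.
  by apply: mcoef_inj; rewrite e mcoef0.
rewrite hmap0 => /(congr1 mcoef); rewrite mcoef0 mcoef_unit //.
by move=> /esym/eqP; rewrite oner_eq0.
Qed.
End KrullSchmidt.

(** * Cocycles for extensions of interval representations *)

Section Cocycles.
Variables (R : realType) (A : quiverA R) (k : fieldType).
Local Notation "x ⪯ y" := (preceq A x y) (at level 70).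
Variables (I J : set R).
Hypotheses (hI : interval_set I) (hJ : interval_set J).
Implicit Types (c : R -> R -> k) (b : R -> k).

(* [c x y], for [x] in [I] and [y] in [J], is the component M_I(x) -> M_J(y) of
   the structure map of an extension of M_I by M_J; only these values matter. *)
Definition cocycle c := forall x y z, I x -> J z -> y ⪯ x -> z ⪯ y ->
  c x z = (if `[< J y >] then c x y else 0) + (if `[< I y >] then c y z else 0).

(** [b] is a change of the pointwise splitting; its values matter only on [I] ∩ [J]. *)
Definition coboundary c := exists b, forall x y, I x -> J y -> y ⪯ x ->
  c x y = (if `[< J x >] then b x else 0) - (if `[< I y >] then b y else 0).

Definition clin a c c' := fun x y => a * c x y + c' x y.

Lemma cocycle_lin a c c' : cocycle c -> cocycle c' -> cocycle (clin a c c').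
Proof.
move=> hc hc' x y z Ix Jz yx zy; rewrite /clin (hc x y z) // (hc' x y z) //.
by case: asboolP; case: asboolP => _ _; ring.
Qed.

Lemma coboundary_lin a c c' : coboundary c -> coboundary c' -> coboundary (clin a c c').
Proof.
move=> [b hb] [b' hb']; exists (fun x => a * b x + b' x) => x y Ix Jy yx.
rewrite /clin hb // hb' //; by case: asboolP; case: asboolP => _ _; ring.
Qed.

Lemma coboundary_ext c c' : (forall x y, I x -> J y -> y ⪯ x -> c x y = c' x y) ->
  coboundary c -> coboundary c'.
Proof. by move=> e [b hb]; exists b => x y Ix Jy yx; rewrite -e // hb. Qed.

Let Iconv : forall x y z, I x -> I y -> x <= z <= y -> I z := ((interval_setP I).1 hI).2.
Let Jconv : forall x y z, J x -> J y -> x <= z <= y -> J z := ((interval_setP J).1 hJ).2.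

Section Potential.
Variables (K : set R).
Hypothesis Kconv : forall x y z, K x -> K y -> x <= z <= y -> K z.
Variable c : R -> R -> k.
Hypothesis hc : forall x y z, K x -> K y -> K z -> y ⪯ x -> z ⪯ y ->
  c x z = c x y + c y z.

Let sol l r b := forall x y, l <= x <= r -> l <= y <= r -> y ⪯ x -> c x y = b x - b y.

(** Within a segment every point is comparable to [l], and [c] between the point and [l] is a
    potential. At a cut point [p] the right-hand potential is shifted to match the left-hand one. *)
Lemma sol_ex l r : l <= r -> K l -> K r -> exists b, sol l r b.
Proof.
move: l r; apply: (@interval_ind _ A) => [n l r lr nl nr Kl Kr|l p r lp pr h1 h2 Kl Kr].
  have Klr x : l <= x <= r -> K x by move=> h; apply: Kconv Kl Kr h.
  have cxx x : K x -> c x x = 0.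
    move=> Kx; have := hc Kx Kx Kx (preceq_refl A x) (preceq_refl A x).
    by move=> /eqP; rewrite eq_sym -subr_eq0 addrK => /eqP.
  have nlr x : l <= x <= r -> segment A n x by apply: seg_convex nl nr.
  pose b x := if `[< l ⪯ x >] then c x l else - c l x.
  have b1 x : l ⪯ x -> b x = c x l by move=> h; rewrite /b asboolT.
  have b2 x : x ⪯ l -> b x = - c l x.
    move=> h; rewrite /b; case: asboolP => // h'.
    by rewrite (preceq_anti h h') cxx // oppr0.
  exists b => x y hx hy yx; have Kx := Klr _ hx; have Ky := Klr _ hy.
  have [ly|yl] := seg_total nl (nlr _ hy).
    by rewrite (b1 y) // (b1 x) ?(hc Kx Ky Kl) ?addrK //; apply: preceq_trans ly yx.
  have [lx|xl] := seg_total nl (nlr _ hx).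
    by rewrite (b1 x) // (b2 y) // opprK -(hc Kx Kl Ky).
  rewrite (b2 x) // (b2 y) ?opprK; last exact: preceq_trans yx xl.
  by rewrite (hc Kl Kx Ky) // addKr.
have Kp : K p by apply: Kconv Kl Kr _; rewrite lp.
have [b1 s1] := h1 Kl Kp; have [b2 s2] := h2 Kp Kr.
pose b x := if x <= p then b1 x else b2 x - b2 p + b1 p.
have bl x : x <= p -> b x = b1 x by rewrite /b => ->.
have br x : p <= x -> b x = b2 x - b2 p + b1 p.
  rewrite /b; case: ifP => // xp px; have -> : x = p by apply/le_anti; rewrite xp.
  by rewrite subrr add0r.
exists b => x y /andP[lx xr] /andP[ly yr] yx.
have Kx : K x by apply: Kconv Kl Kr _; rewrite lx.
have Ky : K y by apply: Kconv Kl Kr _; rewrite ly.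
have [xp|px] := leP x p; have [yp|py] := leP y p.
- by rewrite !bl //; apply: s1; rewrite ?lx ?ly.
- have [yp xp'] : y ⪯ p /\ p ⪯ x.
    by apply: preceq_betw => //; right; rewrite xp ltW.
  rewrite (bl x) // (br y) ?(ltW py) // (hc Kx Kp Ky) // (s1 x p) ?(s2 p y)
    ?lexx ?xp ?lx ?lp ?pr ?yr ?(ltW py) //.
  by ring.
- have [yp' xp'] : y ⪯ p /\ p ⪯ x.
    by apply: preceq_betw => //; left; rewrite yp ltW.
  rewrite (br x) ?(ltW px) // (bl y) // (hc Kx Kp Ky) // (s2 x p) ?(s1 p y)
    ?lexx ?xr ?lp ?pr ?yp ?ly ?(ltW px) //.
  by ring.
- rewrite !br ?ltW // (s2 x y) ?(ltW px) ?(ltW py) ?xr ?yr //.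
  by ring.
Qed.

Lemma sol_unique l r b b' : sol l r b -> sol l r b' ->
  forall x y, l <= x <= r -> l <= y <= r -> b x - b y = b' x - b' y.
Proof.
move=> hb hb' x y hx hy.
have e : b x - b' x = b y - b' y.
  move: x y hx hy; apply: (@const_on_interval _ A k [set x | l <= x <= r]).
    by move=> x y z /= hx hy hz; lra.
  move=> x y /= hx hy yx; have e := hb _ _ hx hy yx; rewrite (hb' _ _ hx hy yx) in e.
  have -> : b x = b x - b y + b y by ring.
  by rewrite -e; ring.
have -> : b x = b x - b' x + b' x by ring.
by rewrite e; ring.
Qed.

(** [K] may be unbounded, so the value at [x] is read off a solution on the interval between [w] and
    [x], normalised at [w]. Uniqueness up to a constant makes these local choices agree. *)
Lemma potential_ex w : K w ->
  exists2 b, b w = 0 & forall x y, K x -> K y -> y ⪯ x -> c x y = b x - b y.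
Proof.
move=> Kw.
have S x : {b | K x -> sol (Num.min w x) (Num.max w x) b}.
  apply: cid; have [Kx|nK] := pselect (K x); last by exists (fun=> 0).
  have [|||b hb] := @sol_ex (Num.min w x) (Num.max w x); last by exists b.
  - by rewrite le_max ge_min lexx.
  - by case: (leP w x).
  - by case: (leP w x).
have inS x : Num.min w x <= x <= Num.max w x by rewrite ge_min le_max lexx !orbT.
have inS' x : Num.min w x <= w <= Num.max w x by rewrite ge_min le_max lexx.
exists (fun x => sval (S x) x - sval (S x) w); first by rewrite subrr.
move=> x y Kx Ky yx.
pose l := Num.min w (Num.min x y); pose r := Num.max w (Num.max x y).
have Kl : K l by rewrite /l; case: (leP x y) => _; case: ltP.
have Kr : K r by rewrite /r; case: (leP x y) => _; case: ltP.
have lw : l <= w <= r by rewrite /l /r ge_min le_max lexx.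
have lx : l <= x <= r by rewrite /l /r !ge_min !le_max lexx !orbT.
have ly : l <= y <= r by rewrite /l /r !ge_min !le_max lexx !orbT.
have [b hb] : exists b, sol l r b.
  by apply: sol_ex => //; case/andP: lw => h1 h2; apply: le_trans h1 h2.
have loc z : K z -> l <= z <= r -> sval (S z) z - sval (S z) w = b z - b w.
  move=> Kz /andP[lz zr]; apply: sol_unique (svalP (S z) Kz) _ _ _ (inS z) (inS' z).
  move=> u v /andP[hu1 hu2] /andP[hv1 hv2] vu; case/andP: lw => lw wr; apply: hb => //.
    by apply/andP; split; [apply: le_trans hu1|apply: le_trans hu2 _];
      rewrite ?le_min ?ge_max ?lw ?wr.
  by apply/andP; split; [apply: le_trans hv1|apply: le_trans hv2 _];
      rewrite ?le_min ?ge_max ?lw ?wr.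
by rewrite !loc // (hb x y) //; ring.
Qed.

Lemma potential_unique w b b' : K w -> b w = b' w ->
  (forall x y, K x -> K y -> y ⪯ x -> c x y = b x - b y) ->
  (forall x y, K x -> K y -> y ⪯ x -> c x y = b' x - b' y) ->
  forall x, K x -> b x = b' x.
Proof.
move=> Kw bw hb hb' x Kx; apply/eqP; rewrite -subr_eq0; apply/eqP.
have <- : b w - b' w = 0 by rewrite bw subrr.
apply: (@const_on_interval _ A k K (fun x => b x - b' x)) => // {x Kx} x y Kx Ky yx.
have e := hb _ _ Kx Ky yx; rewrite (hb' _ _ Kx Ky yx) in e.
have -> : b x = b x - b y + b y by ring.
by rewrite -e; ring.
Qed.
End Potential.

(** Coboundaries vanish here. Moving either point of a pair towards the other inside its own
    interval does not change the value of a cocycle, and any two pairs have a common inner pair, so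
    one value determines the cocycle. *)
Lemma disjoint_functional : ~ (exists x, I x /\ J x) ->
  exists2 lam : (R -> R -> k) -> k,
    forall a c c', lam (clin a c c') = a * lam c + lam c' &
    forall c, cocycle c -> lam c = 0 -> coboundary c.
Proof.
move=> dis.
have dis' x : I x -> J x -> False by move=> Ix Jx; apply: dis; exists x.
have [[x0 [y0 [Ix0 Jy0 yx0]]]|no] :=
  pselect (exists x0 y0, [/\ I x0, J y0 & y0 ⪯ x0]); last first.
  exists (fun=> 0) => [a c c'|c hc _]; first by rewrite mulr0 addr0.
  by exists (fun=> 0) => x y Ix Jy yx; exfalso; apply: no; exists x, y.
exists (fun c => c x0 y0) => // c hc c0; exists (fun=> 0) => x y Ix Jy yx.
rewrite !if_same subrr -c0.
have mvx u v z : I u -> J v -> v ⪯ u -> I z -> u <= z <= v \/ v <= z <= u ->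
    v ⪯ z /\ c u v = c z v.
  move=> Iu Jv vu Iz h; have [vz zu] := preceq_betw vu ((or_comm _ _).1 h).
  have nJ : ~ J z by move=> Jz; apply: dis' Iz Jz.
  by split=> //; rewrite (hc u z v) // (asboolF nJ) (asboolT Iz) add0r.
have mvy u v z : I u -> J v -> v ⪯ u -> J z -> u <= z <= v \/ v <= z <= u ->
    c u v = c u z.
  move=> Iu Jv vu Jz h; have [vz zu] := preceq_betw vu ((or_comm _ _).1 h).
  have nI : ~ I z by move=> Iz; apply: dis' Iz Jz.
  by rewrite (hc u z v) // (asboolF nI) (asboolT Jz) addr0.
have mv u v u' v' : I u -> J v -> v ⪯ u -> I u' -> J v' ->
    (u <= u' /\ u' <= v' /\ v' <= v) \/ (v <= v' /\ v' <= u' /\ u' <= u) -> c u v = c u' v'.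
  move=> Iu Jv vu Iu' Jv' h.
  have [|h1 ->] := mvx u v u' Iu Jv vu Iu'; first by case: h => -[h1 [h2 h3]]; [left|right]; lra.
  by apply: mvy => //; case: h => -[h2 [h3 h4]]; [left|right]; lra.
have Imax : I (Num.max x x0) by case: leP.
have Imin : I (Num.min x x0) by case: leP.
have Jmax : J (Num.max y y0) by case: leP.
have Jmin : J (Num.min y y0) by case: leP.
have [xy|yx'|e] := ltgtP x y; last by exfalso; apply: dis' Ix _; rewrite e.
  have h1 : x < y0.
    by rewrite ltNge; apply/negP => h; apply: (dis' x Ix); apply: Jconv Jy0 Jy _; rewrite h ltW.
  have h2 : x0 < y0.
    by rewrite ltNge; apply/negP => h; apply: (dis' y0 _ Jy0); apply: Iconv Ix Ix0 _; rewrite h ltW.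
  have h3 : x0 < y.
    by rewrite ltNge; apply/negP => h; apply: (dis' y _ Jy); apply: Iconv Ix Ix0 _; rewrite h ltW.
  have hm : Num.max x x0 <= Num.min y y0 by rewrite ge_max !le_min !ltW.
  rewrite (mv _ _ _ _ Ix Jy yx Imax Jmin) ?(mv _ _ _ _ Ix0 Jy0 yx0 Imax Jmin) //;
    by left; split; [|split; [exact: hm|]]; rewrite ?le_max ?ge_min lexx ?orbT.
have h1 : y0 < x.
  by rewrite ltNge; apply/negP => h; apply: (dis' x Ix); apply: Jconv Jy Jy0 _; rewrite h ltW.
have h2 : y0 < x0.
  by rewrite ltNge; apply/negP => h; apply: (dis' y0 _ Jy0); apply: Iconv Ix0 Ix _; rewrite h ltW.
have h3 : y < x0.
  by rewrite ltNge; apply/negP => h; apply: (dis' y _ Jy); apply: Iconv Ix0 Ix _; rewrite h ltW.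
have hm : Num.max y y0 <= Num.min x x0 by rewrite ge_max !le_min !ltW.
rewrite (mv _ _ _ _ Ix Jy yx Imin Jmax) ?(mv _ _ _ _ Ix0 Jy0 yx0 Imin Jmax) //;
  by right; split; [|split; [exact: hm|]]; rewrite ?le_max ?ge_min lexx ?orbT.
Qed.

(* After subtracting the coboundary of a potential on [I `&` J], a cocycle is
   constant at each of the two ends of [I `&` J], and the constant potentials
   shift both constants equally; the functional is their difference. *)
Lemma overlap_functional w : I w -> J w ->
  exists2 lam : (R -> R -> k) -> k,
    forall a c c', cocycle c -> cocycle c' -> lam (clin a c c') = a * lam c + lam c' &
    forall c, cocycle c -> lam c = 0 -> coboundary c.
Proof.
move=> Iw Jw; pose K := I `&` J.
have Kw : K w by [].
have Kconv x y z : K x -> K y -> x <= z <= y -> K z.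
  by move=> [Ix Jx] [Iy Jy] h; split; [apply: Iconv h|apply: Jconv h].
have Kc c : cocycle c -> forall x y z, K x -> K y -> K z -> y ⪯ x -> z ⪯ y ->
    c x z = c x y + c y z.
  by move=> hc x y z [Ix _] [Iy Jy] [_ Jz] yx zy; rewrite (hc x y z) // !asboolT.
have P c : {b | cocycle c -> b w = 0 /\ forall x y, K x -> K y -> y ⪯ x -> c x y = b x - b y}.
  apply: cid; have [hc|] := pselect (cocycle c); last by exists (fun=> 0).
  by have [b bw hb] := potential_ex Kconv (Kc _ hc) Kw; exists b.
pose pot c := sval (P c).
have potw c : cocycle c -> pot c w = 0 by move=> hc; case: (svalP (P c) hc).
have potE c : cocycle c -> forall x y, K x -> K y -> y ⪯ x -> c x y = pot c x - pot c y.
  by move=> hc; case: (svalP (P c) hc).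
pose res c x y := c x y -
  ((if `[< J x >] then pot c x else 0) - (if `[< I y >] then pot c y else 0)).
have reslin a c c' : cocycle c -> cocycle c' -> forall x y, I x -> J y ->
    res (clin a c c') x y = a * res c x y + res c' x y.
  move=> hc hc' x y Ix Jy; have hl := cocycle_lin a hc hc'.
  have pl z : K z -> pot (clin a c c') z = a * pot c z + pot c' z.
    apply: (potential_unique Kconv Kw (b' := fun z => a * pot c z + pot c' z) _ (potE _ hl)).
      by rewrite !potw // mulr0 addr0.
    by move=> u v Ku Kv vu; rewrite /clin (potE c hc) // (potE c' hc') //; ring.
  rewrite /res {1}/clin; case: asboolP => [Jx|_]; case: asboolP => [Iy|_]; rewrite ?pl //; ring.
have resK c : cocycle c -> forall x y, K x -> K y -> y ⪯ x -> res c x y = 0.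
  move=> hc x y Kx Ky yx; have [_ Jx] := Kx; have [Iy _] := Ky.
  by rewrite /res !asboolT // (potE c hc) // subrr.
have resC c : cocycle c -> cocycle (res c).
  move=> hc x y z Ix Jz yx zy; rewrite /res (hc x y z) //.
  have hJ' : J x -> J y.
    by move=> Jx; case: (preceq_between zy yx) => h; [apply: Jconv Jz Jx h|apply: Jconv Jx Jz h].
  have hI' : I z -> I y.
    by move=> Iz; case: (preceq_between zy yx) => h; [apply: Iconv Iz Ix h|apply: Iconv Ix Iz h].
  case: (asboolP (J y)) => Jy; case: (asboolP (I y)) => Iy;
    case: (asboolP (J x)) => Jx; case: (asboolP (I z)) => Iz; try ring; exfalso; auto.
(* A pair that crosses one end of [K]: [κ] lies inside, and [ζ] outside in exactly one of the two
   intervals. *)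
pose endp κ ζ := K κ /\ ((I ζ /\ ~ J ζ /\ κ ⪯ ζ) \/ (J ζ /\ ~ I ζ /\ ζ ⪯ κ)).
have endpK κ ζ : endp κ ζ -> ~ K ζ by move=> [_ [[_ [nJ _]]|[_ [nI _]]]] [].
(* The sign is chosen so that a constant potential β contributes - β at both kinds of end. *)
pose E c κ ζ := if `[< κ ⪯ ζ >] then res c ζ κ else - res c κ ζ.
have E1 c κ ζ : κ ⪯ ζ -> E c κ ζ = res c ζ κ by move=> h; rewrite /E asboolT.
have E2 c κ ζ : K κ -> ~ K ζ -> ζ ⪯ κ -> E c κ ζ = - res c κ ζ.
  move=> Kκ nK h; rewrite /E asboolF // => h'.
  by apply: nK; rewrite -(preceq_anti h' h).
have Elin a c c' : cocycle c -> cocycle c' -> forall κ ζ, endp κ ζ ->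
    E (clin a c c') κ ζ = a * E c κ ζ + E c' κ ζ.
  move=> hc hc' κ ζ h; have nK := endpK _ _ h; case: h => Kκ; have [Iκ Jκ] := Kκ.
  case=> -[h1 [h2 h3]]; first by rewrite !E1 // reslin.
  by rewrite !E2 // reslin //; ring.
(* Passing to an inner pair adds only a term of [res] inside [K], which vanishes. *)
have mv c κ ζ κ' ζ' : cocycle c -> endp κ ζ -> K κ' -> ~ K ζ' ->
    (κ <= κ' /\ κ' <= ζ' /\ ζ' <= ζ) \/ (ζ <= ζ' /\ ζ' <= κ' /\ κ' <= κ) ->
    E c κ ζ = E c κ' ζ'.
  move=> hc h Kκ' nK' o; have nK := endpK _ _ h; case: h => Kκ.
  have rc := resC _ hc; have [Iκ Jκ] := Kκ; have [Iκ' Jκ'] := Kκ'.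
  case=> -[h1 [h2 h3]].
    have [a1 a2] : κ ⪯ ζ' /\ ζ' ⪯ ζ.
      by apply: preceq_betw => //; case: o => -[q1 [q2 q3]]; [left|right]; lra.
    have [a3 a4] : κ ⪯ κ' /\ κ' ⪯ ζ'.
      by apply: preceq_betw => //; case: o => -[q1 [q2 q3]]; [left|right]; lra.
    have Iζ' : I ζ'.
      by case: o => -[q1 [q2 q3]]; [apply: Iconv Iκ h1 _|apply: Iconv h1 Iκ _]; lra.
    have nJ' : ~ J ζ' by move=> Jζ'; apply: nK'.
    rewrite !E1 // (rc ζ ζ' κ) // (asboolF nJ') (asboolT Iζ') add0r (rc ζ' κ' κ) //.
    by rewrite !asboolT // (resK c hc κ' κ) // addr0.
  have [a1 a2] : ζ ⪯ ζ' /\ ζ' ⪯ κ.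
    by apply: preceq_betw => //; case: o => -[q1 [q2 q3]]; [right|left]; lra.
  have [a3 a4] : ζ' ⪯ κ' /\ κ' ⪯ κ.
    by apply: preceq_betw => //; case: o => -[q1 [q2 q3]]; [right|left]; lra.
  have Jζ' : J ζ'.
    by case: o => -[q1 [q2 q3]]; [apply: Jconv Jκ h1 _|apply: Jconv h1 Jκ _]; lra.
  have nI' : ~ I ζ' by move=> Iζ'; apply: nK'.
  rewrite !E2 // (rc κ ζ' ζ) // (asboolF nI') (asboolT Jζ') addr0 (rc κ κ' ζ') //.
  by rewrite !asboolT // (resK c hc κ κ') // add0r.
have Kmax x y : K x -> K y -> K (Num.max x y) by case: leP.
have Kmin x y : K x -> K y -> K (Num.min x y) by case: leP.
have nKmax x y : ~ K x -> ~ K y -> ~ K (Num.max x y) by case: leP.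
have nKmin x y : ~ K x -> ~ K y -> ~ K (Num.min x y) by case: leP.
have constR c κ ζ κ' ζ' : cocycle c -> endp κ ζ -> endp κ' ζ' -> κ < ζ -> κ' < ζ' ->
    E c κ ζ = E c κ' ζ'.
  move=> hc e e' l l'; have nK := endpK _ _ e; have nK' := endpK _ _ e'.
  have [Kκ _] := e; have [Kκ' _] := e'.
  have KM := Kmax _ _ Kκ Kκ'; have nKm := nKmin _ _ nK nK'.
  have l1 : κ < ζ'.
    by rewrite ltNge; apply/negP => h; apply: nK'; apply: Kconv Kκ' Kκ _; rewrite h ltW.
  have l2 : κ' < ζ.
    by rewrite ltNge; apply/negP => h; apply: nK; apply: Kconv Kκ Kκ' _; rewrite h ltW.
  have hm : Num.max κ κ' <= Num.min ζ ζ' by rewrite ge_max !le_min !ltW.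
  rewrite (mv c _ _ _ _ hc e KM nKm) ?(mv c _ _ _ _ hc e' KM nKm) //;
    by left; split; [|split; [exact: hm|]]; rewrite ?le_max ?ge_min lexx ?orbT.
have constL c κ ζ κ' ζ' : cocycle c -> endp κ ζ -> endp κ' ζ' -> ζ < κ -> ζ' < κ' ->
    E c κ ζ = E c κ' ζ'.
  move=> hc e e' l l'; have nK := endpK _ _ e; have nK' := endpK _ _ e'.
  have [Kκ _] := e; have [Kκ' _] := e'.
  have KM := Kmin _ _ Kκ Kκ'; have nKm := nKmax _ _ nK nK'.
  have l1 : ζ' < κ.
    by rewrite ltNge; apply/negP => h; apply: nK'; apply: Kconv Kκ Kκ' _; rewrite h ltW.
  have l2 : ζ < κ'.
    by rewrite ltNge; apply/negP => h; apply: nK; apply: Kconv Kκ' Kκ _; rewrite h ltW.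
  have hm : Num.max ζ ζ' <= Num.min κ κ' by rewrite ge_max !le_min !ltW.
  rewrite (mv c _ _ _ _ hc e KM nKm) ?(mv c _ _ _ _ hc e' KM nKm) //;
    by right; split; [|split; [exact: hm|]]; rewrite ?le_max ?ge_min lexx ?orbT.
have side κ ζ : endp κ ζ -> κ < ζ \/ ζ < κ.
  move=> e; have nK := endpK _ _ e; case: e => Kκ _.
  by have [h|h|h] := ltgtP κ ζ; [left|right|exfalso; apply: nK; rewrite -h].
(* It suffices to make the end values equal to a single constant. *)
have fin c β : cocycle c -> (forall κ ζ, endp κ ζ -> E c κ ζ = - β) -> coboundary c.
  move=> hc hE; exists (fun x => pot c x + β).
  have rc := resC _ hc.
  have claim x y : I x -> J y -> y ⪯ x -> res c x y =
      (if `[< J x >] then β else 0) - (if `[< I y >] then β else 0).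
    move=> Ix Jy yx; case: asboolP => Jx; case: asboolP => Iy.
    - by rewrite resK // subrr.
    - have e : endp x y by split=> //; right.
      have := hE _ _ e; rewrite E2 //; last exact: endpK e.
      by rewrite subr0 => /oppr_inj.
    - have e : endp y x by split=> //; left.
      by have := hE _ _ e; rewrite E1 // sub0r.
    have [yw wx] : y ⪯ w /\ w ⪯ x.
      apply: preceq_betw => //; apply: contrapT => /not_orP[/negP n1 /negP n2].
      have [xy|yx'|e] := ltgtP x y; last by apply: Jx; rewrite e.
        have [l|l] := ltP w x; first by apply: Jx; apply: Jconv Jw Jy _; rewrite !ltW.
        have [l'|l'] := ltP y w; first by apply: Iy; apply: Iconv Ix Iw _; rewrite !ltW.
        by move: n2; rewrite l l'.
      have [l|l] := ltP w y; first by apply: Iy; apply: Iconv Iw Ix _; rewrite !ltW.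
      have [l'|l'] := ltP x w; first by apply: Jx; apply: Jconv Jy Jw _; rewrite !ltW.
      by move: n1; rewrite l l'.
    rewrite (rc x w y) // !asboolT // subrr.
    have e : endp w x by split=> //; left.
    have e' : endp w y by split=> //; right.
    have := hE _ _ e'; rewrite E2 //; last exact: endpK e'.
    have := hE _ _ e; rewrite E1 // => -> /oppr_inj ->.
    by rewrite addNr.
  move=> x y Ix Jy yx; have := claim x y Ix Jy yx; rewrite /res.
  move=> /eqP; rewrite subr_eq => /eqP ->.
  by case: asboolP => _; case: asboolP => _; ring.
(* If [K] has at most one such end, the constant of the potential absorbs its value, every cocycle
   is a coboundary, and the zero functional serves. *)
have [[[κR ζR] [eR lR]]|noR] := pselect (exists p : R * R, endp p.1 p.2 /\ p.1 < p.2); last first.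
  exists (fun=> 0) => [a c c' _ _|c hc _]; first by rewrite mulr0 addr0.
  have [[[κL ζL] [eL lL]]|noL] := pselect (exists p : R * R, endp p.1 p.2 /\ p.2 < p.1).
    apply: (fin c (- E c κL ζL)) => // κ ζ e; rewrite opprK.
    case: (side _ _ e) => l; first by exfalso; apply: noR; exists (κ, ζ).
    exact: constL.
  apply: (fin c 0) => // κ ζ e; exfalso.
  by case: (side _ _ e) => l; [apply: noR|apply: noL]; exists (κ, ζ).
have [[[κL ζL] [eL lL]]|noL] := pselect (exists p : R * R, endp p.1 p.2 /\ p.2 < p.1); last first.
  exists (fun=> 0) => [a c c' _ _|c hc _]; first by rewrite mulr0 addr0.
  apply: (fin c (- E c κR ζR)) => // κ ζ e; rewrite opprK.
  case: (side _ _ e) => l; first exact: constR.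
  by exfalso; apply: noL; exists (κ, ζ).
exists (fun c => E c κR ζR - E c κL ζL) => [a c c' hc hc'|c hc /eqP].
  by rewrite !Elin //; ring.
rewrite subr_eq0 => /eqP RL; apply: (fin c (- E c κR ζR)) => // κ ζ e; rewrite opprK.
case: (side _ _ e) => l; first exact: constR.
by rewrite RL; apply: constL.
Qed.

Lemma cocycle_functional : exists2 lam : (R -> R -> k) -> k,
    forall a c c', cocycle c -> cocycle c' -> lam (clin a c c') = a * lam c + lam c' &
    forall c, cocycle c -> lam c = 0 -> coboundary c.
Proof.
have [[w [Iw Jw]]|dis] := pselect (exists x, I x /\ J x); first exact: overlap_functional Iw Jw.
by have [lam lin h] := disjoint_functional dis; exists lam.
Qed.
End Cocycles.

(** * Extensions and their classes *)

Section Extensions.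
Variables (R : realType) (A : quiverA R) (k : fieldType).
Local Notation "x ⪯ y" := (preceq A x y) (at level 70).
Local Notation rep := (qrep A k).
Variables (I J : set R) (hI : interval_set I) (hJ : interval_set J).
Local Notation MI := (Mint A k hI).
Local Notation MJ := (Mint A k hJ).
Local Notation e := (@unit_at R A k I hI).
Local Notation u := (@unit_at R A k J hJ).
Local Notation cocycle := (@cocycle R A k I J).
Local Notation coboundary := (@coboundary R A k I J).

(* [d] measures the failure of the pointwise splitting [s] to be a morphism. *)
Definition splitting (U E : rep) (f : rhom U E) (g : rhom E MI)
    (s : forall x, E x) (d : forall x y : R, U y) :=
  [/\ forall x, g x (s x) = e x, forall x, ~ I x -> s x = 0 &
      forall x y (h : y ⪯ x), I x -> rmap E h (s x) = s y + f y (d x y)].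

Section OneExtension.
Variables (U E : rep) (f : rhom U E) (g : rhom E MI).
Hypotheses (fi : hinj f) (gs : hsurj g) (ex : hexact f g).

Lemma splitting_ex : exists s d, splitting f g s d.
Proof.
have S x : {v : E x | g x v = e x /\ (~ I x -> v = 0)}.
  apply: cid; have [Ix|Ix] := pselect (I x).
    by have [v gv] := gs (e x); exists v.
  by exists 0; rewrite hmap0 unit_out.
pose s x := sval (S x).
have sE x : g x (s x) = e x by case: (svalP (S x)).
have s0 x : ~ I x -> s x = 0 by case: (svalP (S x)).
have D x y : {d : U y | forall h : y ⪯ x, I x -> rmap E h (s x) = s y + f y d}.
  apply: cid; have [[h Ix]|nh] := pselect (y ⪯ x /\ I x); last first.
    by exists 0 => h Ix; exfalso; apply: nh.
  have [|d dE] := (ex (rmap E h (s x) - s y)).1.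
    by rewrite hmapB hmap_nat !sE unit_map // subrr.
  exists d => h' _; rewrite dE (rmap_irr h' h).
  by rewrite addrC subrK.
exists s, (fun x y => sval (D x y)); split=> // x y h Ix.
exact: (svalP (D x y)).
Qed.

Variables (s : forall x, E x) (d : forall x y : R, U y).
Hypothesis sd : splitting f g s d.

Lemma splitting_dec x (v : E x) : exists w a, v = f x w + a *: s x.
Proof.
have [sE _ _] := sd; have [|w wE] := (ex (v - mcoef (g x v) *: s x)).1.
  by rewrite hmapB hmapZ sE -mcoefE subrr.
by exists w, (mcoef (g x v)); rewrite wE subrK.
Qed.

Lemma splitting_hom_eq X (b b' : rhom E X) : comph b f = comph b' f ->
  (forall x, I x -> b x (s x) = b' x (s x)) -> b = b'.
Proof.
move=> bf bs; apply: homP => x v; have [w [a ->]] := splitting_dec v.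
rewrite !hmapD !hmapZ; have /= -> := hom_ev bf x w; congr (_ + _ *: _).
have [Ix|Ix] := pselect (I x); first exact: bs.
by have [_ s0 _] := sd; rewrite s0 // !hmap0.
Qed.

(** A morphism out of [E] may be prescribed on [U] and on the elements [s x]; the condition on [t]
    is the image of the relation that defines [d]. *)
Lemma splitting_desc X (phi : rhom U X) (t : forall x, X x) :
  (forall x, ~ I x -> t x = 0) ->
  (forall x y (h : y ⪯ x), I x -> rmap X h (t x) = t y + phi y (d x y)) ->
  exists b : rhom E X, comph b f = phi /\ forall x, b x (s x) = t x.
Proof.
move=> t0 tn; have [sE s0 sn] := sd.
have D x (v : E x) : {p : U x * k | v = f x p.1 + p.2 *: s x}.
  by apply: cid; have [w [a vE]] := splitting_dec v; exists (w, a).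
pose b x v := phi x (sval (D x v)).1 + (sval (D x v)).2 *: t x.
have bE x w a : b x (f x w + a *: s x) = phi x w + a *: t x.
  rewrite /b; case: (D _ _) => -[w' a'] /= eq.
  have [Ix|Ix] := pselect (I x); last first.
    by move: eq; rewrite s0 // t0 // !scaler0 !addr0 => /fi ->.
  have aa : a = a'.
    have := congr1 (fun z => mcoef (g x z)) eq; rewrite !hmapD !hmapZ sE.
    have g0 z : g x (f x z) = 0 by apply/ex; exists z.
    by rewrite !g0 !add0r !mcoefZ mcoef_unit // !mulr1.
  by move: eq; rewrite aa => /addIr/fi ->.
have bl x : linear (b x).
  move=> a v v'; have [w [c ->]] := splitting_dec v; have [w' [c' ->]] := splitting_dec v'.
  have -> : a *: (f x w + c *: s x) + (f x w' + c' *: s x) =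
      f x (a *: w + w') + (a * c + c') *: s x.
    by rewrite hmap_linear scalerDr scalerA scalerDl addrACA.
  by rewrite !bE hmap_linear scalerDr scalerA scalerDl addrACA.
have bn x y (h : y ⪯ x) v : b y (rmap E h v) = rmap X h (b x v).
  have [w [a ->]] := splitting_dec v; rewrite bE.
  have [Ix|Ix] := pselect (I x).
    have -> : rmap E h (f x w + a *: s x) = f y (rmap U h w + a *: d x y) + a *: s y.
      by rewrite rmapD rmapZ sn // -hmap_nat hmapD hmapZ scalerDr -addrA [X in _ + X]addrC.
    rewrite bE rmapD rmapZ tn // -hmap_nat hmapD hmapZ scalerDr -addrA.
    by rewrite [X in _ + X]addrC.
  have -> : rmap E h (f x w + a *: s x) = f y (rmap U h w) + 0 *: s y.
    by rewrite (s0 x Ix) scaler0 addr0 hmap_nat scale0r addr0.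
  by rewrite bE (t0 x Ix) scaler0 addr0 scale0r addr0 hmap_nat.
exists (@Defs.Hom _ _ _ E X b bl bn); split.
  by apply: homP => x w /=; have := bE x w 0; rewrite !scale0r !addr0.
by move=> x /=; have := bE x 0 1; rewrite !hmap0 !add0r !scale1r.
Qed.
End OneExtension.

Definition splits_by (E : rep) (f : rhom MJ E) (g : rhom E MI) (s : forall x, E x) c :=
  splitting f g s (fun x y => c x y *: u y).

Lemma splits_by_cocycle (E : rep) (f : rhom MJ E) (g : rhom E MI) s c :
  hinj f -> splits_by f g s c -> cocycle c.
Proof.
move=> fi [sE s0 sn] x y z Ix Jz yx zy.
have Iy : I z -> I y.
  move=> Iz; have [_ cv] := (interval_setP I).1 hI.
  by case: (preceq_between zy yx) => h; [apply: cv Iz Ix h|apply: cv Ix Iz h].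
have := rmap_comp yx zy (preceq_trans zy yx) (s x).
rewrite !sn // rmapD -hmap_nat rmapZ.
have uyz : rmap MJ zy (u y) = if `[< J y >] then u z else 0.
  case: asboolP => [Jy|Jy]; first exact: unit_map.
  by rewrite unit_out // rmap0.
rewrite uyz; have -> : rmap E zy (s y) =
    s z + f z ((if `[< I y >] then c y z else 0) *: u z).
  case: asboolP => [Iy'|nIy]; first exact: sn.
  rewrite s0 // s0; last by move=> /Iy.
  by rewrite rmap0 scale0r hmap0 addr0.
rewrite -addrA => /addrI; rewrite -hmapD => /fi /(congr1 mcoef).
rewrite mcoefD !mcoefZ mcoef_unit // !mulr1 => <-; rewrite addrC; congr (_ + _).
by case: asboolP => _; rewrite ?mcoef_unit ?mulr1 // mcoef0 mulr0.
Qed.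

Lemma splits_by_ex (E : rep) (f : rhom MJ E) (g : rhom E MI) :
  hinj f -> hsurj g -> hexact f g -> exists s c, splits_by f g s c.
Proof.
move=> fi gs ex; have [s [d [sE s0 sn]]] := splitting_ex gs ex.
exists s, (fun x y => mcoef (d x y)); split=> // x y h Ix.
by rewrite sn // -mcoefE.
Qed.

(** The subobject [U] and the map [phi] are arbitrary so that equivalence, scaling and the Baer sum,
    with [U] a double copy of M_J, are all instances. A morphism [b] moves [s] to [s'] up to
    coefficients in M_J, and these are the potential of the coboundary. *)
Lemma extension_hom (U D E : rep) (f : rhom U D) (g : rhom D MI) s d
    (f' : rhom MJ E) (g' : rhom E MI) s' c' (phi : rhom U MJ) :
  hinj f -> hexact f g -> splitting f g s d ->
  hinj f' -> hexact f' g' -> splits_by f' g' s' c' ->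
  (exists b : rhom D E, comph b f = comph f' phi /\ comph g' b = g) <->
  coboundary (fun x y => mcoef (phi y (d x y)) - c' x y).
Proof.
move=> fi ex sd fi' ex' sd'; have [sE s0 sn] := sd; have [sE' s0' sn'] := sd'.
have uE x y (h : y ⪯ x) : J y -> rmap MJ h (u x) = (if `[< J x >] then 1 else 0) *: u y.
  move=> Jy; case: asboolP => Jx; first by rewrite unit_map // scale1r.
  by rewrite unit_out // rmap0 scale0r.
split=> [[b [bf g'b]]|[beta hb]].
  have B x : {a | b x (s x) = s' x + f' x (a *: u x)}.
    apply: cid; have [|w wE] := (ex' x (b x (s x) - s' x)).1.
      by rewrite hmapB sE'; have /= -> := hom_ev g'b x (s x); rewrite sE subrr.
    by exists (mcoef w); rewrite -mcoefE wE addrC subrK.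
  have [bt bs] : exists bt, forall x, b x (s x) = s' x + f' x (bt x *: u x).
    by exists (fun x => sval (B x)) => x; case: (B x).
  exists bt => x y Ix Jy yx.
  have bf0 x0 w : b x0 (f x0 w) = f' x0 (phi x0 w) by exact: (hom_ev bf x0 w).
  have := hmap_nat b yx (s x); rewrite sn // hmapD bs bf0 bs rmapD -hmap_nat sn' //.
  rewrite rmapZ uE // -!addrA => /addrI; rewrite -!hmapD => /fi' /(congr1 mcoef).
  rewrite !mcoefD !mcoefZ mcoef_unit // !mulr1.
  case: (asboolP (I y)) => Iy eq.
    apply/eqP; rewrite subr_eq; apply/eqP.
    have -> : mcoef (phi y (d x y)) = bt y + mcoef (phi y (d x y)) - bt y by ring.
    by rewrite eq; case: asboolP => _; ring.
  (* Outside [I] both splittings vanish at [y], so the coefficient chosen there is 0. *)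
  have By : bt y = 0.
    have := bs y; rewrite s0 // s0' // hmap0 add0r => /esym/(hinj0 fi') /(congr1 mcoef).
    by rewrite mcoefZ mcoef_unit // mulr1 mcoef0.
  move: eq; rewrite By add0r => ->.
  by case: asboolP => _; ring.
pose t x := if `[< I x >] then s' x + f' x (beta x *: u x) else 0.
have tE x : I x -> t x = s' x + f' x (beta x *: u x) by move=> Ix; rewrite /t asboolT.
have t0 x : ~ I x -> t x = 0 by move=> Ix; rewrite /t asboolF.
have [|b [bf bs]] := @splitting_desc _ _ f g fi ex s d sd E (comph f' phi) t t0.
  move=> x y h Ix; rewrite tE // rmapD -hmap_nat sn' // rmapZ [comph _ _ _ _]/=.
  have [Jy|Jy] := pselect (J y); last first.
    have M0 (w : MJ y) : w = 0 by apply: mcoef_inj; rewrite !mcoef_out.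
    rewrite (M0 (_ *: u y)) (M0 (_ *: rmap _ _ _)) (M0 (phi y _)) !hmap0 !addr0.
    by have [Iy|Iy] := pselect (I y); [rewrite tE // (M0 (_ *: _)) hmap0 addr0|rewrite t0 // s0'].
  rewrite uE // (mcoefE (phi y (d x y))).
  have := hb x y Ix Jy h => /eqP; rewrite subr_eq => /eqP ->.
  have [Iy|Iy] := pselect (I y).
    rewrite tE // (asboolT Iy) -!addrA; congr (_ + _); rewrite -!hmapD scalerA -!scalerDl.
    congr (f' y (_ *: _)); case: asboolP => _; ring.
  rewrite t0 // s0' // (asboolF Iy) !add0r -!hmapD scalerA -!scalerDl.
  congr (f' y (_ *: _)); case: asboolP => _; ring.
exists b; split=> //; apply: (splitting_hom_eq ex sd).
  rewrite -comphA bf; apply: homP => x w /=.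
  have -> : g' x (f' x (phi x w)) = 0 by apply/ex'; exists (phi x w).
  by symmetry; apply/ex; exists w.
move=> x Ix /=; rewrite bs tE // sE hmapD sE'.
have -> : g' x (f' x (beta x *: u x)) = 0 by apply/ex'; exists (beta x *: u x).
by rewrite addr0.
Qed.

(** The structure maps are triangular with off-diagonal entry [c]; the cocycle rule is exactly their
    functoriality. *)
Lemma cocycle_realize c : cocycle c -> exists (E : rep) (f : rhom MJ E) (g : rhom E MI) s,
  [/\ hinj f, hsurj g, hexact f g & splits_by f g s c].
Proof.
move=> hc.
pose m x y (h : y ⪯ x) (v : MJ x * MI x) : MJ y * MI y :=
  (rmap MJ h v.1 + (mcoef v.2 * c x y) *: u y, rmap MI h v.2).
have ml x y h : linear (@m x y h : (MJ x * MI x)%type -> (MJ y * MI y)%type).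
  move=> a [v1 v2] [w1 w2]; congr pair; rewrite /= !linearP //=.
  rewrite mcoefD mcoefZ mulrDl scalerDl scalerDr scalerA -mulrA addrACA.
  by rewrite -!addrA.
have out (K : set R) (hK : interval_set K) x (w : Mint A k hK x) : ~ K x -> w = 0.
  by move=> Kx; apply: mcoef_inj; rewrite !mcoef_out.
have mid x (h : x ⪯ x) v : mklin (ml x x h) v = v.
  case: v => v1 v2.
  rewrite -[LHS]/(rmap MJ h v1 + (mcoef v2 * c x x) *: u x, rmap MI h v2) !rmap_id; congr pair.
  have [Ix|Ix] := pselect (I x); last by rewrite (mcoef_out _ Ix) mul0r scale0r addr0.
  have [Jx|Jx] := pselect (J x); last by rewrite (unit_out A k hJ Jx) scaler0 addr0.
  have := hc x x x Ix Jx h h; rewrite !asboolT // => /eqP.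
  by rewrite eq_sym -subr_eq0 addrK => /eqP ->; rewrite mulr0 scale0r addr0.
have mc x y z (hyx : y ⪯ x) (hzy : z ⪯ y) (hzx : z ⪯ x) v :
    mklin (ml y z hzy) (mklin (ml x y hyx) v) = mklin (ml x z hzx) v.
  case: v => v1 v2.
  rewrite -[LHS]/(rmap MJ hzy (rmap MJ hyx v1 + (mcoef v2 * c x y) *: u y) +
    (mcoef (rmap MI hyx v2) * c y z) *: u z, rmap MI hzy (rmap MI hyx v2)).
  rewrite -[RHS]/(rmap MJ hzx v1 + (mcoef v2 * c x z) *: u z, rmap MI hzx v2).
  congr pair; last exact: rmap_comp.
  have [Jz|Jz] := pselect (J z); last by rewrite [LHS](out _ hJ) // [RHS](out _ hJ).
  have [Ix|Ix] := pselect (I x); last first.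
    by rewrite (out _ hI x v2 Ix) mcoef0 rmap0 mcoef0 !mul0r !scale0r !addr0; apply: rmap_comp.
  rewrite rmapD rmapZ (rmap_comp hyx hzy hzx) (hc x y z) // -addrA; congr (_ + _).
  apply: mcoef_inj; rewrite mcoefD !mcoefZ mcoef_unit // !mulr1 mulrDr.
  congr (_ + _); case: asboolP => [Jy|Jy].
  - by rewrite unit_map // mcoef_unit // mulr1.
  - by rewrite (unit_out A k hJ Jy) rmap0 mcoef0 !mulr0.
  - by rewrite mcoef_map.
  - by rewrite (mcoef_out _ Jy) mul0r mulr0.
pose E : rep := @QRep R A k (fun x => (MJ x * MI x)%type) (fun x y h => mklin (ml x y h)) mid mc.
pose f0 x (v : MJ x) : E x := (v, 0).
have fl x : linear (@f0 x).
  by move=> a v w; rewrite -[RHS]/(a *: v + w, a *: (0 : MI x) + 0) scaler0 addr0.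
have fn x y (h : y ⪯ x) v : f0 y (rmap MJ h v) = rmap E h (f0 x v).
  rewrite -[RHS]/(rmap MJ h v + (mcoef (0 : MI x) * c x y) *: u y, rmap MI h 0).
  by rewrite rmap0 mcoef0 mul0r scale0r addr0.
pose g0 x (v : E x) : MI x := v.2.
have gl x : linear (@g0 x) by [].
have gn x y (h : y ⪯ x) v : g0 y (rmap E h v) = rmap MI h (g0 x v) by [].
exists E, (@Defs.Hom _ _ _ MJ E f0 fl fn), (@Defs.Hom _ _ _ E MI g0 gl gn), (fun x => (0, e x)).
split=> [x v w [] //|x w|x [v w]|]; first by exists (0, w).
  by split=> /= [->|[v' [_ <-]]] //; exists v.
split=> //= [x Ix|x y h Ix]; first by rewrite (unit_out A k hI Ix).
rewrite -[LHS]/(rmap MJ h 0 + (mcoef (e x) * c x y) *: u y, rmap MI h (e x)).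
rewrite -[RHS]/(0 + c x y *: u y, e y + 0).
by rewrite rmap0 mcoef_unit // mul1r addr0 unit_map.
Qed.

Variable C : rep -> Prop.
Hypotheses (sC : serre C) (CI : C MI) (CJ : C MJ).

Lemma extension_exact U (E : extension C MI U) :
  [/\ hinj (einj E), hsurj (eproj E) & hexact (einj E) (eproj E)].
Proof. exact: exact_ses sC (eses E). Qed.

Definition has_class (E : extension C MI MJ) c :=
  exists s, splits_by (einj E) (eproj E) s c.

Lemma has_class_ex (E : extension C MI MJ) : exists c, has_class E c.
Proof.
have [fi gs ex] := extension_exact E.
by have [s [c h]] := splits_by_ex fi gs ex; exists c, s.
Qed.

Lemma has_class_cocycle (E : extension C MI MJ) c : has_class E c -> cocycle c.
Proof. by move=> [s]; apply: splits_by_cocycle; case: (extension_exact E). Qed.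

Lemma class_scale (E E' : extension C MI MJ) c c' a : has_class E c -> has_class E' c' ->
  ext_scale a E E' <-> coboundary (fun x y => a * c x y - c' x y).
Proof.
move=> [s h] [s' h']; have [fi gs ex] := extension_exact E.
have [fi' gs' ex'] := extension_exact E'.
rewrite /ext_scale (extension_hom (a *: idh MJ) fi ex h fi' ex' h').
have eq x y : J y -> mcoef ((a *: idh MJ) y (c x y *: u y)) - c' x y = a * c x y - c' x y.
  by move=> Jy; rewrite homZE !mcoefZ mcoef_unit // mulr1.
by split; apply: coboundary_ext => x y _ Jy _; rewrite eq.
Qed.

Lemma class_equiv (E E' : extension C MI MJ) c c' : has_class E c -> has_class E' c' ->
  ext_equiv E E' <-> coboundary (fun x y => c x y - c' x y).
Proof.
move=> h h'; have -> : ext_equiv E E' = ext_scale 1 E E'.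
  by rewrite /ext_scale scale1r comphid.
rewrite (class_scale 1 h h').
by split; apply: coboundary_ext => x y _ _ _; rewrite mul1r.
Qed.

Lemma class_realize c : cocycle c -> exists E : extension C MI MJ, has_class E c.
Proof.
move=> /cocycle_realize[E [f [g [s [fi gs ex h]]]]].
have CE := serre_ext sC fi gs ex CJ CI.
by exists (Extension (ses_exact CJ CE CI fi gs ex)), s.
Qed.

Lemma coboundaryB c c' : coboundary c -> coboundary c' ->
  coboundary (fun x y => c x y - c' x y).
Proof.
move=> h h'; apply: coboundary_ext (coboundary_lin (-1) h' h) => x y _ _ _.
by rewrite /clin mulN1r addrC.
Qed.

(** A given [D] is compared with [E1] and [E2] through the two projections and with [E3] through the
    codiagonal. Conversely, [D] is taken to be the fibre product of [E1] and [E2] over M_I. *)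
Lemma class_baer (E1 E2 E3 : extension C MI MJ) c1 c2 c3 :
  has_class E1 c1 -> has_class E2 c2 -> has_class E3 c3 ->
  ext_baer E1 E2 E3 <-> coboundary (fun x y => c1 x y + c2 x y - c3 x y).
Proof.
move=> [s1 h1] [s2 h2] [s3 h3].
have [fi1 gs1 ex1] := extension_exact E1; have [fi2 gs2 ex2] := extension_exact E2.
have [fi3 gs3 ex3] := extension_exact E3.
have comp (D : extension C MI (dsum MJ MJ)) (b : rhom (emid D) (dsum (emid E1) (emid E2))) s d :
    splitting (einj D) (eproj D) s d ->
    comph b (einj D) = dsumh (einj E1) (einj E2) ->
    comph (dsumh (eproj E1) (eproj E2)) b = comph (diagh MI) (eproj D) ->
    coboundary (fun x y => mcoef (d x y).1 + mcoef (d x y).2 - (c1 x y + c2 x y)).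
  move=> sd b1 b2; have [fi gs ex] := extension_exact D.
  have := (extension_hom (dfst MJ MJ) fi ex sd fi1 ex1 h1).1; case.
    exists (comph (dfst _ _) b); split; first by rewrite -comphA b1; apply: homP.
    by apply: homP => x v; have /= := hom_ev b2 x v => -[].
  move=> beta1 hb1; have := (extension_hom (dsnd MJ MJ) fi ex sd fi2 ex2 h2).1; case.
    exists (comph (dsnd _ _) b); split; first by rewrite -comphA b1; apply: homP.
    by apply: homP => x v; have /= := hom_ev b2 x v => -[].
  move=> beta2 hb2; exists (fun x => beta1 x + beta2 x) => x y Ix Jy yx.
  have eq1 := hb1 x y Ix Jy yx; have eq2 := hb2 x y Ix Jy yx.
  rewrite opprD addrACA [mcoef _ - _]eq1 [mcoef _ - _]eq2.
  by case: asboolP => _; case: asboolP => _; ring.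
split=> [[D [b [c [b1 b2 b3 b4]]]]|cb].
  have [fi gs ex] := extension_exact D; have [s [d sd]] := splitting_ex gs ex.
  have h12 := comp D b s d sd b1 b2.
  have h := (extension_hom (codiagh MJ) fi ex sd fi3 ex3 h3).1 (ex_intro _ c (conj b3 b4)).
  apply: coboundary_ext (coboundaryB h h12) => x y _ _ _ /=.
  by rewrite mcoefD; ring.
have C1 : C (emid E1) by have [] := eses E1.
have C2 : C (emid E2) by have [] := eses E2.
pose df : rhom (dsum (emid E1) (emid E2)) MI :=
  comph (eproj E1) (dfst _ _) - comph (eproj E2) (dsnd _ _).
have [D [j [ji je]]] := ker_ex df.
have CD : C D := serre_sub sC ji (serre_dsum sC C1 C2).
have [|f fE] := @hom_lift _ _ _ (dsum MJ MJ) D _ j (dsumh (einj E1) (einj E2)) ji.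
  move=> x [v w]; apply/je; rewrite -[LHS]/(eproj E1 x (einj E1 x v) - eproj E2 x (einj E2 x w)).
  have -> : eproj E1 x (einj E1 x v) = 0 by apply/ex1; exists v.
  have -> : eproj E2 x (einj E2 x w) = 0 by apply/ex2; exists w.
  by rewrite subrr.
have jf x v w : j x (f x (v, w)) = (einj E1 x v, einj E2 x w) by exact: (hom_ev fE x (v, w)).
pose g : rhom D MI := comph (eproj E1) (comph (dfst _ _) j).
have g2 x v : eproj E2 x (j x v).2 = eproj E1 x (j x v).1.
  have : df x (j x v) = 0 by apply/je; exists v.
  by move=> /= /subr0_eq.
have fi : hinj f.
  by move=> x [v w] [v' w'] /(congr1 (j x)); rewrite !jf => -[/fi1 -> /fi2 ->].
have gs : hsurj g.
  move=> x w; have [v1 v1E] := gs1 x w; have [v2 v2E] := gs2 x w.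
  have [|v vE] := (je x (v1, v2)).1; first by rewrite /= v1E v2E subrr.
  by exists v; rewrite /= vE.
have ex : hexact f g.
  move=> x v; split=> [/= gv|[[w1 w2] <-] /=]; last first.
    by rewrite jf /=; apply/ex1; exists w1.
  have [w1 w1E] := (ex1 x (j x v).1).1 gv.
  have [|w2 w2E] := (ex2 x (j x v).2).1; first by rewrite g2.
  by exists (w1, w2); apply: ji; rewrite jf w1E w2E -surjective_pairing.
pose DE := Extension (ses_exact (serre_dsum sC CJ CJ) CD CI fi gs ex).
have [s [d sd]] := splitting_ex gs ex.
have b2 : comph (dsumh (eproj E1) (eproj E2)) j = comph (diagh MI) g.
  by apply: homP => x v; rewrite /= g2.
have h12 := comp DE j s d sd fE b2.
have [|c [b3 b4]] := (extension_hom (codiagh MJ) fi ex sd fi3 ex3 h3).2.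
  have hN := coboundary_lin 1 h12 cb.
  apply: coboundary_ext hN => x y _ _ _ /=.
  by rewrite /clin mcoefD; ring.
by exists DE, j, c.
Qed.

(** [lam] identifies cocycles modulo coboundaries with [T], so its value on any cocycle of an
    extension depends only on the class. Leaving [T] general treats both outcomes, [k] and 0, at
    once. *)
Lemma Ext1_iso_functional (T : lmodType k) (lam : (R -> R -> k) -> T) :
  (forall a c c', cocycle c -> cocycle c' -> lam (clin a c c') = a *: lam c + lam c') ->
  (forall v, exists2 c, cocycle c & lam c = v) ->
  (forall c, cocycle c -> lam c = 0 <-> coboundary c) ->
  Ext1_iso C MI MJ T.
Proof.
move=> lin surj ker; pose cls E := sval (cid (has_class_ex E)).
have clsE E : has_class E (cls E) := svalP (cid (has_class_ex E)).
have clsZ E : cocycle (cls E) := has_class_cocycle (clsE E).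
have linB a c c' : cocycle c -> cocycle c' ->
    lam (fun x y => a * c x y - c' x y) = a *: lam c - lam c'.
  (* [clin (-1) c c] is the zero cocycle, which turns the difference into iterated instances of
     [clin]. *)
  move=> hc hc'; have -> : (fun x y => a * c x y - c' x y) = clin (-1) c' (clin a c (clin (-1) c c)).
    by apply/funext => x; apply/funext => y; rewrite /clin; ring.
  have h0 := cocycle_lin (-1) hc hc; have h1 := cocycle_lin a hc h0.
  by rewrite !lin // !scaleN1r addNr addr0 addrC.
have cocB a c c' : cocycle c -> cocycle c' -> cocycle (fun x y => a * c x y - c' x y).
  move=> hc hc'; have -> : (fun x y => a * c x y - c' x y) = clin (-1) c' (clin a c (clin (-1) c c)).
    by apply/funext => x; apply/funext => y; rewrite /clin; ring.
  by do 3! apply: cocycle_lin => //.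
have eqE a c c' : cocycle c -> cocycle c' ->
    lam c' = a *: lam c <-> coboundary (fun x y => a * c x y - c' x y).
  move=> hc hc'; rewrite -ker; last exact: cocB.
  rewrite linB //; split=> [->|/subr0_eq //]; exact: subrr.
exists (fun E => lam (cls E)); split=> [E E'|v|E1 E2 E3|a E E'].
- rewrite (class_equiv (clsE E) (clsE E')).
  have -> : (fun x y => cls E x y - cls E' x y) = (fun x y => 1 * cls E x y - cls E' x y).
    by apply/funext => x; apply/funext => y; rewrite mul1r.
  by rewrite -(eqE 1) // scale1r; split.
- have [c hc <-] := surj v; have [E hE] := class_realize hc; exists E.
  have : ext_scale 1 E E by exists (idh _); rewrite scale1r comphid compidh comphid.
  by rewrite (class_scale 1 hE (clsE E)) -(eqE 1) // scale1r.
- rewrite (class_baer (clsE E1) (clsE E2) (clsE E3)).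
  have h12 := cocycle_lin 1 (clsZ E1) (clsZ E2).
  have -> : (fun x y => cls E1 x y + cls E2 x y - cls E3 x y) =
      (fun x y => 1 * clin 1 (cls E1) (cls E2) x y - cls E3 x y).
    by apply/funext => x; apply/funext => y; rewrite /clin; ring.
  by rewrite -(eqE 1) // scale1r lin // scale1r.
- by rewrite (class_scale a (clsE E) (clsE E')) -eqE.
Qed.

Lemma Ext1_dichotomy : Ext1_iso C MI MJ k^o \/ Ext1_iso C MI MJ 'rV[k]_0.
Proof.
have [lam lin ker] := cocycle_functional A k hI hJ.
have [all|/existsNP[c0 /not_implyP[hc0 nc0]]] := pselect (forall c, cocycle c -> coboundary c).
  right; apply: (@Ext1_iso_functional _ (fun=> 0)).
  - by move=> a c c' _ _; rewrite scaler0 addr0.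
  - move=> v; exists (fun _ _ => 0); last by apply/rowP => -[].
    by move=> x y z *; rewrite !if_same addr0.
  - by move=> c hc; split=> // _; apply: all.
have l0 : lam c0 != 0 by apply: contra_notN nc0 => /eqP; apply: ker.
left; apply: (@Ext1_iso_functional k^o lam) => // [v|c hc]; last first.
  split=> [|cb]; first exact: ker.
  (* If [lam] were nonzero on a coboundary, subtracting a multiple of it would move [c0] into the
     kernel of [lam], and [c0] would be a coboundary. *)
  apply: contrapT => /eqP lc; apply: nc0.
  have hl : cocycle (clin (- (lam c0 / lam c)) c c0) by apply: cocycle_lin.
  have hk : coboundary (clin (- (lam c0 / lam c)) c c0).
    by apply: ker; rewrite // lin // mulNr divfK // addNr.
  apply: coboundary_ext (coboundary_lin (lam c0 / lam c) cb hk) => x y _ _ _.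
  by rewrite /clin; ring.
have z0 : cocycle (clin (-1) c0 c0) by apply: cocycle_lin.
exists (clin (v / lam c0) c0 (clin (-1) c0 c0)); first exact: cocycle_lin.
by rewrite !lin // mulN1r addNr addr0 divfK.
Qed.
End Extensions.

(** * Auslander-Reiten sequences *)

Section AuslanderReiten.
Variables (R : realType) (A : quiverA R) (k : fieldType).
Local Notation "x ⪯ y" := (preceq A x y) (at level 70).
Local Notation rep := (qrep A k).
Local Notation u := (unit_at A k).
Local Notation fg := (@rep_fg R A k).

Variables (c b a d : R).
Hypotheses (cb : c ⪯ b) (ba : b ⪯ a) (ad : a ⪯ d).
Hypotheses (ncb : c <> b) (nba : b <> a) (nad : a <> d).

Let up x : b ⪯ x -> x ⪯ a \/ a ⪯ x.
Proof. by move=> bx; apply: up_chain cb ncb bx ba. Qed.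

Let dn x : x ⪯ a -> x ⪯ b \/ b ⪯ x.
Proof. by move=> xa; apply: down_chain ad nad xa ba. Qed.

Let chain x y : b ⪯ x -> b ⪯ y -> x ⪯ y \/ y ⪯ x.
Proof. by move=> bx by'; apply: up_chain cb ncb bx by'. Qed.

Let Icc := [set x | b ⪯ x /\ x ⪯ a].
Let Ico := [set x | b ⪯ x /\ x ⪯ a /\ x <> a].
Let Ioc := [set x | b ⪯ x /\ x <> b /\ x ⪯ a].
Let Ioo := [set x | b ⪯ x /\ x <> b /\ x ⪯ a /\ x <> a].

Let squeeze x y : x ⪯ y -> y ⪯ x -> x = y := @preceq_anti _ _ x y.

Let icc : interval_set Icc.
Proof.
apply: (@chain_interval _ A); first by exists b; split=> //; apply: preceq_refl.
  by move=> x y [bx _] [by' _]; apply: chain.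
by move=> x y z [bx _] [_ ya] xz zy; split; [apply: preceq_trans bx xz|apply: preceq_trans zy ya].
Qed.

Let ico : interval_set Ico.
Proof.
apply: (@chain_interval _ A); first by exists b; split=> //; apply: preceq_refl.
  by move=> x y [bx _] [by' _]; apply: chain.
move=> x y z [bx _] [_ [ya nya]] xz zy; split; first exact: preceq_trans bx xz.
split; first exact: preceq_trans zy ya.
by move=> za; apply: nya; apply: squeeze => //; rewrite -za.
Qed.

Let ioc : interval_set Ioc.
Proof.
apply: (@chain_interval _ A); first exists a.
  by split=> //; split; [apply: nesym|apply: preceq_refl].
  by move=> x y [bx _] [by' _]; apply: chain.
move=> x y z [bx [nbx _]] [_ [_ ya]] xz zy; split; first exact: preceq_trans bx xz.
split; last exact: preceq_trans zy ya.
by move=> zb; apply: nbx; apply: squeeze => //; rewrite -zb.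
Qed.

Let ioo : interval_set Ioo.
Proof.
apply: (@chain_interval _ A).
- have [z [bz za nbz nza]] := preceq_dense ba nba.
  by exists z; split=> //; split; [apply: nesym|].
- by move=> x y [bx _] [by' _]; apply: chain.
move=> x y z [bx [nbx _]] [_ [_ [ya nya]]] xz zy; split; first exact: preceq_trans bx xz.
split; first by move=> zb; apply: nbx; apply: squeeze => //; rewrite -zb.
split; first exact: preceq_trans zy ya.
by move=> za; apply: nya; apply: squeeze => //; rewrite -za.
Qed.

Local Notation Mcc := (Mint A k icc).
Local Notation Mco := (Mint A k ico).
Local Notation Moc := (Mint A k ioc).
Local Notation Moo := (Mint A k ioo).

Let fg_cc : fg Mcc.
Proof.
have pI : pint A [set x | x ⪯ a] by left; exists a.
have [x y yx _ [bx _] [_ ya]|x y yx /= xa _ [by' _]|f fE] :=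
  @Mint_map _ A k _ _ (pint_interval pI) icc.
- exact: ya.
- by split=> //; apply: preceq_trans by' yx.
have fs : hsurj f by apply: (Mint_map_surj _ fE) => x [].
exact (serre_quot (serre_fg A k) fs (pint_fg k _ pI)).
Qed.

Let cc_oc : exists f : rhom Mcc Moc, forall x, Icc x -> f x (u icc x) = u ioc x.
Proof.
apply: Mint_map => x y yx; first by move=> _ _ [by' [_ ya]].
move=> [bx xa] [by' ya] [_ [nby _]]; split=> //; split=> // xb.
by apply: nby; apply: squeeze => //; rewrite -xb.
Qed.

Let co_cc : exists f : rhom Mco Mcc, forall x, Ico x -> f x (u ico x) = u icc x.
Proof.
apply: Mint_map => x y yx; last by move=> [bx [xa _]].
move=> [_ [xa nxa]] _ [by' ya]; split=> //; split=> // ya'.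
by apply: nxa; apply: squeeze => //; rewrite -ya'.
Qed.

Let oo_oc : exists f : rhom Moo Moc, forall x, Ioo x -> f x (u ioo x) = u ioc x.
Proof.
apply: Mint_map => x y yx; last by move=> [bx [nxb [xa _]]].
move=> [_ [_ [xa nxa]]] _ [by' [nyb ya]]; split=> //; split=> //; split=> // ya'.
by apply: nxa; apply: squeeze => //; rewrite -ya'.
Qed.

Let co_oo : exists f : rhom Mco Moo, forall x, Ico x -> f x (u ico x) = u ioo x.
Proof.
apply: Mint_map => x y yx; first by move=> _ _ [by' [_ [ya nya]]].
move=> [bx [xa nxa]] [by' ya] [_ [nby _]]; split=> //; split=> // xb.
by apply: nby; apply: squeeze => //; rewrite -xb.
Qed.

Let fg_oc : fg Moc.
Proof.
have [f fE] := cc_oc.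
have fs : hsurj f by apply: (Mint_map_surj _ fE) => x [bx [_ xa]].
exact (serre_quot (serre_fg A k) fs fg_cc).
Qed.

Let fg_co : fg Mco.
Proof.
have [f fE] := co_cc.
have fi : hinj f by apply: (Mint_map_inj _ fE) => x [bx [xa _]].
exact (serre_sub (serre_fg A k) fi fg_cc).
Qed.

Let fg_oo : fg Moo.
Proof.
have [f fE] := oo_oc.
have fi : hinj f by apply: (Mint_map_inj _ fE) => x [bx [nxb [xa _]]].
exact (serre_sub (serre_fg A k) fi fg_oc).
Qed.

(* A map out of M_[b,a) factors as soon as the image of the generator at [b]
   comes from [X a]; otherwise a functional on [X b] separating it from the
   image of [X a] gives a retraction. *)
Lemma almost_split_left X (h : rhom Mco X)
    (f1 : rhom Mco Mcc) (f2 : rhom Mco Moo) : Rep_pwf X ->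
  (forall x, Ico x -> f1 x (u ico x) = u icc x) ->
  (forall x, Ico x -> f2 x (u ico x) = u ioo x) ->
  (exists r, comph r h = idh Mco) \/
  exists h1 : rhom Mcc X, exists h2 : rhom Moo X, h = comph h1 f1 + comph h2 f2.
Proof.
move=> Xf f1E f2E; pose ub := h b (u ico b).
have Ib : Ico b by split=> //; apply: preceq_refl.
have h0 y : y ⪯ b -> y <> b -> forall hy : y ⪯ b, rmap X hy ub = 0.
  move=> yb nyb hy; rewrite (hom_unit_map h hy) // unit_out ?hmap0 //.
  by move=> [by0 _]; apply: nyb; exact: squeeze yb by0.
have [[t tE]|nt] := pselect (exists t, rmap X ba t = ub); [right|left]; last first.
  have [n /has_dim_findim Xn] := Xf b.
  have nS : ~ range (rmap X ba) ub by move=> [t _ e]; apply: nt; exists t.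
  have hS := subspace_im (linearP (rmap X ba)).
  have [phi [phil phi0 phi1]] := findim_functional Xn hS nS.
  pose psi x (v : X x) : k^o := if pselect (Ico x) is left p then phi (rmap X p.1 v) else 0.
  have psiE x (p : b ⪯ x) v : Ico x -> psi x v = phi (rmap X p v).
    by move=> Ix; rewrite /psi; case: pselect => // p'; rewrite (rmap_irr p'.1 p).
  have [|x v nI|x y hyx v Iy|r rE] := @to_Mint _ _ _ _ ico X psi.
  - move=> x s v w; rewrite /psi; case: pselect => p; first by rewrite linearP phil.
    by rewrite scaler0 addr0.
  - by rewrite /psi; case: pselect.
  - have by' := Iy.1; have bx := preceq_trans by' hyx.
    rewrite (psiE _ by') // (rmap_comp _ _ bx).
    have [Ix|nI] := pselect (Ico x); first by rewrite (psiE _ bx).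
    (* A point above [b] but outside [b,a) lies above [a], so its restriction to [b] passes through
       [X a] and is killed by [phi]. *)
    rewrite /psi; case: pselect => // _; have ax : a ⪯ x.
      case: (up bx) => // xa; have [->|nxa] := pselect (x = a); first exact: preceq_refl.
      by exfalso; apply: nI.
    by rewrite -(rmap_comp ax ba bx) phi0 //; exists (rmap X ax v).
  exists r; apply: (hom_scalar_eq (x := b)) => //.
  by rewrite /= rE (psiE _ (preceq_refl A b)) // rmap_id phi1 mcoef_unit.
have [|x y hyx [bx xa]|h1 h1E] := @from_Mint _ _ _ _ icc X
    (fun x => if pselect (Icc x) is left p then rmap X p.2 t else 0).
- by move=> x nI; case: pselect.
- case: pselect => [p|/(_ (conj bx xa))//].
  have ya := preceq_trans hyx xa; rewrite (rmap_comp _ _ ya).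
  case: pselect => [p'|nI]; first exact: rmap_irr.
  have [yb|by'] := dn ya; last by exfalso; apply: nI.
  rewrite -(rmap_comp ba yb ya) tE h0 // => e; apply: nI.
  by rewrite e; split=> //; apply: preceq_refl.
have h1b : h1 b (u icc b) = ub.
  rewrite h1E mcoef_unit; last by split=> //; apply: preceq_refl.
  rewrite scale1r; case: pselect => [p|[]]; last by split=> //; apply: preceq_refl.
  by rewrite (rmap_irr _ ba).
(* What is left after the part through M_[b,a] vanishes at [b], hence factors through M_(b,a). *)
pose g := h - comph h1 f1.
have gb : g b (u ico b) = 0 by rewrite homDE homNE /= f1E // h1b subrr.
have [|x y hyx Ix|h2 h2E] := @from_Mint _ _ _ _ ioo X
    (fun x => if `[< Ioo x >] then g x (u ico x) else 0).
- by move=> x nI; rewrite asboolF.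
- rewrite asboolT // hom_unit_map; last by case: Ix => bx [_ [xa nxa]].
  case: asboolP => // nI; have [Iy|nIy] := pselect (Ico y); last by rewrite unit_out // hmap0.
  have -> : y = b; last exact: gb.
  by case: Iy => by' [ya nya]; apply: contrapT => nyb; apply: nI.
exists h1, h2; have -> : comph h2 f2 = g; last by rewrite /g addrC subrK.
apply: hom_Mint_eq => x Ix; rewrite /= f2E // h2E.
case: asboolP => [Io|nI]; first by rewrite mcoef_unit // scale1r.
rewrite scaler0; have -> : x = b; last exact/esym/gb.
by case: Ix => bx [xa nxa]; apply: contrapT => nxb; apply: nI.
Qed.

(** The functional [phi] induced by [h] at [a] decides. If it kills the kernel of [X a] -> [X b], it
    factors through [X b], which lifts [h] up to a map vanishing at [a]. Otherwise an element killed
    at [b] on which [phi] is nonzero generates a copy of M_(b,a] that splits [h]. *)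
Lemma almost_split_right X (h : rhom X Moc)
    (g1 : rhom Mcc Moc) (g2 : rhom Moo Moc) : Rep_pwf X ->
  (forall x, Icc x -> g1 x (u icc x) = u ioc x) ->
  (forall x, Ioo x -> g2 x (u ioo x) = u ioc x) ->
  (exists s, comph h s = idh Moc) \/
  exists h1 : rhom X Mcc, exists h2 : rhom X Moo, h = comph g1 h1 + comph g2 h2.
Proof.
move=> Xf g1E g2E.
have Ia : Ioc a by split=> //; split; [apply: nesym|apply: preceq_refl].
pose phi (v : X a) : k^o := mcoef (h a v).
have phil : linear phi by move=> s v w; rewrite /phi hmap_linear mcoefD mcoefZ.
have phi_up x (ax : a ⪯ x) v : x <> a -> phi (rmap X ax v) = 0.
  move=> nxa; rewrite /phi hmap_nat mcoef_map // mcoef_out //.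
  by move=> [_ [_ xa]]; apply: nxa; apply: squeeze.
have [ker|/existsNP[t /not_implyP[tb /eqP nt]]] :=
  pselect (forall t, rmap X ba t = 0 -> phi t = 0); [right|left]; last first.
  have [|x y hyx [bx [nxb xa]]|s sE] := @from_Mint _ _ _ _ ioc X
      (fun x => if pselect (Ioc x) is left p then rmap X p.2.2 ((phi t)^-1 *: t) else 0).
  - by move=> x nI; case: pselect.
  - case: pselect => [p|/(_ (conj bx (conj nxb xa)))//].
    have ya := preceq_trans hyx xa; rewrite (rmap_comp _ _ ya).
    case: pselect => [p'|nI]; first exact: rmap_irr.
    have [yb|by'] := dn ya; first by rewrite -(rmap_comp ba yb ya) rmapZ tb scaler0 rmap0.
    have yb : y = b by apply: contrapT => nyb; apply: nI.
    by subst y; rewrite (rmap_irr _ ba) rmapZ tb scaler0.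
  exists s; apply: (hom_scalar_eq (x := a)) => //.
  rewrite /= sE mcoef_unit // scale1r; case: pselect => [p|//].
  by rewrite rmap_id hmapZ mcoefZ mulVf.
have [n /has_dim_findim Xn] := Xf b.
have [psi psil psiE] := findim_factor Xn (linearP (rmap X ba)) phil ker.
have [|x v nI|x y hyx v Iy|h1 h1E] := @to_Mint _ _ _ _ icc X
    (fun x v => if pselect (Icc x) is left p then psi (rmap X p.1 v) else 0).
- move=> x s v w; case: pselect => p; first by rewrite linearP psil.
  by rewrite scaler0 addr0.
- by case: pselect.
- have by' := Iy.1; have bx := preceq_trans by' hyx.
  case: pselect => // p; rewrite (rmap_comp _ _ bx).
  case: pselect => [p'|nI]; first by rewrite (rmap_irr _ p'.1).
  have ax : a ⪯ x by case: (up bx) => // xa; exfalso; apply: nI.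
  rewrite -(rmap_comp ax ba bx) psiE phi_up // => e; apply: nI.
  by rewrite e; split=> //; apply: preceq_refl.
have h1a v : mcoef (h1 a v) = phi v.
  rewrite h1E; case: pselect => [p|[]]; last by split=> //; apply: preceq_refl.
  by rewrite (rmap_irr _ ba) psiE.
have g1c x v : Icc x -> Ioc x -> mcoef (g1 x v) = mcoef v.
  by move=> Ix Ix'; rewrite hom_unit g1E // mcoefZ mcoef_unit // mulr1.
pose g := h - comph g1 h1.
have ga v : mcoef (g a v) = 0.
  rewrite homDE homNE mcoefD mcoefN [comph _ _ _ _]/= g1c // ?h1a ?subrr //.
  by split=> //; apply: preceq_refl.
have [|x v nI|x y hyx v Iy|h2 h2E] := @to_Mint _ _ _ _ ioo X
    (fun x v => if `[< Ioo x >] then mcoef (g x v) else 0).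
- move=> x s v w; case: asboolP => _; last by rewrite scaler0 addr0.
  by rewrite hmap_linear mcoefD mcoefZ.
- by rewrite asboolF.
- have [by' [nyb [ya nya]]] := Iy.
  rewrite asboolT // hmap_nat mcoef_map //.
  case: asboolP => // nI; have [Ix|nIx] := pselect (Ioc x); last by rewrite mcoef_out.
  have xE : x = a by case: Ix => bx [nxb xa]; apply: contrapT => nxa; apply: nI.
  by subst x; apply: ga.
exists h1, h2; have -> : comph g2 h2 = g; last by rewrite /g addrC subrK.
apply: homP => x v; apply: mcoef_inj; rewrite /=.
have [Ix|nI] := pselect (Ioo x).
  have [bx [nxb [xa nxa]]] := Ix.
  by rewrite hom_unit g2E // mcoefZ mcoef_unit // mulr1 h2E asboolT.
have -> : h2 x v = 0 by apply: mcoef_inj; rewrite !mcoef_out.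
rewrite hmap0 mcoef0; have [Ix|nIx] := pselect (Ioc x); last by rewrite mcoef_out.
have xa : x = a by case: Ix => bx [nxb xa]; apply: contrapT => nxa; apply: nI.
by subst x; exact: esym (ga v).
Qed.

Lemma AR_exists : exists (U V W : rep) (f : rhom U V) (g : rhom V W), AR_sequence fg f g.
Proof.
have [f1 f1E] := co_cc; have [f2 f2E] := co_oo; have [g1 g1E] := cc_oc; have [g2 g2E] := oo_oc.
have f1i : hinj f1 by apply: (Mint_map_inj _ f1E) => x [bx [xa _]].
have f2s : hsurj f2 by apply: (Mint_map_surj _ f2E) => x [bx [_ xa]].
have g1s : hsurj g1 by apply: (Mint_map_surj _ g1E) => x [bx [_ xa]].
have g2i : hinj g2 by apply: (Mint_map_inj _ g2E) => x [bx [nxb [xa _]]].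
pose f := hpair f1 f2; pose g := hcopair g1 (- g2).
have fE x v : f x v = (f1 x v, f2 x v) by [].
have gE x v w : g x (v, w) = g1 x v - g2 x w by [].
have gf : comph g1 f1 = comph g2 f2.
  apply: hom_Mint_eq => x Ix /=; rewrite f1E // f2E // g1E; last by case: Ix => bx [xa _].
  have [Ioo_x|nI] := pselect (Ioo x); first by rewrite g2E.
  rewrite (unit_out A k ioo nI) hmap0 unit_out // => -[bx [nxb _]].
  by apply: nI; case: Ix => _ [].
have fi : hinj f by move=> x v w []; rewrite -!/(hmap _ _) => /f1i.
have gs : hsurj g.
  by move=> x w; have [v vE] := g1s x w; exists (v, 0); rewrite gE vE hmap0 subr0.
have Ib : Ico b by split=> //; apply: preceq_refl.
have Ia : Ioc a by split=> //; split; [apply: nesym|apply: preceq_refl].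
have Iba : Icc b by split=> //; apply: preceq_refl.
have Iaa : Icc a by split=> //; apply: preceq_refl.
have ex : hexact f g.
  move=> x [v w]; split=> [|[z <-]]; last first.
    by rewrite fE gE; have /= -> := hom_ev gf x z; rewrite subrr.
  rewrite gE => /subr0_eq vw.
  have [Ix|nI] := pselect (Ico x).
    exists (mcoef v *: u ico x); rewrite fE !hmapZ f1E // -mcoefE; congr pair.
    have [Ix'|nI'] := pselect (Ioo x); last by apply: mcoef_inj; rewrite !mcoef_out.
    have h1 : forall z, mcoef (g1 x z) = mcoef z.
      move=> z; rewrite hom_unit g1E ?mcoefZ ?mcoef_unit ?mulr1 //.
        by case: Ix' => bx [nxb [xa _]].
      by case: Ix => bx [xa _].
    have h2 : forall z, mcoef (g2 x z) = mcoef z.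
      move=> z; rewrite hom_unit g2E ?mcoefZ ?mcoef_unit ?mulr1 //.
      by case: Ix' => bx [nxb [xa _]].
    by rewrite f2E // -h1 vw h2 -mcoefE.
  exists 0; rewrite fE !hmap0.
  have w0 : w = 0.
    apply: mcoef_inj; rewrite mcoef_out ?mcoef0 // => -[bx [nxb [xa nxa]]].
    by apply: nI.
  rewrite w0; congr pair; apply: mcoef_inj; rewrite mcoef0.
  have [[bx xa]|nI'] := pselect (Icc x); last by rewrite mcoef_out.
  have xE : x = a by apply: contrapT => nxa; apply: nI.
  subst x; move: vw; rewrite w0 hmap0 => /(congr1 mcoef).
  by rewrite hom_unit g1E // mcoefZ mcoef_unit // mulr1 mcoef0.
have Vfg := serre_dsum (serre_fg A k) fg_cc fg_oo.
exists Mco, (dsum Mcc Moo), Moc, f, g; split.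
- exact: ses_exact.
(* A retraction would kill the generator of M_[b,a] at [b], which is restricted from [a], where
   M_[b,a) vanishes. A section at [a] would have its value in M_[b,a], where restriction to [b] is
   injective although M_(b,a] vanishes at [b]. *)
- split=> [[r rf]|[s gs1]].
    have : r b (f1 b (u ico b), f2 b (u ico b)) = u ico b := hom_ev rf b (u ico b).
    rewrite f1E // (_ : f2 b (u ico b) = 0); last first.
      by rewrite f2E // unit_out // => -[_ []].
    have -> : r b (u icc b, 0) = 0.
      have -> : (u icc b, 0) = rmap (dsum Mcc Moo) ba (u icc a, 0).
        by rewrite -[RHS]/(rmap Mcc ba (u icc a), rmap Moo ba 0) rmap0 unit_map.
      rewrite hmap_nat (_ : r a _ = 0) ?rmap0 //.
      by apply: mcoef_inj; rewrite !mcoef_out // => -[_ []].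
    move=> /(congr1 mcoef); rewrite mcoef0 mcoef_unit // => /esym/eqP.
    by rewrite oner_eq0.
  have : g a (s a (u ioc a)) = u ioc a := hom_ev gs1 a (u ioc a).
  case E: (s a (u ioc a)) => [v w]; rewrite gE.
  have w0 : w = 0 by apply: mcoef_inj; rewrite !mcoef_out // => -[_ [_ []]].
  have : rmap (dsum Mcc Moo) ba (v, w) = 0.
    rewrite -E (hom_unit_map s ba) // unit_out ?hmap0 //.
    by move=> [_ []].
  move=> /(congr1 fst); rewrite -[LHS]/(rmap Mcc ba v) => /(congr1 mcoef).
  rewrite mcoef_map // mcoef0 => v0.
  have -> : v = 0 by apply: mcoef_inj; rewrite v0 mcoef0.
  rewrite w0 !hmap0 subrr => /(congr1 mcoef); rewrite mcoef0 mcoef_unit // => /esym/eqP.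
  by rewrite oner_eq0.
- by split; apply: Mint_indecomposable.
- move=> X h indX nX _; have [Xfg _ _] := indX.
  have [[r rh]|[h1 [h2 hE]]] := almost_split_left h (serre_pwf (serre_fg A k) Xfg) f1E f2E.
    exfalso; apply: nX; apply: (retract_indecomposable (serre_fg A k) indX rh).
    exact: Mint_nonzero.
  by exists (hcopair h1 h2); rewrite hE; apply: homP.
- move=> X h indX nX _; have [Xfg _ _] := indX.
  have [[s hs]|[h1 [h2 hE]]] := almost_split_right h (serre_pwf (serre_fg A k) Xfg) g1E g2E.
    exfalso; apply: nX; apply: (retract_indecomposable (serre_fg A k) indX hs).
    exact: Mint_nonzero.
  exists (hpair h1 (- h2)); rewrite hE; apply: homP => x v.
  by rewrite /= hmapN opprK.
Qed.
End AuslanderReiten.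

Section NoAuslanderReiten.
Variables (R : realType) (A : quiverA R) (k : fieldType).
Local Notation "x ⪯ y" := (preceq A x y) (at level 70).
Local Notation rep := (qrep A k).
Local Notation fg := (@rep_fg R A k).

Definition order_itv b a := [set x | b ⪯ x /\ x ⪯ a].

Lemma order_itv_interval b a : b ⪯ a -> interval_set (order_itv b a).
Proof.
move=> ba; apply: (@chain_interval _ A).
- by exists b; split=> //; apply: preceq_refl.
- move=> x y [bx xa] [by' ya].
  have [e|nba] := pselect (b = a).
    subst a; left; rewrite (preceq_anti xa bx) (preceq_anti ya by'); exact: preceq_refl.
  have [n [n1 n2 n3 _]] := preceq_common bx xa nba.
  have [m [m1 m2 m3 _]] := preceq_common by' ya nba.
  have nm := seg_uniq nba n1 n3 m1 m3; subst m; exact: seg_total n2 m2.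
- by move=> x y z [bx _] [_ ya] xz zy; split; [apply: preceq_trans bx xz|apply: preceq_trans zy ya].
Qed.

Local Notation M ba := (Mint A k (order_itv_interval ba)).

Lemma order_itv_indecomposable b a (ba : b ⪯ a) : indecomposable fg (M ba).
Proof.
apply: Mint_indecomposable.
have pI : pint A [set x | x ⪯ a] by left; exists a.
have [x y yx _ [bx _] [_ ya]|x y yx /= xa _ [by' _]|f fE] :=
  @Mint_map _ A k _ _ (pint_interval pI) (order_itv_interval ba).
- exact: ya.
- by split=> //; apply: preceq_trans by' yx.
have fs : hsurj f by apply: (Mint_map_surj _ fE) => x [].
exact (serre_quot (serre_fg A k) fs (pint_fg k _ pI)).
Qed.

Lemma order_itv_not_isomorphic b a b' a' (ba : b ⪯ a) (ba' : b' ⪯ a') x :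
  order_itv b a x -> ~ order_itv b' a' x -> ~ isomorphic (M ba) (M ba').
Proof.
move=> Ix nIx /isomorphic_bij[f fi _].
have /(congr1 mcoef) : unit_at A k (order_itv_interval ba) x = 0.
  by apply: (fi x); apply: mcoef_inj; rewrite !mcoef_out.
by rewrite mcoef_unit // mcoef0 => /eqP; rewrite oner_eq0.
Qed.

Variables (c b a : R).
Hypotheses (cb : c ⪯ b) (ba : b ⪯ a) (ncb : c <> b) (nba : b <> a).
Let bb := preceq_refl A b.
Let I := order_itv b b.
Local Notation Mb := (M bb).
Local Notation e := (unit_at A k (order_itv_interval bb)).

Let Ib : I b. Proof. by split. Qed.
Let IE x : I x -> x = b. Proof. by move=> [bx xb]; apply: preceq_anti xb bx. Qed.

(* The images of [B z], [z] above [b], in [B b] stabilise as [z] decreases to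
   [b], so a factorisation of M_b -> M_[b,a'] through [B] for [a'] close to
   [b] already splits M_b -> [B]. *)
Lemma no_AR_left : ~ exists (B Z : rep) (f : rhom Mb B) (g : rhom B Z), AR_sequence fg f g.
Proof.
move=> [B [Z [f [g [fgses [nsec _] _ AR _]]]]]; apply: nsec.
have [_ Bfg _ _ _] := fgses.
have Bf := serre_pwf (serre_fg A k) Bfg.
have [n /has_dim_findim Bn] := Bf b.
pose D := [set z | b ⪯ z /\ b <> z].
pose L z := [set v | exists (h : b ⪯ z) w, rmap B h w = v].
have LA z z' : b ⪯ z -> z ⪯ z' -> L z' `<=` L z.
  by move=> bz zz _ [h [w <-]]; exists bz, (rmap B zz w); apply: rmap_comp.
have [||z z' [bz nz] [bz' nz']|z1 [bz1 nz1] zmax] := @chain_max _ _ _ _ D L Bn.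
- by exists a.
- move=> z [bz nz]; split=> [|s _ _ [h [w <-]] [h' [w' <-]]].
    by exists bz, 0; rewrite rmap0.
  by exists h, (s *: w + w'); rewrite rmapD rmapZ !(rmap_irr h h').
- by case: (up_chain cb ncb bz bz') => h; [right|left]; apply: LA.
have [a' [ba' az nba' naz]] := preceq_dense bz1 nz1.
have [x y yx [bx xb] _ [by' _]|x y _ [bx xb] _ _|h hE] :=
  @Mint_map _ A k _ _ (order_itv_interval bb) (order_itv_interval ba').
- by split=> //; apply: preceq_trans yx xb.
- by split=> //; apply: preceq_trans xb ba'.
have Ib' : order_itv b a' b by split.
have [||phi phiE] := AR _ h (order_itv_indecomposable ba').
- apply: (@order_itv_not_isomorphic _ _ _ _ _ _ a'); first by split=> //; apply: preceq_refl.
  by move=> /IE a'b; apply: nba'.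
- move=> h0; have := hE b Ib; rewrite h0 => /(congr1 mcoef).
  by rewrite mcoef_unit // mcoef0 => /esym/eqP; rewrite oner_eq0.
have phi0 z (bz : b ⪯ z) v : z <> b -> mcoef (phi b (rmap B bz v)) = 0.
  move=> nz; have Dz : D z by split=> // bz'; apply: nz.
  have [|h1 [w <-]] := zmax z Dz (rmap B bz v); first by exists bz, v.
  rewrite hmap_nat mcoef_map // mcoef_out // => -[_ za].
  exact: naz (preceq_anti az za).
have [|x v nI|x y yx v Iy|r rE] := @to_Mint _ _ _ _ (order_itv_interval bb) B
    (fun x v => if `[< I x >] then mcoef (phi x v) else 0).
- move=> x s v w; case: asboolP => _; last by rewrite scaler0 addr0.
  by rewrite hmap_linear mcoefD mcoefZ.
- by rewrite asboolF.
- rewrite asboolT //; have yb := IE Iy; subst y.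
  case: asboolP => [/IE xb|nI]; first by subst x; rewrite rmap_id.
  by apply: phi0 => xb; apply: nI; rewrite xb.
exists r; apply: (hom_scalar_eq (x := b)) => //.
have /= := hom_ev phiE b (e b) => phifE.
by rewrite /= rE asboolT // phifE hE // !mcoef_unit.
Qed.

(** The kernels of [B b] -> [B y] shrink as [y] increases to [b] and become stationary. A lift of
    M_[b',b] -> M_b with [b'] above the critical point [y1] sends the generator at [b] to an element
    killed at [y1], hence at every point strictly below [b]; this element defines a section. *)
Lemma no_AR_right : ~ exists (Y B : rep) (f : rhom Y B) (g : rhom B Mb), AR_sequence fg f g.
Proof.
move=> [Y [B [f [g [fgses [_ nretr] _ _ AR]]]]]; apply: nretr.
have [_ Bfg _ _ _] := fgses.
have Bf := serre_pwf (serre_fg A k) Bfg.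
have [n /has_dim_findim Bn] := Bf b.
pose D := [set y | y ⪯ b /\ y <> b].
pose L y := [set v | forall h : y ⪯ b, rmap B h v = 0].
have LA y y' : y ⪯ y' -> y' ⪯ b -> L y' `<=` L y.
  by move=> yy y'b v Lv h; rewrite -(rmap_comp y'b yy h) Lv rmap0.
have [||y y' [yb ny] [yb' ny']|y1 [y1b ny1] ymin] := @chain_min _ _ _ _ D L Bn.
- by exists c.
- move=> y _; split=> [h|s v w Lv Lw h]; first exact: rmap0.
  by rewrite rmapD rmapZ Lv Lw scaler0 addr0.
- by case: (down_chain ba nba yb yb') => h; [right|left]; apply: LA.
have [b' [yb' b'b nyb' nb']] := preceq_dense y1b ny1.
have [x y _ _ [bx xb] [by' yb]|x y yx [_ xb] _ [by' _]|h hE] :=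
  @Mint_map _ A k _ _ (order_itv_interval b'b) (order_itv_interval bb).
- by split=> //; apply: preceq_trans b'b by'.
- by split=> //; apply: preceq_trans by' yx.
have Ib' : order_itv b' b b by split.
have [||s sE] := AR _ h (order_itv_indecomposable b'b).
- apply: (@order_itv_not_isomorphic _ _ _ _ _ _ b'); first by split=> //; apply: preceq_refl.
  by move=> /IE b'b0; apply: nb'.
- move=> h0; have := hE b Ib'; rewrite h0 => /(congr1 mcoef).
  by rewrite mcoef_unit // mcoef0 => /esym/eqP; rewrite oner_eq0.
pose t := s b (unit_at A k (order_itv_interval b'b) b).
have t0 y (yb : y ⪯ b) : y <> b -> rmap B yb t = 0.
  move=> ny; apply: (ymin y) => // h1.
  rewrite (hom_unit_map s h1) // unit_out ?hmap0 // => -[b'y _].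
  exact: nyb' (preceq_anti yb' b'y).
have [x nI|x y yx Ix|r rE] := @from_Mint _ _ _ _ (order_itv_interval bb) B
    (fun x => if `[< I x >] then s x (unit_at A k (order_itv_interval b'b) x) else 0).
- by rewrite asboolF.
- rewrite asboolT //; have xb := IE Ix; subst x.
  case: asboolP => [/IE yb|nI]; first by subst y; rewrite rmap_id.
  by apply: t0 => yb; apply: nI; rewrite yb.
exists r; apply: (hom_scalar_eq (x := b)) => //.
have := hom_ev sE b (unit_at A k (order_itv_interval b'b) b); rewrite hE //= => sE'.
by rewrite /= rE asboolT // mcoef_unit // scale1r sE' !mcoef_unit.
Qed.
End NoAuslanderReiten.

Theorem theorem4 (R : realType) (A : quiverA R) (k : fieldType) :
  (forall C : qrep A k -> Prop, C = Rep_pwf \/ C = Rep_b \/ C = rep_fg ->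
    forall (I J : set R) (hI : interval_set I) (hJ : interval_set J),
      C (Mint A k hI) -> C (Mint A k hJ) ->
      lmod_iso (rhom (Mint A k hI) (Mint A k hJ)) k^o \/
      (forall f : rhom (Mint A k hI) (Mint A k hJ), f = 0)) /\
  (forall C : qrep A k -> Prop, C = Rep_pwf \/ C = Rep_b \/ C = rep_fg ->
    forall (V W : qrep A k) (f : rhom V W), C V -> C W ->
      has_ker_coker_im C f) /\
  (krull_schmidt (@rep_fg R A k) /\ ~ artinian (@rep_fg R A k)) /\
  gldim_eq (@rep_fg R A k) 1 /\
  (forall C : qrep A k -> Prop, C = Rep_pwf \/ C = Rep_b \/ C = rep_fg ->
    forall (I J : set R) (hI : interval_set I) (hJ : interval_set J),
      C (Mint A k hI) -> C (Mint A k hJ) ->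
      Ext1_iso C (Mint A k hI) (Mint A k hJ) k^o \/
      Ext1_iso C (Mint A k hI) (Mint A k hJ) 'rV[k]_0) /\
  ((exists (U V W : qrep A k) (f : rhom U V) (g : rhom V W),
      AR_sequence rep_fg f g) /\
   (exists X : qrep A k, indecomposable rep_fg X /\
      ~ (exists (B Z : qrep A k) (f : rhom X B) (g : rhom B Z),
           AR_sequence rep_fg f g) /\
      ~ (exists (Y B : qrep A k) (f : rhom Y B) (g : rhom B X),
           AR_sequence rep_fg f g))).
Proof.
have sC (C : qrep A k -> Prop) : C = Rep_pwf \/ C = Rep_b \/ C = rep_fg -> serre C.
  by move=> [->|[->|->]]; [apply: serre_pwfT|apply: serre_b|apply: serre_fg].
have [c [b [a [d [cb ba ad [ncb nba nad]]]]]] := preceq_four A.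
split; first by move=> C _ I J hI hJ _ _; apply: hom_Mint_dichotomy.
split; first by move=> C /sC sC' V W f; apply: serre_ker_coker.
split; first by split; [apply: krull_schmidt_fg|apply: not_artinian_fg].
split; first exact: gldim_fg.
split; first by move=> C /sC sC' I J hI hJ CI CJ; apply: Ext1_dichotomy.
split; first exact: AR_exists cb ba ad ncb nba nad.
(* The simple representation at [b], a point with elements strictly below and strictly above it. *)
exists (Mint A k (order_itv_interval (preceq_refl A b))).
split; first exact: order_itv_indecomposable.
by split; [apply: no_AR_left cb ba ncb nba|apply: no_AR_right cb ba ncb nba].
Qed.
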